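(* Let $U(4)$ carry the Poisson--Lie structure whose tangent Lie bialgebra is $(\mathbf{u}(4),\delta_{\mathbb R})$ (see context), let $SU(2)^d\subset U(4)$ be the diagonal subgroup of block matrices $\mathrm{diag}(u,u)$, $u\in SU(2)$, let $$g=\begin{pmatrix}1&0&0&0\\0&1&0&0\\0&0&0&1\\0&0&-1&0\end{pmatrix}\in U(4),$$ and let $SU(2)^d_g=g\,SU(2)^d\,g^{-1}$. Then $SU(2)^d_g$ is a coisotropic subgroup of $U(4)$. Moreover, the corresponding bundle $\mathbb S^7=U(3)\backslash U(4)\to \mathbb S^4\simeq \mathbb S^7/SU(2)^d_g$ is a Poisson bundle.
   Context: A Poisson--Lie group is a Lie group $\mathcal G$ with a Poisson bracket $\{,\}$ (with bivector $\omega$) such that multiplication $\mathcal G\times\mathcal G\to\mathcal G$ is a Poisson map. Its tangent Lie bialgebra is $\mathfrak g=\mathrm{Lie}(\mathcal G)$ with cobracket $\delta:\mathfrak g\to\mathfrak g\wedge\mathfrak g$ given by $\langle X,d_e\{f,h\}\rangle=\langle\delta(X),d_ef\otimes d_eh\rangle$ for $X\in\mathfrak g$, $f,h\in C^\infty(\mathcal G)$. Identify $\mathbf u(4)=\mathrm{Lie}\,U(4)$ with antihermitian $4\times4$ matrices. With elementary matrices $e_{ij}$ put, for $i=1,2,3$ (the prefactor $\mathrm i$ being $\sqrt{-1}$), $H_i=\mathrm i(e_{ii}-e_{i+1,i+1})$, $E_i=\frac1{2\mathrm i}(e_{i,i+1}+e_{i+1,i})$, $F_i=\frac12(e_{i,i+1}-e_{i+1,i})$,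 and $H=\mathrm i\,\mathbb I$. The Poisson--Lie structure of $U(4)$ is the one determined by the coboundary Lie bialgebra structure with $$\delta_{\mathbb R}(H_i)=0,\quad \delta_{\mathbb R}(H)=0,\quad \delta_{\mathbb R}(E_i)=E_i\wedge H_i,\quad \delta_{\mathbb R}(F_i)=F_i\wedge H_i .$$ A submanifold $N$ of a Poisson manifold $(M,\omega)$ is coisotropic if $\omega|_{\mathrm{Ann}(TN)}=0$, where $\mathrm{Ann}(T_xN)=\{\alpha\in T_x^*M: \alpha(v)=0\ \forall v\in T_xN\}$. A Lie subgroup of a Poisson--Lie group is a coisotropic subgroup if it is a coisotropic submanifold. $U(3)\subset U(4)$ is the upper-left subgroup $\{\mathrm{diag}(v,1)\}$; it is a Poisson--Lie subgroup. $\mathbb S^7=U(3)\backslash U(4)$ (coordinates: the last row of a unitary matrix) carries the coinduced Poisson bracket, i.e. the unique one making $U(4)\to U(3)\backslash U(4)$ a Poisson map. $SU(2)^d_g$ acts on $\mathbb S^7$ by right multiplication. Saying that the bundle is a Poisson (principal) bundle means: it is a principal bundle, both the total space $\mathbb S^7$ and the base are Poisson manifolds (the base with the Poisson structure coinduced from $\mathbb S^7$), and the bundle projection is a Poisson map. *)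

(* Defs.v *)
From HB Require Import structures.
From mathcomp Require Import all_boot all_order all_algebra.
From mathcomp Require Import spectral complex.
From mathcomp Require Import all_classical all_reals all_analysis.
Set Implicit Arguments.
Unset Strict Implicit.
Unset Printing Implicit Defensive.
Import Order.TTheory GRing.Theory Num.Theory.
Import numFieldNormedType.Exports.
Local Open Scope classical_set_scope.
Local Open Scope ring_scope.

(** Every manifold below is a closed embedded submanifold [M] of some R^n.
    Since [M] is closed, C^oo(M) consists of the restrictions to [M] of the smooth
    functions on R^n, and likewise for tensor fields and for maps into R^m.
    Functions, bivectors and maps on [M] are therefore represented by smooth
    ambient objects of which only the restriction to [M] matters. *)

Section Smooth.
Context {R : realType}.

Fixpoint Ck_on (V W : normedModType R) (k : nat) (O : set V) (f : V -> W) : Prop :=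
  if k is k'.+1 then
    (forall x, O x -> differentiable f x) /\ (forall v, Ck_on k' O ('D_v f))
  else forall x, O x -> {for x, continuous f}.

(** Meaningful for open [O] only. *)
Definition smooth_on (V W : normedModType R) (O : set V) (f : V -> W) : Prop :=
  forall k, Ck_on k O f.

Definition smooth (V W : normedModType R) (f : V -> W) : Prop := smooth_on setT f.

(** Near each of its points [M] is the zero set of a submersion to some R^k. *)
Definition closed_submanifold n (M : set 'rV[R]_n) : Prop :=
  closed M /\
  forall x, M x -> exists (O : set 'rV[R]_n) (k : nat) (F : 'rV[R]_n -> 'rV[R]_k),
    [/\ open O, O x, smooth_on O F,
        (forall w, exists v, 'D_v F x = w)
      & forall y, O y -> (M y <-> F y = 0)].

Definition tangent n (M : set 'rV[R]_n) (x v : 'rV[R]_n) : Prop :=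
  exists c : R -> 'rV[R]_n,
    [/\ smooth c, (forall t, M (c t)), c 0 = x & 'D_1 c 0 = v].

(** The pairing of the 2-tensor [T] at [x] with the tensor product of the
    differentials of [f] and [h] at [x]. *)
Definition pair2 n (T : 'M[R]_n) (f h : 'rV[R]_n -> R) (x : 'rV[R]_n) : R :=
  \sum_(i < n) \sum_(j < n)
    T i j * 'D_(delta_mx 0 i) f x * 'D_(delta_mx 0 j) h x.

Definition wedge n (Y Z : 'rV[R]_n) : 'M[R]_n := Y^T *m Z - Z^T *m Y.

(** [T] belongs to the exterior square of the subspace [S] of R^n. *)
Definition in_ext2 n (S : set 'rV[R]_n) (T : 'M[R]_n) : Prop :=
  T^T = - T /\ forall i, S (row i T).

End Smooth.

Section Poisson.
Context {R : realType}.

Definition bracket n (w : 'rV[R]_n -> 'M[R]_n) (f h : 'rV[R]_n -> R) :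
  'rV[R]_n -> R := fun x => pair2 (w x) f h x.

Definition poisson_manifold n (M : set 'rV[R]_n) (w : 'rV[R]_n -> 'M[R]_n) : Prop :=
  [/\ closed_submanifold M,
      smooth w,
      (forall x, M x -> in_ext2 (tangent M x) (w x))
    & forall f g h : 'rV[R]_n -> R, smooth f -> smooth g -> smooth h ->
      forall x, M x ->
        bracket w f (bracket w g h) x + bracket w g (bracket w h f) x
        + bracket w h (bracket w f g) x = 0].

Definition poisson_map m n (M : set 'rV[R]_m) (w : 'rV[R]_m -> 'M[R]_m)
    (N : set 'rV[R]_n) (w' : 'rV[R]_n -> 'M[R]_n)
    (phi : 'rV[R]_m -> 'rV[R]_n) : Prop :=
  [/\ smooth phi, (forall x, M x -> N (phi x))
    & forall f h : 'rV[R]_n -> R, smooth f -> smooth h ->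
      forall x, M x -> bracket w (f \o phi) (h \o phi) x = bracket w' f h (phi x)].

Definition prod_set m n (M : set 'rV[R]_m) (N : set 'rV[R]_n) : set 'rV[R]_(m + n) :=
  [set z | M (lsubmx z) /\ N (rsubmx z)].

Definition prod_bivector m n (w : 'rV[R]_m -> 'M[R]_m) (w' : 'rV[R]_n -> 'M[R]_n)
    (z : 'rV[R]_(m + n)) : 'M[R]_(m + n) :=
  block_mx (w (lsubmx z)) 0 0 (w' (rsubmx z)).

(** [w'] is the unique Poisson structure on [N] making [phi] a Poisson map;
    uniqueness is that of the restriction to [N]. *)
Definition coinduced m n (M : set 'rV[R]_m) (w : 'rV[R]_m -> 'M[R]_m)
    (N : set 'rV[R]_n) (w' : 'rV[R]_n -> 'M[R]_n)
    (phi : 'rV[R]_m -> 'rV[R]_n) : Prop :=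
  [/\ poisson_manifold N w', poisson_map M w N w' phi
    & forall w'' : 'rV[R]_n -> 'M[R]_n,
        poisson_manifold N w'' -> poisson_map M w N w'' phi ->
        forall y, N y -> w'' y = w' y].

(** Covectors are represented by row vectors, paired with tangent vectors by
    [(a *m v^T) 0 0]; the representative is determined modulo the annihilator of
    the tangent space, on which the bivector vanishes. *)
Definition annihilator n (N : set 'rV[R]_n) (x : 'rV[R]_n) : set 'rV[R]_n :=
  [set a | forall v, tangent N x v -> a *m v^T = 0].

Definition coisotropic n (M : set 'rV[R]_n) (w : 'rV[R]_n -> 'M[R]_n)
    (N : set 'rV[R]_n) : Prop :=
  [/\ closed_submanifold N, N `<=` M
    & forall x, N x -> forall a b, annihilator N x a -> annihilator N x b ->
        a *m w x *m b^T = 0].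

End Poisson.

(** The real coordinates of complex m x n matrices: first all real parts, then all
    imaginary parts. *)
Notation coords R m n := 'rV[R]_(m * n + m * n).

Section Matrices.
Context {R : realType}.
Local Notation C := (complex R).

Definition cmat m n (x : coords R m n) : 'M[C]_(m, n) :=
  \matrix_(i, j) Complex (vec_mx (lsubmx x) i j) (vec_mx (rsubmx x) i j).

Definition rvec m n (A : 'M[C]_(m, n)) : coords R m n :=
  row_mx (mxvec (map_mx (@complex.Re R) A)) (mxvec (map_mx (@complex.Im R) A)).

Definition cmul m n p (x : coords R m n) (y : coords R n p) : coords R m p :=
  rvec (cmat x *m cmat y).

Definition cone : coords R 4 4 := rvec 1%:M.

Definition cinv (x : coords R 4 4) : coords R 4 4 := rvec (invmx (cmat x)).

Definition U4 : set (coords R 4 4) := [set x | cmat x \is unitarymx].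

Definition U3 : set (coords R 4 4) :=
  [set x | exists2 v : 'M[C]_3, v \is unitarymx
           & cmat x = block_mx v 0 0 (1%:M : 'M[C]_1)].

Definition gmx : 'M[C]_4 :=
  \matrix_(i, j) (nth [::] [:: [:: 1; 0; 0; 0];
                               [:: 0; 1; 0; 0];
                               [:: 0; 0; 0; 1];
                               [:: 0; 0; -1; 0]] i)`_j.

Definition SU2d : set 'M[C]_4 :=
  [set A | exists u : 'M[C]_2,
     [/\ u \is unitarymx, \det u = 1 & A = block_mx u 0 0 u]].

Definition SU2dg : set (coords R 4 4) :=
  [set x | exists2 A, SU2d A & cmat x = gmx *m A *m invmx gmx].

Definition S7 : set (coords R 1 4) := [set z | cmat z \is unitarymx].

Definition S4 : set 'rV[R]_5 := [set y | \sum_(i < 5) y 0 i ^+ 2 = 1].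

Definition last_row (x : coords R 4 4) : coords R 1 4 := rvec (row ord_max (cmat x)).

(** [phi] induces a bijection from [K \ G], the set of cosets [K x], onto [N]. *)
Definition quotient_map n (K G : set (coords R 4 4)) (N : set 'rV[R]_n)
    (phi : coords R 4 4 -> 'rV[R]_n) : Prop :=
  phi @` G = N /\
  forall x y, G x -> G y -> (phi x = phi y <-> exists2 k, K k & y = cmul k x).

Definition lie_subgroup (H : set (coords R 4 4)) : Prop :=
  [/\ H `<=` U4, H cone, (forall x y, H x -> H y -> H (cmul x y)),
      (forall x, H x -> H (cinv x)) & closed_submanifold H].

Definition poisson_lie (w : coords R 4 4 -> 'M[R]_(4 * 4 + 4 * 4)) : Prop :=
  poisson_manifold U4 w /\
  poisson_map (prod_set U4 U4) (prod_bivector w w) U4 w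
    (fun z => cmul (lsubmx z) (rsubmx z)).

Definition coisotropic_subgroup (w : coords R 4 4 -> 'M[R]_(4 * 4 + 4 * 4))
    (H : set (coords R 4 4)) : Prop :=
  lie_subgroup H /\ coisotropic U4 w H.

Definition u4 : set (coords R 4 4) :=
  [set X | map_mx Num.conj (cmat X)^T = - cmat X].

Definition lie_br (X Y : coords R 4 4) : coords R 4 4 := cmul X Y - cmul Y X.

(** [ad X (x) 1 + 1 (x) ad X] applied to [T]; the matrix of [ad X] acts on row
    vectors from the right. *)
Definition ad2 (X : coords R 4 4) (T : 'M[R]_(4 * 4 + 4 * 4)) :
    'M[R]_(4 * 4 + 4 * 4) :=
  (lin1_mx (lie_br X))^T *m T + T *m lin1_mx (lie_br X).

(** The second condition is the co-Jacobi identity: [delta (row k (delta X)^T) i j]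
    is the [(i, j, k)] coefficient of [(delta (x) 1) (delta X)]. *)
Definition coboundary_lie_bialgebra
    (delta : coords R 4 4 -> 'M[R]_(4 * 4 + 4 * 4)) : Prop :=
  (exists2 r, in_ext2 u4 r & forall X, u4 X -> delta X = ad2 X r) /\
  (forall X, u4 X -> forall i j k,
    let t a b c := delta (row c (delta X)^T) a b in
    t i j k + t j k i + t k i j = 0).

(** The pairing of [X] with the differential of [f] at the identity is
    ['D_X f cone]. *)
Definition tangent_cobracket (w : coords R 4 4 -> 'M[R]_(4 * 4 + 4 * 4))
    (delta : coords R 4 4 -> 'M[R]_(4 * 4 + 4 * 4)) : Prop :=
  forall X, u4 X -> forall f h : coords R 4 4 -> R, smooth f -> smooth h ->
    'D_X (bracket w f h) cone = pair2 (delta X) f h cone.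

Definition ci : C := Complex 0 1.

(** Matrix units with rows and columns numbered from 0. *)
Definition e_ (i j : nat) : 'M[C]_4 := delta_mx (inord i) (inord j).

Definition H_ (i : nat) : coords R 4 4 := rvec (ci *: (e_ i i - e_ i.+1 i.+1)).
Definition E_ (i : nat) : coords R 4 4 :=
  rvec ((2 * ci)^-1 *: (e_ i i.+1 + e_ i.+1 i)).
Definition F_ (i : nat) : coords R 4 4 := rvec (2^-1 *: (e_ i i.+1 - e_ i.+1 i)).
Definition Hc : coords R 4 4 := rvec (ci *: 1%:M).

Definition standard_values (delta : coords R 4 4 -> 'M[R]_(4 * 4 + 4 * 4)) : Prop :=
  delta Hc = 0 /\
  forall i : nat, (i < 3)%N ->
    [/\ delta (H_ i) = 0, delta (E_ i) = wedge (E_ i) (H_ i)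
      & delta (F_ i) = wedge (F_ i) (H_ i)].

(** A smooth principal right [H]-bundle [p : P -> B]: over [B `&` O] the map
    [z |-> (p z, t z)] is an equivariant diffeomorphism onto [(B `&` O) x H], with
    inverse [s].  As [P] and [B x H] are closed, [t] and [s] may be taken smooth on
    the open sets [p @^-1` O] and [O x R^32]. *)
Definition principal_bundle m n (H : set (coords R 4 4))
    (act : 'rV[R]_m -> coords R 4 4 -> 'rV[R]_m)
    (P : set 'rV[R]_m) (B : set 'rV[R]_n) (p : 'rV[R]_m -> 'rV[R]_n) : Prop :=
  [/\ lie_subgroup H, closed_submanifold P, closed_submanifold B,
      [/\ smooth (fun z : 'rV[R]_(m + (4 * 4 + 4 * 4)) => act (lsubmx z) (rsubmx z)),
          (forall z h, P z -> H h -> P (act z h)),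
          (forall z, P z -> act z cone = z)
        & forall z h k, P z -> H h -> H k -> act (act z h) k = act z (cmul h k)]
    & [/\ smooth p, (forall z, P z -> B (p z))
        & forall b, B b ->
          exists (O : set 'rV[R]_n) (t : 'rV[R]_m -> coords R 4 4)
                 (s : 'rV[R]_(n + (4 * 4 + 4 * 4)) -> 'rV[R]_m),
            [/\ open O /\ O b,
                smooth_on (p @^-1` O) t,
                smooth_on [set y | O (lsubmx y)] s,
                (forall z, P z -> O (p z) ->
                   [/\ H (t z), s (row_mx (p z) (t z)) = z
                     & forall h, H h ->
                       p (act z h) = p z /\ t (act z h) = cmul (t z) h])
              & (forall c h, B c -> O c -> H h ->
                   [/\ P (s (row_mx c h)), p (s (row_mx c h)) = c
                     & t (s (row_mx c h)) = h])]]].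

(** Both spaces are Poisson, the base with the structure coinduced from the total
    space. *)
Definition poisson_bundle m n (H : set (coords R 4 4))
    (act : 'rV[R]_m -> coords R 4 4 -> 'rV[R]_m)
    (P : set 'rV[R]_m) (w : 'rV[R]_m -> 'M[R]_m)
    (B : set 'rV[R]_n) (w' : 'rV[R]_n -> 'M[R]_n)
    (p : 'rV[R]_m -> 'rV[R]_n) : Prop :=
  [/\ principal_bundle H act P B p, poisson_manifold P w & coinduced P w B w' p].

End Matrices.

Arguments U4 R : clear implicits.
Arguments U3 R : clear implicits.
Arguments SU2dg R : clear implicits.
Arguments S7 R : clear implicits.
Arguments S4 R : clear implicits.
Arguments u4 R : clear implicits.

(* Main.v *)
(** The bivector [w] and the multiplicative bivector [x . r - r . x], where
    [r = 1/2 \sum_(i < j) V i j 1 /\ V i j 'i] and [V i j c = c e_ij - conj c e_ji], both trivialise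
    to 1-cocycles on U(4) whose derivatives at the identity are the cobracket: that of [r] has the
    prescribed values on the generators [H], [H_i], [E_i], [F_i], and these determine a coboundary.
    A cocycle with zero derivative vanishes along one-parameter subgroups, and these cover U(4) by
    the spectral theorem, so [w = x . r - r . x].

    Conjugation by the lower block of [g] is complex conjugation on SU(2), so the subgroup consists
    of the matrices diag(u, conj u).  A covector annihilating it takes opposite values on the
    directions (1,2) and (3,4) after conjugation, so these two terms of [r] cancel, and the four
    remaining ones form a hermitian pairing of 2 x 2 blocks that the subgroup leaves invariant;
    hence [x . r] and [r . x] agree on such covectors.

    Pushing [w] forward along the last row, the left-invariant part depends only on the row, and
    the right-invariant part reduces to [\sum_i (i x_i) /\ x_i] over the first three rows of [x],
    which by unitarity is a constant minus the contribution of the last row.  Pushing the result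
    forward along [(a, c) |-> (2 q1, 2 q2, |a|^2 - |c|^2)], where
    [su2 q1 q2 = su2 a * adjoint (su2 (conj c))] and [a], [c] are in C^2, gives a polynomial bivector in the
    image point.  Where [a] (resp. [c]) does not vanish, normalising the corresponding factor gives
    the trivialisation. *)
Require Import Defs.
From HB Require Import structures.
From mathcomp Require Import all_boot all_order all_algebra.
From mathcomp Require Import spectral complex ring lra.
From mathcomp Require Import all_classical all_reals all_analysis.
Set Implicit Arguments.
Unset Strict Implicit.
Unset Printing Implicit Defensive.
Import Order.TTheory GRing.Theory Num.Theory.
Import numFieldNormedType.Exports.
Local Open Scope classical_set_scope.
Local Open Scope ring_scope.

(** * Smooth maps and Poisson bivectors on submanifolds of R^n *)

(** Both quotient spheres rest on one principle: if a smooth map sends a Poisson manifold onto a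
    round sphere and carries the bivector to a smooth field at the image point, that field inherits
    skewness, tangency, the Jacobi identity and uniqueness. The two coinduced structures thus come
    down to matrix identities [J^T w J = w']. Polynomial identities that hold only for unit vectors
    are made homogeneous by a factor equal to the squared norm; they then hold identically and can
    be checked by ring normalisation. The cobracket is compared on adjacent roots only, because
    there the terms of [r] that share one index with the root cancel in pairs; two coboundaries
    agree on a Lie subalgebra, and the adjacent roots together with the diagonal matrices generate
    u(4). For coisotropy a real covector is encoded as a complex 4 x 4 matrix [F] of its values on
    translated root vectors. A term of [r] then becomes the imaginary part of [conj F_ij G_ij], and
    exchanging left and right translation conjugates [F] by the group element. *)

Section Calculus.
Context {R : realType}.
Implicit Types V W : normedModType R.

Lemma derive_comp V W (U : normedModType R) (f : V -> W) (g : W -> U) x v :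
  differentiable f x -> differentiable g (f x) ->
  'D_v (g \o f) x = 'D_('D_v f x) g (f x).
Proof.
move=> df dg; rewrite (deriveE v df) (deriveE _ dg) (deriveE v (differentiable_comp df dg)).
by rewrite (diff_comp df dg).
Qed.

Lemma deriveZl V W (f : V -> W) x a v : differentiable f x ->
  'D_(a *: v) f x = a *: 'D_v f x.
Proof. by move=> df; rewrite !(deriveE _ df) linearZ. Qed.

Lemma differentiable_id V (x : V) : differentiable (fun y : V => y) x.
Proof. exact: (@ex_diff _ _ _ _ _ _ _ (is_diff_id x)). Qed.

Lemma derive_rV n W (f : 'rV[R]_n -> W) x v : differentiable f x ->
  'D_v f x = \sum_i v 0 i *: 'D_(delta_mx 0 i) f x.
Proof.
move=> df; rewrite {1}[v]row_sum_delta (deriveE _ df) linear_sum; apply: eq_bigr => i _.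
by rewrite linearZ (deriveE _ df).
Qed.

Lemma differentiable_entry V m n (f : V -> 'M[R]_(m, n)) x i j :
  differentiable f x -> differentiable (fun y => f y i j) x.
Proof. by move=> df; apply: (differentiable_comp df (differentiable_coord (f x) i j)). Qed.

Lemma derive_entry V m n (f : V -> 'M[R]_(m, n)) x v i j :
  differentiable f x -> 'D_v (fun y => f y i j) x = 'D_v f x i j.
Proof. by move=> df; rewrite derive_mx ?mxE//; exact: diff_derivable. Qed.

(** Along the line the difference quotient is exactly [b + h *: c], so the derivative is read off
    from an algebraic expansion. The squared norm, bilinear products, [coboundary] and [hopf] are
    all differentiated in this way. *)
Lemma derive_quad V W (f : V -> W) x v (b c : W) :
  (forall h : R, f (h *: v + x) = f x + h *: b + h ^+ 2 *: c) -> 'D_v f x = b.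
Proof.
move=> fq; apply/cvg_lim => //.
rewrite -[X in _ --> X]addr0 -[X in _ --> _ + X](scale0r c).
apply: (@cvg_trans _ ((b + h *: c) @[h --> (0 : R)^'])).
  apply: near_eq_cvg; near=> h.
  have h0 : h != 0 by near: h; exact: nbhs_dnbhs_neq.
  rewrite /= fq -[f x + _ + _]addrA [f x + _]addrC addrK scalerDr !scalerA mulVf// scale1r.
  by rewrite expr2 mulrA mulVf// mul1r.
apply: cvgD; first exact: cvg_cst.
apply: cvgZr_tmp; apply: cvg_within; exact: cvg_id.
Unshelve. all: by end_near. Qed.
End Calculus.

(** * Differentiability classes and their closure properties *)

Section Smooth.
Context {R : realType}.
Implicit Types V W : normedModType R.

(** The difference [g - f] vanishes near [x], so it is differentiable there with differential 0, and
    [g] is the sum of this difference and [f]. *)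
Lemma near_eq_differentiable V W (f g : V -> W) x :
  (\near x, f x = g x) -> differentiable f x -> differentiable g x.
Proof.
move=> fg df; have e0 : g x - f x = 0 by rewrite (nbhs_singleton fg) subrr.
suff de : differentiable (g - f) x.
  by rewrite -[g](subrK f); exact: differentiableD.
have h0 : (g - f) \o shift x = cst ((g - f) x) + (0 : V -> W) +o_ (0 : V) id.
  apply/eqaddoP => e e_gt0; near=> y.
  rewrite /cst /= !fctE /= e0 addr0 subr0.
  have -> : f (y + x) = g (y + x).
    near: y; have := fg; rewrite (near_shift 0) /=.
    by apply: filterS => y; rewrite subr0.
  by rewrite subrr normr0 mulr_ge0// ltW.
have c0 : continuous (0 : V -> W) by move=> y; exact: cvg_cst.
have lin : linear (0 : V -> W) by move=> a u v; rewrite /= scaler0 addr0.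
pose z : {linear V -> W} := HB.pack (0 : V -> W) (GRing.isLinear.Build _ _ _ _ _ lin).
by apply/diff_locallyP; rewrite (diff_unique (df := z) c0 h0).
Unshelve. all: by end_near. Qed.

(** [Ck_on] speaks of the actual functions ['D_v f], while the differentiation rules identify them
    only at points of [O]. Openness turns equality on [O] into equality of germs, so all derivatives
    agree on [O] as well; the closure rules below use this to replace a derivative by its
    formula. *)
Lemma Ck_ext V W k (O : set V) (f g : V -> W) :
  open O -> (forall x, O x -> f x = g x) -> Ck_on k O f -> Ck_on k O g.
Proof.
move=> oO.
have nfg (f' g' : V -> W) : (forall x, O x -> f' x = g' x) ->
    forall x, O x -> \forall y \near x, f' y = g' y.
  by move=> fg x Ox; apply: filterS (fun y => fg y) _; exact: open_nbhs_nbhs.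
elim: k f g => [|k IH] f g fg /=.
  move=> fc x Ox; change (g @ x --> g x); rewrite -(fg _ Ox).
  apply: cvg_trans (fc _ Ox); apply: near_eq_cvg.
  by apply: filterS (nfg _ _ fg _ Ox) => y.
move=> [df dDf]; split.
  move=> x Ox; exact: near_eq_differentiable (nfg _ _ fg _ Ox) (df _ Ox).
move=> v; apply: IH (dDf v) => x Ox; exact/near_eq_derive/nfg.
Qed.

Lemma CkS V W k (O : set V) (f : V -> W) : Ck_on k.+1 O f -> Ck_on k O f.
Proof.
elim: k f => [|k IH] f [df dDf]; first by move=> x /df /differentiable_continuous.
by split=> // v; apply: IH; exact: dDf.
Qed.

Lemma Ck_cst V W k (O : set V) (a : W) : Ck_on k O (fun=> a).
Proof.
elim: k a => [|k IH] a; first by move=> x _; exact: cvg_cst.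
split=> [x _|v]; first exact: differentiable_cst.
by rewrite (_ : 'D_v _ = fun=> 0) //; apply/funext => x; exact: derive_cst.
Qed.

Lemma CkD V W k (O : set V) (f g : V -> W) : open O ->
  Ck_on k O f -> Ck_on k O g -> Ck_on k O (fun x => f x + g x).
Proof.
move=> oO; elim: k f g => [|k IH] f g.
  by move=> fc gc x Ox; exact: (cvgD (fc _ Ox) (gc _ Ox)).
move=> [df dDf] [dg dDg]; split=> [x Ox|v].
  exact: differentiableD (df _ Ox) (dg _ Ox).
apply: (Ck_ext (f := fun x => 'D_v f x + 'D_v g x)) (IH _ _ (dDf v) (dDg v)) => // x Ox.
by rewrite (deriveD (diff_derivable (df _ Ox)) (diff_derivable (dg _ Ox))).
Qed.

Lemma Ck_lin V W (U : normedModType R) k (O : set V) (f : V -> W)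
    (L : {linear W -> U}) : open O -> continuous L ->
  Ck_on k O f -> Ck_on k O (fun x => L (f x)).
Proof.
move=> oO cL; have dL y : differentiable L y by exact: linear_differentiable.
elim: k f => [|k IH] f.
  by move=> fc x Ox; have := @continuous_comp _ _ _ f L x (fc _ Ox) (cL _); exact.
move=> [df dDf]; split=> [x Ox|v].
  exact: differentiable_comp (df _ Ox) (dL _).
apply: (Ck_ext (f := fun x => L ('D_v f x))) (IH _ (dDf v)) => // x Ox.
by rewrite (derive_comp v (df _ Ox) (dL _)) (deriveE _ (dL _)) diff_lin.
Qed.

Lemma CkM V k (O : set V) (f g : V -> R) : open O ->
  Ck_on k O f -> Ck_on k O g -> Ck_on k O (fun x => f x * g x).
Proof.
move=> oO; elim: k f g => [|k IH] f g.
  by move=> fc gc x Ox; exact: (cvgM (fc _ Ox) (gc _ Ox)).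
move=> /[dup] Cf [df dDf] /[dup] Cg [dg dDg]; split=> [x Ox|v].
  exact: differentiableM (df _ Ox) (dg _ Ox).
apply: (Ck_ext (f := fun x => f x * 'D_v g x + g x * 'D_v f x)) => //.
  move=> x Ox.
  by rewrite (deriveM (diff_derivable (df _ Ox)) (diff_derivable (dg _ Ox))).
by apply: CkD => //; [exact: IH (CkS Cf) (dDg v)|exact: IH (CkS Cg) (dDf v)].
Qed.

Lemma Ck_sum V W k (O : set V) (I : Type) (r : seq I) (P : pred I) (f : I -> V -> W) :
  open O -> (forall i, P i -> Ck_on k O (f i)) ->
  Ck_on k O (fun x => \sum_(i <- r | P i) f i x).
Proof.
move=> oO Cf; rewrite (_ : (fun _ => _) = \sum_(i <- r | P i) f i); last first.
  by apply/funext => x; rewrite fct_sumE.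
by elim/big_ind : _ => //; [exact: Ck_cst|move=> *; exact: CkD].
Qed.

Lemma Ck_mxP V m n k (O : set V) (f : V -> 'M[R]_(m, n)) : open O ->
  Ck_on k O f <-> forall i j, Ck_on k O (fun x => f x i j).
Proof.
move=> oO; split=> [Cf i j|Cf].
  have lin : linear (fun N : 'M[R]_(m, n) => N i j : R).
    by move=> a M N; rewrite !mxE.
  pose L : {linear 'M[R]_(m, n) -> R} := HB.pack (fun N : 'M[R]_(m, n) => N i j : R)
    (GRing.isLinear.Build _ _ _ _ _ lin).
  by apply: (Ck_lin (L := L)) => //; exact: coord_continuous.
rewrite (_ : f = fun x => \sum_i \sum_j f x i j *: delta_mx i j); last first.
  by apply/funext => x; exact: matrix_sum_delta.
do 2![apply: Ck_sum => // ? _].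
have lin (N : 'M[R]_(m, n)) : linear (fun a : R => a *: N).
  by move=> a b c; rewrite scalerDl scalerA.
pose L N : {linear R -> 'M[R]_(m, n)} := HB.pack (fun a : R => a *: N)
    (GRing.isLinear.Build _ _ _ _ _ (lin N)).
by apply: (Ck_lin (L := L _)) => //; exact: scalel_continuous.
Qed.

(** Induction on the order through the chain rule in coordinates: the derivative of the composite is
    a sum of products of the entries of ['D_v f] with partial derivatives of [g] composed with [f],
    to which the induction hypothesis applies. *)
Lemma Ck_comp V n k (O : set V) (O' : set 'rV[R]_n) (f : V -> 'rV[R]_n)
    (g : 'rV[R]_n -> R) : open O -> (forall x, O x -> O' (f x)) ->
  Ck_on k O f -> Ck_on k O' g -> Ck_on k O (g \o f).
Proof.
move=> oO fO; elim: k g => [|k IH] g.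
  by move=> fc gc x Ox; exact: (continuous_comp (fc _ Ox) (gc _ (fO _ Ox))).
move=> /[dup] Cf [df dDf] [dg dDg]; split=> [x Ox|v].
  exact: differentiable_comp (df _ Ox) (dg _ (fO _ Ox)).
apply: (Ck_ext (f := fun x => \sum_i 'D_v f x 0 i * ('D_(delta_mx 0 i) g \o f) x)) => //.
  by move=> x Ox; rewrite (derive_comp v (df _ Ox) (dg _ (fO _ Ox))) derive_rV//; exact/dg/fO.
apply: Ck_sum => // i _; apply: CkM => //; last exact: IH (CkS Cf) (dDg _).
by apply: (Ck_mxP _ _ oO).1; exact: dDf.
Qed.

(** For [h = f^(-1/2)] one has [h' = - h^3 f' / 2], a polynomial in [h] and [f']. The inverse square
    root therefore satisfies a closed recursion, which drives the induction on the order. *)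
Lemma Ck_rsqrt V k (O : set V) (f : V -> R) : open O ->
  (forall x, O x -> 0 < f x) -> Ck_on k O f ->
  Ck_on k O (fun x => (Num.sqrt (f x))^-1).
Proof.
move=> oO f0; elim: k => [|k IH].
  move=> fc x Ox; apply: (@cvgV _ _ _ _ (fun x => Num.sqrt (f x))).
    by rewrite gt_eqF// sqrtr_gt0 f0.
  by apply: continuous_comp (fc _ Ox) _; exact: sqrt_continuous.
move=> /[dup] Cf [df dDf].
have dsqrt x : O x -> differentiable (Num.sqrt : R -> R) (f x).
  move=> Ox; apply/derivable1_diffP; apply: ex_derive.
  exact: is_derive1_sqrt (f0 _ Ox).
have sq0 x : O x -> Num.sqrt (f x) != 0 by move=> Ox; rewrite gt_eqF// sqrtr_gt0 f0.
have dsf x (Ox : O x) := differentiable_comp (df _ Ox) (dsqrt _ Ox).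
split=> [x Ox|v].
  by apply: (differentiableV (dsf _ Ox)); exact: sq0.
pose h x := (Num.sqrt (f x))^-1.
apply: (Ck_ext (f := fun x => (- 2^-1) * (h x * h x * h x * 'D_v f x))) => //.
  move=> x Ox; set d := 'D_v f x.
  have Ds : 'D_v (Num.sqrt \o f) x = d * (2 * Num.sqrt (f x))^-1.
    rewrite (derive_comp v (df _ Ox) (dsqrt _ Ox)) -/d -[d in LHS]mulr1.
    by rewrite -[d * 1]/(d *: (1 : R)) (deriveZl _ _ (dsqrt _ Ox)) (derive_sqrt (f0 _ Ox)).
  rewrite (deriveE v (differentiableV (dsf _ Ox) (sq0 _ Ox))) (diffV (dsf _ Ox) (sq0 _ Ox)).
  rewrite /= -(deriveE v (dsf _ Ox)) Ds /h -[_ *: _]/(_ * _).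
  by have := sq0 _ Ox; move: (Num.sqrt (f x)) => r r0; field.
have Ch : Ck_on k O h by exact: IH (CkS Cf).
apply: CkM => //; first exact: Ck_cst.
apply: CkM => //; last exact: dDf.
by apply: (CkM oO (CkM oO Ch Ch) Ch).
Qed.

Lemma differentiable_cosZ (th t : R) : differentiable (fun t : R => cos (t * th)) t /\
  forall v, 'D_v (fun t : R => cos (t * th)) t = - (v * th * sin (t * th)).
Proof.
have dM : differentiable (fun t : R => t * th) t by exact: differentiableM.
have dc : differentiable (cos : R -> R) (t * th) by exact/derivable1_diffP/derivable_cos.
split=> [|v]; first exact: (differentiable_comp dM dc).
have -> : 'D_v (fun t : R => cos (t * th)) t = 'D_v (cos \o (fun t : R => t * th)) t by [].
rewrite (derive_comp v dM dc).
have D1 : 'D_v (fun t : R => t * th) t = v * th.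
  by apply: (derive_quad (c := 0)) => h; rewrite scaler0 addr0 mulrDl addrC -scalerAl.
have E : v * th = (v * th) *: (1 : R) by rewrite -[RHS]/(_ * _) mulr1.
rewrite D1 [in LHS]E (deriveZl _ _ dc).
by rewrite (derive_val (is_derive := is_derive_cos _)) scalerN.
Qed.

Lemma differentiable_sinZ (th t : R) : differentiable (fun t : R => sin (t * th)) t /\
  forall v, 'D_v (fun t : R => sin (t * th)) t = v * th * cos (t * th).
Proof.
have dM : differentiable (fun t : R => t * th) t by exact: differentiableM.
have dc : differentiable (sin : R -> R) (t * th) by exact/derivable1_diffP/derivable_sin.
split=> [|v]; first exact: (differentiable_comp dM dc).
have -> : 'D_v (fun t : R => sin (t * th)) t = 'D_v (sin \o (fun t : R => t * th)) t by [].
rewrite (derive_comp v dM dc).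
have D1 : 'D_v (fun t : R => t * th) t = v * th.
  by apply: (derive_quad (c := 0)) => h; rewrite scaler0 addr0 mulrDl addrC -scalerAl.
have E : v * th = (v * th) *: (1 : R) by rewrite -[RHS]/(_ * _) mulr1.
rewrite D1 [in LHS]E (deriveZl _ _ dc).
by rewrite (derive_val (is_derive := is_derive_sin _)).
Qed.

Section Rotation.
Variables (W : normedModType R) (th : R).
Let rot (a b : W) (t : R) : W := cos (t * th) *: a + sin (t * th) *: b.

Lemma derive_rot a b t : differentiable (rot a b) t /\
  forall v, 'D_v (rot a b) t = rot ((v * th) *: b) (- ((v * th) *: a)) t.
Proof.
have [dc Dc] := differentiable_cosZ th t.
have [ds Ds] := differentiable_sinZ th t.
have dca := differentiableZl a dc; have dsb := differentiableZl b ds.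
split=> [|v]; first exact: differentiableD dca dsb.
have -> : rot a b = (fun t : R => cos (t * th) *: a) + (fun t : R => sin (t * th) *: b) by [].
rewrite (deriveD (diff_derivable dca) (diff_derivable dsb)).
have Dca : 'D_v (fun t : R => cos (t * th) *: a) t = - (v * th * sin (t * th)) *: a.
  by rewrite (deriveE v dca) (diffZl a dc) -(deriveE v dc) Dc.
have Dsb : 'D_v (fun t : R => sin (t * th) *: b) t = (v * th * cos (t * th)) *: b.
  by rewrite (deriveE v dsb) (diffZl b ds) -(deriveE v ds) Ds.
rewrite Dca Dsb.
rewrite /rot !scalerN !scalerA addrC; congr (_ *: _ + _); first by rewrite mulrC.
by rewrite scaleNr [in RHS]mulrC.
Qed.

(** The family [rot] is closed under differentiation, so the induction on the order runs over all
    [a] and [b] at once. *)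
Lemma smooth_rot a b : smooth (rot a b).
Proof.
move=> k; elim: k a b => [|k IH] a b.
  by move=> t _; have [/differentiable_continuous + _] := derive_rot a b t.
split=> [t _|v]; first by have [] := derive_rot a b t.
rewrite (_ : 'D_v _ = rot ((v * th) *: b) (- ((v * th) *: a))) //.
by apply/funext => t; have [_ ->] := derive_rot a b t.
Qed.

End Rotation.

End Smooth.

Section SmoothOn.
Context {R : realType}.
Implicit Types V W : normedModType R.

Lemma smooth_on_cst V W (O : set V) (a : W) : smooth_on O (fun=> a).
Proof. by move=> k; exact: Ck_cst. Qed.

Lemma smooth_onD V (O : set V) (f g : V -> R) : open O ->
  smooth_on O f -> smooth_on O g -> smooth_on O (fun x => f x + g x).
Proof. by move=> oO sf sg k; exact: CkD. Qed.

Lemma smooth_onM V (O : set V) (f g : V -> R) : open O ->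
  smooth_on O f -> smooth_on O g -> smooth_on O (fun x => f x * g x).
Proof. by move=> oO sf sg k; exact: CkM. Qed.

Lemma smooth_onN V (O : set V) (f : V -> R) : open O ->
  smooth_on O f -> smooth_on O (fun x => - f x).
Proof.
move=> oO sf; rewrite (_ : (fun _ => _) = fun x => -1 * f x).
  by apply: smooth_onM => //; exact: smooth_on_cst.
by apply/funext => x; rewrite mulN1r.
Qed.

Lemma smooth_on_sum V (O : set V) (I : Type) (r : seq I) (P : pred I)
    (f : I -> V -> R) : open O -> (forall i, P i -> smooth_on O (f i)) ->
  smooth_on O (fun x => \sum_(i <- r | P i) f i x).
Proof. by move=> oO sf k; apply: Ck_sum => // i Pi; exact: sf. Qed.

Lemma smooth_on_mxP V m n (O : set V) (f : V -> 'M[R]_(m, n)) : open O ->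
  smooth_on O f <-> forall i j, smooth_on O (fun x => f x i j).
Proof.
move=> oO; split=> sf => [i j k|k]; first exact: (Ck_mxP _ _ oO).1 (sf k) i j.
by apply/Ck_mxP => // i j; exact: sf.
Qed.

Lemma smooth_on_coord m n (O : set 'M[R]_(m, n)) i j : open O ->
  smooth_on O (fun x : 'M[R]_(m, n) => x i j).
Proof.
move=> oO; apply: (smooth_on_mxP id oO).1 => -[|k].
  by move=> x _; exact: cvg_id.
split=> [x _|v]; first exact: differentiable_id.
rewrite (_ : 'D_v _ = fun=> v); last by apply/funext => x; exact: derive_id.
exact: Ck_cst.
Qed.

Lemma smooth_on_rsqrt V (O : set V) (f : V -> R) : open O ->
  (forall x, O x -> 0 < f x) -> smooth_on O f ->
  smooth_on O (fun x => (Num.sqrt (f x))^-1).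
Proof. by move=> oO f0 sf k; exact: Ck_rsqrt. Qed.

Lemma smooth_on_derive V W (O : set V) (f : V -> W) v :
  smooth_on O f -> smooth_on O ('D_v f).
Proof. by move=> sf k; have [_] := sf k.+1; apply. Qed.

Lemma smooth_diff V W (f : V -> W) x : smooth f -> differentiable f x.
Proof. by move=> /(_ 1%N)[+ _]; apply. Qed.

Lemma smooth_compr V n (f : V -> 'rV[R]_n) (g : 'rV[R]_n -> R) :
  smooth f -> smooth g -> smooth (g \o f).
Proof. by move=> sf sg k; exact: (Ck_comp openT _ (sf k) (sg k)). Qed.

End SmoothOn.

(** * Gradients, tangent vectors and round spheres *)

Section Gradient.
Context {R : realType}.

Definition grad n (f : 'rV[R]_n -> R) (x : 'rV[R]_n) : 'rV[R]_n :=
  \row_i 'D_(delta_mx 0 i) f x.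

Lemma derive_grad n (f : 'rV[R]_n -> R) x v : differentiable f x ->
  'D_v f x = (v *m (grad f x)^T) 0 0.
Proof. by move=> df; rewrite derive_rV// mxE; apply: eq_bigr => i _; rewrite !mxE. Qed.

Lemma pair2E n (T : 'M[R]_n) (f h : 'rV[R]_n -> R) x :
  pair2 T f h x = (grad f x *m T *m (grad h x)^T) 0 0.
Proof.
rewrite mxE /pair2 exchange_big; apply: eq_bigr => j _ /=.
by rewrite !mxE mulr_suml; apply: eq_bigr => i _; rewrite !mxE (mulrC (T _ _)).
Qed.

Lemma grad_comp m n (phi : 'rV[R]_m -> 'rV[R]_n) (f : 'rV[R]_n -> R) x :
  differentiable phi x -> differentiable f (phi x) ->
  grad (f \o phi) x = grad f (phi x) *m (jacobian phi x)^T.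
Proof.
move=> dphi df; apply/rowP => i; rewrite mxE (derive_comp _ dphi df).
rewrite (derive_grad _ df) (deriveEjacobian _ dphi) -rowE !mxE.
by apply: eq_bigr => j _; rewrite !mxE mulrC.
Qed.

Lemma grad_coord n (i : 'I_n) x : grad (fun y : 'rV[R]_n => y 0 i) x = delta_mx 0 i.
Proof.
apply/rowP => j; rewrite mxE derive_entry; last exact: differentiable_id.
by rewrite derive_id !mxE eqxx eq_sym.
Qed.

Lemma pair2_coord n (T : 'M[R]_n) (i j : 'I_n) x :
  pair2 T (fun y => y 0 i) (fun y => y 0 j) x = T i j.
Proof. by rewrite pair2E !grad_coord trmx_delta -rowE -colE !mxE. Qed.

Lemma pair2_comp m n (T : 'M[R]_m) (phi : 'rV[R]_m -> 'rV[R]_n)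
    (f h : 'rV[R]_n -> R) x : differentiable phi x ->
  differentiable f (phi x) -> differentiable h (phi x) ->
  pair2 T (f \o phi) (h \o phi) x =
  pair2 ((jacobian phi x)^T *m T *m jacobian phi x) f h (phi x).
Proof.
by move=> dphi df dh; rewrite !pair2E (grad_comp dphi df) (grad_comp dphi dh) trmx_mul trmxK !mulmxA.
Qed.

Lemma smooth_bracket n (w : 'rV[R]_n -> 'M[R]_n) (f h : 'rV[R]_n -> R) :
  smooth w -> smooth f -> smooth h -> smooth (bracket w f h).
Proof.
move=> sw sf sh; rewrite /smooth /bracket /pair2. 
do 2![apply: (smooth_on_sum _ openT) => ? _].
apply: (smooth_onM openT); last exact: smooth_on_derive.
apply: (smooth_onM openT); last exact: smooth_on_derive.
exact: (smooth_on_mxP _ openT).1 sw _ _.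
Qed.

Lemma smooth_coord m n i j : smooth (fun x : 'M[R]_(m, n) => x i j).
Proof. exact: smooth_on_coord openT. Qed.

Lemma tangent_grad n (M : set 'rV[R]_n) x v (f : 'rV[R]_n -> R) a :
  tangent M x v -> (forall y, M y -> f y = a) -> differentiable f x ->
  v *m (grad f x)^T = 0.
Proof.
move=> [c [sc Mc <- <-]] fa df; apply/matrixP => i j; rewrite !ord1 [RHS]mxE.
rewrite -(derive_grad _ df) -(derive_comp _ (smooth_diff 0 sc) df).
rewrite (_ : f \o c = fun=> a); first exact: derive_cst.
by apply/funext => t; exact: fa.
Qed.

(** The rows of [T] are tangent to [M], and the gradient of [f - g] annihilates tangent vectors.
    Hence a bivector tangent to [M] sees only restrictions to [M], which makes brackets independent
    of the ambient representatives. *)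
Lemma ext2_grad n (M : set 'rV[R]_n) x T (f g : 'rV[R]_n -> R) :
  in_ext2 (tangent M x) T -> (forall y, M y -> f y = g y) ->
  differentiable f x -> differentiable g x ->
  T *m (grad f x)^T = T *m (grad g x)^T.
Proof.
move=> [_ tT] fg df dg; apply/row_matrixP => i; rewrite !row_mul.
have d : differentiable (f - g) x by exact: differentiableB.
have fg0 y : M y -> (f - g) y = 0 by move=> My; rewrite !fctE fg// subrr.
have := tangent_grad (tT i) fg0 d.
have -> : grad (f - g) x = grad f x - grad g x.
  apply/rowP => j; rewrite !mxE.
  by rewrite (deriveB (diff_derivable df) (diff_derivable dg)).
by rewrite linearB mulmxBr => /subr0_eq.
Qed.

(** Testing the bracket identity on coordinate functions yields the matrix form of the
    push-forward. *)
Lemma poisson_map_jacobian m n (M : set 'rV[R]_m) w (N : set 'rV[R]_n) w' phi x :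
  poisson_map M w N w' phi -> M x ->
  (jacobian phi x)^T *m w x *m jacobian phi x = w' (phi x).
Proof.
move=> [sphi _ br] Mx; apply/matrixP => i j.
rewrite -(pair2_coord _ i j (phi x)) -(pair2_coord (w' _) i j (phi x)).
have c k : smooth (fun y : 'rV[R]_n => y 0 k) by exact: smooth_coord.
rewrite -[RHS](br _ _ (c i) (c j) x Mx) /bracket pair2_comp//; exact: smooth_diff.
Qed.

Definition sphere n : set 'rV[R]_n := [set y | \sum_i y 0 i ^+ 2 = 1].

Lemma sqnormE n (y : 'rV[R]_n) : \sum_i y 0 i ^+ 2 = (y *m y^T) 0 0.
Proof. by rewrite mxE; apply: eq_bigr => i _; rewrite mxE expr2. Qed.

Lemma dotC n (x y : 'rV[R]_n) : x *m y^T = y *m x^T.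
Proof.
by apply/matrixP => i j; rewrite !ord1 !mxE; apply: eq_bigr => k _; rewrite !mxE mulrC.
Qed.

Lemma derive_sqnorm n (x v : 'rV[R]_n) :
  'D_v (fun y : 'rV[R]_n => \sum_i y 0 i ^+ 2) x = 2 * (v *m x^T) 0 0.
Proof.
apply: (derive_quad (c := \sum_i v 0 i ^+ 2)) => h; rewrite !sqnormE.
rewrite linearD linearZ /= mulmxDl !mulmxDr -!scalemxAl -!scalemxAr [x *m v^T]dotC !mxE.
by rewrite -![_ *: _]/(_ * _) /=; ring.
Qed.

Lemma grad_sqnorm n (x : 'rV[R]_n) :
  grad (fun y : 'rV[R]_n => \sum_i y 0 i ^+ 2) x = 2 *: x.
Proof. by apply/rowP => i; rewrite mxE derive_sqnorm -rowE !mxE. Qed.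

Lemma smooth_sqnorm n : smooth (fun y : 'rV[R]_n => \sum_i y 0 i ^+ 2).
Proof.
rewrite /smooth; apply: (smooth_on_sum _ openT) => i _; under eq_fun do rewrite expr2.
by apply: (smooth_onM openT); exact: smooth_coord.
Qed.

(** The curve is the great circle through [x] in the direction of [v], run with angular speed
    [s = |v|]. *)
Lemma tangent_sphere n (x v : 'rV[R]_n) : sphere x -> x *m v^T = 0 ->
  tangent (@sphere n) x v.
Proof.
move=> x1 xv; pose q := \sum_i v 0 i ^+ 2; pose s := Num.sqrt q.
have q0 : 0 <= q by apply: sumr_ge0 => i _; exact: sqr_ge0.
have ss : s * s = q by rewrite -expr2 sqr_sqrtr.
have v0 : s = 0 -> v = 0.
  move=> s0; have : q = 0 by rewrite -ss s0 mul0r.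
  move/eqP; rewrite psumr_eq0; last by move=> i _; exact: sqr_ge0.
  move=> /allP vi; apply/rowP => i; rewrite mxE; apply/eqP.
  by rewrite -sqrf_eq0; apply: (implyP (vi i (mem_index_enum i))).
(* For [v = 0] the convention [0^-1 = 0] makes this the constant curve. *)
pose c := fun t : R => cos (t * s) *: x + sin (t * s) *: (s^-1 *: v).
exists c; split; first exact: smooth_rot.
- move=> t; rewrite /sphere /= sqnormE.
  have E : (x *m x^T) 0 0 = 1 by rewrite -sqnormE.
  have Ev : (v *m v^T) 0 0 = q by rewrite -sqnormE.
  rewrite /c linearD !linearZ /= mulmxDl !mulmxDr -!scalemxAl -!scalemxAr [v *m x^T]dotC xv.
  rewrite !scaler0 addr0 add0r; move: (x *m x^T) (v *m v^T) E Ev => A B EA EB.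
  rewrite !mxE EA EB.
  have [s0|s0] := eqVneq s 0.
    rewrite s0 mulr0 cos0 sin0. by ring.
  rewrite -ss -[RHS](cos2Dsin2 (t * s)).
  by field.
- by rewrite /c mul0r cos0 sin0 scale1r scale0r addr0.
- have [_ /(_ 1)] := derive_rot s x (s^-1 *: v) 0; rewrite /c => ->.
  rewrite mul0r cos0 sin0 scale0r addr0 scale1r mul1r scalerA.
  have [/v0 ->|s0] := eqVneq s 0; first by rewrite scaler0.
  by rewrite divff// scale1r.
Qed.

Lemma sphere_submanifold n : closed_submanifold (@sphere n).
Proof.
split.
  have c : continuous (fun y : 'rV[R]_n => \sum_i y 0 i ^+ 2).
    by move=> x; apply: differentiable_continuous; exact/smooth_diff/smooth_sqnorm.
  exact: (preimage_closed (fun x _ => c x) (@closed_eq _ _)).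
move=> x x1; exists setT, 1%N, (fun y => const_mx (\sum_i y 0 i ^+ 2 - 1)).
have sF : smooth (fun y : 'rV[R]_n => const_mx (\sum_i y 0 i ^+ 2 - 1) : 'rV[R]_1).
  apply/(smooth_on_mxP _ openT) => i j; under eq_fun do rewrite mxE.
  by apply: (smooth_onD openT); [exact: smooth_sqnorm|exact: smooth_on_cst].
split=> //; first exact: openT.
(* The differential of the squared norm at the unit vector [x] takes the value 2 on [x] itself. *)
- move=> u; exists ((u 0 0 / 2) *: x).
  apply/rowP => i; rewrite ord1 -(derive_entry _ _ _ (smooth_diff x sF)).
  under eq_fun do rewrite mxE.
  have dS := smooth_diff x (@smooth_sqnorm n).
  have d1 := @differentiable_cst _ 'rV[R]_n R (-1) x.
  rewrite (deriveD (diff_derivable dS) (diff_derivable d1)).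
  rewrite derive_cst addr0 derive_sqnorm -scalemxAl mxE -sqnormE x1 mulr1.
  by rewrite mulrC divfK// pnatr_eq0.
- move=> y _; rewrite /sphere /=; split=> [->|/rowP/(_ 0)]; last first.
    by rewrite !mxE => /subr0_eq.
  by apply/rowP => i; rewrite !mxE subrr.
Qed.

End Gradient.

(** * Push-forward of Poisson structures onto spheres *)

Section Descent.
Context {R : realType}.

Lemma jacobian_poisson_map m n (M : set 'rV[R]_m) w (N : set 'rV[R]_n) w' phi :
  smooth phi -> (forall x, M x -> N (phi x)) ->
  (forall x, M x -> (jacobian phi x)^T *m w x *m jacobian phi x = w' (phi x)) ->
  poisson_map M w N w' phi.
Proof.
move=> sphi MN Jw; split=> // f h sf sh x Mx.
by rewrite /bracket pair2_comp ?Jw//; exact: smooth_diff.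
Qed.

(** Surjectivity lets everything be checked upstairs: brackets of [w'] pull back to brackets of [w],
    so skewness and the Jacobi identity descend, and [w'] is forced at each image point, which is
    uniqueness. Tangency holds because [|phi|^2] is constant on [M], so that [w] kills its
    gradient. *)
Lemma coinduced_sphere m n (M : set 'rV[R]_m) w w' (phi : 'rV[R]_m -> 'rV[R]_n) :
  poisson_manifold M w -> smooth phi -> phi @` M = @sphere R n -> smooth w' ->
  (forall x, M x -> (jacobian phi x)^T *m w x *m jacobian phi x = w' (phi x)) ->
  coinduced M w (@sphere R n) w' phi.
Proof.
move=> [cM sw tw jac] sphi phiM sw' Jw.
have MN x : M x -> sphere (phi x) by move=> Mx; rewrite -phiM; exists x.
have onto y : sphere y -> exists2 x, M x & phi x = y by rewrite -phiM.
have dphi x := smooth_diff x sphi.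
have brE f h x : smooth f -> smooth h -> M x ->
    bracket w (f \o phi) (h \o phi) x = bracket w' f h (phi x).
  by move=> sf sh Mx; rewrite /bracket pair2_comp ?Jw//; exact: smooth_diff.
split; last 1 first.
- move=> w'' _ pm y /onto[x Mx <-].
  by rewrite -(poisson_map_jacobian pm Mx) Jw.
- split=> //; first exact: sphere_submanifold.
  + move=> y /onto[x Mx <-]; split.
      rewrite -(Jw _ Mx) !trmx_mul trmxK (tw _ Mx).1.
      by rewrite mulNmx mulmxN mulmxA.
    move=> i; apply: tangent_sphere; first exact: MN.
    rewrite dotC -row_mul -(Jw _ Mx).
    have dq := smooth_diff (phi x) (@smooth_sqnorm R n).
    have dcst : differentiable (fun _ : 'rV[R]_m => 1 : R) x by exact: differentiable_cst.
    have := ext2_grad (f := (fun y : 'rV[R]_n => \sum_i y 0 i ^+ 2) \o phi) (tw _ Mx)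
      MN (differentiable_comp (dphi x) dq) dcst.
    rewrite (grad_comp (dphi x) dq) grad_sqnorm trmx_mul trmxK linearZ /= -!scalemxAr.
    have -> : grad (fun _ : 'rV[R]_m => 1 : R) x = 0.
      by apply/rowP => j; rewrite !mxE; exact: derive_cst.
    rewrite trmx0 mulmx0 => /(congr1 (fun A => 2^-1 *: A)).
    rewrite scalerA mulVf ?pnatr_eq0// scale1r scaler0 => E.
    by rewrite -!mulmxA E mulmx0 row0.
  + move=> f g h sf sg sh y /onto[x Mx <-].
    have sc (k : 'rV[R]_n -> R) : smooth k -> smooth (k \o phi) by exact: smooth_compr.
    have J3 f1 f2 f3 : smooth f1 -> smooth f2 -> smooth f3 ->
        bracket w' f1 (bracket w' f2 f3) (phi x) =
        bracket w (f1 \o phi) (bracket w (f2 \o phi) (f3 \o phi)) x.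
      move=> s1 s2 s3; have s23 := smooth_bracket sw' s2 s3.
      rewrite -brE// /bracket !pair2E -!mulmxA.
      (* The two inner functions agree on [M] only, which is enough because [w] is tangent to
         [M]. *)
      congr ((_ *m _) 0 0); apply: (ext2_grad (tw _ Mx)).
      - by move=> z Mz; exact/esym/(brE _ _ z s2 s3 Mz).
      - exact/smooth_diff/sc.
      - by apply/smooth_diff/smooth_bracket => //; exact: sc.
    by rewrite !J3//; apply: jac => //; exact: sc.
- exact: jacobian_poisson_map.
Qed.

Lemma smooth_linear k n (L : {linear 'rV[R]_k -> 'rV[R]_n}) : smooth L.
Proof.
apply/(smooth_on_mxP _ openT) => i j.
rewrite (_ : (fun x => _) = fun x : 'rV[R]_k => \sum_l x 0 l * lin1_mx L l j); last first.
  by apply/funext => x; rewrite -mul_rV_lin1 ord1 mxE.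
apply: (smooth_on_sum _ openT) => l _; apply: (smooth_onM openT).
  exact: smooth_coord.
exact: smooth_on_cst.
Qed.

(** The cokernel basis turns the linear equations [x = L (c x)] into a submersion. *)
Lemma sphere_image_submanifold k n (L : {linear 'rV[R]_k -> 'rV[R]_n})
    (c : {linear 'rV[R]_n -> 'rV[R]_k}) : cancel L c ->
  closed_submanifold (L @` @sphere R k).
Proof.
move=> Lc; pose d : {linear 'rV[R]_n -> 'rV[R]_n} := idfun \- (L \o c).
pose K := lin1_mx d; pose B := col_base K.
pose q (x : 'rV[R]_n) := \sum_i c x 0 i ^+ 2.
have dE x : x *m B = 0 <-> x = L (c x).
  have -> : (x *m B = 0) <-> (x *m K = 0).
    have -> : x *m K = x *m B *m row_base K by rewrite -mulmxA mulmx_base.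
    split=> [->|/eqP]; first by rewrite mul0mx.
    by rewrite mulmx_free_eq0 ?row_base_free// => /eqP.
  rewrite /K mul_rV_lin1 /d /=; split=> [/subr0_eq//|{1}->]; exact: subrr.
have ME x : (L @` @sphere R k) x <-> x = L (c x) /\ q x = 1.
  split=> [[a a1 <-]|[xE qx]]; first by rewrite /q Lc.
  by exists (c x); last exact/esym.
have sq : smooth q.
  rewrite /q; have -> : (fun x => \sum_i c x 0 i ^+ 2) =
    (fun y : 'rV[R]_k => \sum_i y 0 i ^+ 2) \o c by [].
  exact: smooth_compr (smooth_linear c) (@smooth_sqnorm R k).
split.
  have -> : L @` @sphere R k = d @^-1` [set 0] `&` q @^-1` [set 1].
    apply/seteqP; split=> x; rewrite ME /d /=.
      by move=> [xE ->]; rewrite -xE subrr.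
    by move=> [/subr0_eq xE qx]; split.
  have cd x : {for x, continuous d}.
    exact/differentiable_continuous/smooth_diff/smooth_linear.
  have cq x : {for x, continuous q} by exact/differentiable_continuous/smooth_diff.
  apply: closedI; first apply: preimage_closed (fun x _ => cd x) _.
    exact/accessible_closed_set1/hausdorff_accessible/norm_hausdorff.
  exact: (preimage_closed (fun x _ => cq x) (@closed_eq _ _)).
move=> x /ME[xE qx].
pose F (y : 'rV[R]_n) : 'rV[R]_(_ + 1) := row_mx (y *m B) (const_mx (q y - 1)).
exists setT, _, F.
have DF v : 'D_v F x = row_mx (v *m B) (const_mx (2 * (c v *m (c x)^T) 0 0)).
  apply: (derive_quad (c := row_mx 0 (const_mx (q v)))) => h.
  rewrite /F /q !sqnormE (linearP c) [_^T]linearP !mulmxDl !mulmxDr /=.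
  rewrite -!scalemxAl -!scalemxAr [c x *m (c v)^T]dotC !scale_row_mx !add_row_mx.
  congr row_mx; first by rewrite scaler0 addr0 addrC.
  move: (c v *m _) (c x *m _) (c v *m _) => X Y Z.
  by apply/matrixP => i j; rewrite !mxE /=; ring.
split=> //; first exact: openT.
- apply/(smooth_on_mxP _ openT) => i j; rewrite /F.
  case: (fintype.splitP j) => l jl.
    rewrite (_ : (fun _ => _) = fun y : 'rV[R]_n => \sum_k y 0 k * B k l); last first.
      apply/funext => y; rewrite ord1.
      by rewrite (_ : j = lshift 1 l) ?row_mxEl ?mxE//; exact: val_inj.
    apply: (smooth_on_sum _ openT) => i' _; apply: (smooth_onM openT).
      exact: smooth_coord.
    exact: smooth_on_cst.
  rewrite (_ : (fun _ => _) = fun y => q y - 1); last first.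
    apply/funext => y; rewrite ord1.
    by rewrite (_ : j = rshift _ l) ?row_mxEr ?mxE//; exact: val_inj.
  by apply: (smooth_onD openT) => //; exact: smooth_on_cst.
- move=> u; have Bf : row_full B by exact: col_base_full.
  (* [v0] solves the linear equations. A multiple of [x], which lies in the kernel of [B] and
     satisfies [q x = 1], then adjusts the last component, as the derivative of [q] along [x] is
     2. *)
  pose v0 := lsubmx u *m pinvmx B.
  have v0B : v0 *m B = lsubmx u by rewrite mulmxKpV// submx_full.
  pose s := rsubmx u 0 0 / 2 - (c v0 *m (c x)^T) 0 0.
  exists (v0 + s *: x); rewrite DF mulmxDl v0B -scalemxAl (proj2 (dE x) xE) scaler0 addr0.
  rewrite -[RHS]hsubmxK; congr row_mx; apply/matrixP => i j; rewrite !ord1 mxE.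
  rewrite linearD linearZ /= mulmxDl -scalemxAl mxE [X in _ + X]mxE.
  by rewrite -[X in _ * (_ + _ * X)]sqnormE -/(q x) qx /s; field.
- move=> y _; rewrite ME -dE /F -row_mx0; split=> [[-> ->]|/eq_row_mx[-> /matrixP/(_ 0 0)]].
    by congr row_mx; apply/matrixP => i j; rewrite !mxE subrr.
  by rewrite !mxE => /subr0_eq.
Qed.

End Descent.

(** * Complex matrices in real coordinates *)

Section Coordinates.
Context {R : realType}.
Local Notation C := (complex R).

Lemma cmatK m n (A : 'M[C]_(m, n)) : cmat (rvec A) = A.
Proof.
apply/matrixP => i j; rewrite [LHS]mxE /rvec row_mxKl row_mxKr !mxvecK !mxE.
by case: (A i j).
Qed.

Lemma rvecK m n (x : coords R m n) : rvec (cmat x) = x.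
Proof.
rewrite -[RHS]hsubmxK /rvec; congr row_mx; apply: (can_inj vec_mxK); rewrite mxvecK;
  by apply/matrixP => i j; rewrite !mxE.
Qed.

Lemma cmat_inj m n : injective (@cmat R m n).
Proof. exact: can_inj (@rvecK m n). Qed.

Lemma rvecP m n a (A B : 'M[C]_(m, n)) : rvec (a%:C *: A + B)%C = a *: rvec A + rvec B.
Proof.
rewrite /rvec scale_row_mx add_row_mx -!linearP; congr (row_mx (mxvec _) (mxvec _));
  apply/matrixP => i j; rewrite !mxE; case: (A i j) => b c; case: (B i j) => d e /=; ring.
Qed.

Lemma cmatP m n a (x y : coords R m n) : cmat (a *: x + y) = (a%:C *: cmat x + cmat y)%C.
Proof. by apply: (can_inj (@cmatK m n)); rewrite rvecP !rvecK. Qed.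

Lemma rvecD m n (A B : 'M[C]_(m, n)) : rvec (A + B) = rvec A + rvec B.
Proof. by have := rvecP 1 A B; rewrite !scale1r. Qed.

Lemma rvec0 m n : rvec (0 : 'M[C]_(m, n)) = 0.
Proof. by have := rvecD (0 : 'M[C]_(m, n)) 0; rewrite addr0 => /eqP; rewrite -subr_eq0 opprD addNKr oppr_eq0 => /eqP. Qed.

Lemma rvecZ m n a (A : 'M[C]_(m, n)) : rvec (a%:C *: A)%C = a *: rvec A.
Proof. by have := rvecP a A 0; rewrite rvec0 !addr0. Qed.

Lemma rvecN m n (A : 'M[C]_(m, n)) : rvec (- A) = - rvec A.
Proof. by rewrite -scaleN1r -[RHS]scaleN1r -rvecZ rmorphN1. Qed.

Lemma cmatZ m n a (x : coords R m n) : cmat (a *: x) = (a%:C *: cmat x)%C.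
Proof. by rewrite -[RHS]cmatK rvecZ !rvecK. Qed.

Lemma rvec_entry m n (A : 'M[C]_(m, n)) i j :
  rvec A 0 (lshift _ (mxvec_index i j)) = complex.Re (A i j) /\
  rvec A 0 (rshift _ (mxvec_index i j)) = complex.Im (A i j).
Proof. by rewrite /rvec row_mxEl row_mxEr !mxvecE !mxE. Qed.

Lemma cmat_entry m n (x : coords R m n) i j :
  complex.Re (cmat x i j) = x 0 (lshift _ (mxvec_index i j)) /\
  complex.Im (cmat x i j) = x 0 (rshift _ (mxvec_index i j)).
Proof. by rewrite !mxE. Qed.

Lemma cmat_cmul m n p (x : coords R m n) (y : coords R n p) :
  cmat (cmul x y) = cmat x *m cmat y.
Proof. exact: cmatK. Qed.

Lemma cmulA m n p q (x : coords R m n) (y : coords R n p) (z : coords R p q) :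
  cmul x (cmul y z) = cmul (cmul x y) z.
Proof. by apply: cmat_inj; rewrite !cmat_cmul mulmxA. Qed.

Lemma cmul1 m (x : coords R m 4) : cmul x cone = x.
Proof. by apply: cmat_inj; rewrite cmat_cmul cmatK mulmx1. Qed.

Lemma mul1c m (x : coords R 4 m) : cmul cone x = x.
Proof. by apply: cmat_inj; rewrite cmat_cmul cmatK mul1mx. Qed.

Lemma cmul_linearr m n p (x : coords R m n) : linear (cmul x : coords R n p -> _).
Proof. by move=> a y z; rewrite /cmul cmatP mulmxDr -scalemxAr rvecP. Qed.

Lemma cmul_linearl m n p (y : coords R n p) : linear (fun x : coords R m n => cmul x y).
Proof. by move=> a x z; rewrite /cmul cmatP mulmxDl -scalemxAl rvecP. Qed.

Definition csmooth (V : normedModType R) (f : V -> C) : Prop :=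
  smooth (fun x => complex.Re (f x)) /\ smooth (fun x => complex.Im (f x)).

Lemma csmooth_cst (V : normedModType R) (a : C) : csmooth (fun _ : V => a).
Proof. by split; exact: smooth_on_cst. Qed.

Lemma csmoothD (V : normedModType R) (f g : V -> C) : csmooth f -> csmooth g ->
  csmooth (fun x => f x + g x).
Proof.
move=> [f1 f2] [g1 g2]; split.
  rewrite (_ : (fun _ => _) = fun x => complex.Re (f x) + complex.Re (g x)).
    exact: smooth_onD openT f1 g1.
  by apply/funext => x; case: (f x); case: (g x).
rewrite (_ : (fun _ => _) = fun x => complex.Im (f x) + complex.Im (g x)).
  exact: smooth_onD openT f2 g2.
by apply/funext => x; case: (f x); case: (g x).
Qed.

Lemma csmoothM (V : normedModType R) (f g : V -> C) : csmooth f -> csmooth g ->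
  csmooth (fun x => f x * g x).
Proof.
move=> [f1 f2] [g1 g2]; split.
  rewrite (_ : (fun _ => _) = fun x => complex.Re (f x) * complex.Re (g x)
     + - (complex.Im (f x) * complex.Im (g x))).
    apply: (smooth_onD openT); first exact: smooth_onM openT f1 g1.
    apply: (smooth_onN openT); exact: smooth_onM openT f2 g2.
  by apply/funext => x; case: (f x); case: (g x).
rewrite (_ : (fun _ => _) = fun x => complex.Re (f x) * complex.Im (g x)
     + complex.Im (f x) * complex.Re (g x)).
  by apply: (smooth_onD openT); exact: smooth_onM openT _ _.
by apply/funext => x; case: (f x); case: (g x).
Qed.

Lemma csmooth_sum (V : normedModType R) (I : Type) (r : seq I) (P : pred I) (f : I -> V -> C) :
  (forall i, csmooth (f i)) -> csmooth (fun x => \sum_(i <- r | P i) f i x).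
Proof.
move=> sf; rewrite (_ : (fun _ => _) = \sum_(i <- r | P i) f i); last first.
  by apply/funext => x; rewrite fct_sumE.
by elim/big_ind : _ => //; [exact: csmooth_cst|move=> *; exact: csmoothD].
Qed.

Lemma smooth_rvec (V : normedModType R) p q (f : V -> 'M[C]_(p, q)) :
  (forall i j, csmooth (fun x => f x i j)) -> smooth (fun x => rvec (f x)).
Proof.
move=> sf; apply/(smooth_on_mxP _ openT) => i j; rewrite ord1.
case: (fintype.splitP j) => l jl.
  have -> : j = lshift _ l by exact: val_inj.
  case: (mxvec_indexP l) => a b.
  rewrite (_ : (fun _ => _) = fun y => complex.Re (f y a b)); first exact: (sf a b).1.
  by apply/funext => y; case: (rvec_entry (f y) a b).
have -> : j = rshift _ l by exact: val_inj.
case: (mxvec_indexP l) => a b.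
rewrite (_ : (fun _ => _) = fun y => complex.Im (f y a b)); first exact: (sf a b).2.
by apply/funext => y; case: (rvec_entry (f y) a b).
Qed.

Lemma csmooth_cmat (V : normedModType R) p q (f : V -> coords R p q) i j : smooth f ->
  csmooth (fun x => cmat (f x) i j).
Proof.
move=> /(smooth_on_mxP _ openT) sf; split.
  rewrite (_ : (fun _ => _) = fun x => f x 0 (lshift _ (mxvec_index i j))); first exact: sf.
  by apply/funext => y; case: (cmat_entry (f y) i j).
rewrite (_ : (fun _ => _) = fun x => f x 0 (rshift _ (mxvec_index i j))); first exact: sf.
by apply/funext => y; case: (cmat_entry (f y) i j).
Qed.

Lemma csmooth_mulmx (V : normedModType R) p q r (f : V -> 'M[C]_(p, q)) (g : V -> 'M[C]_(q, r)) :
  (forall i j, csmooth (fun x => f x i j)) -> (forall i j, csmooth (fun x => g x i j)) ->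
  forall i j, csmooth (fun x => (f x *m g x) i j).
Proof.
move=> sf sg i j; under eq_fun do rewrite mxE.
by apply: csmooth_sum => k; exact: csmoothM.
Qed.

Lemma smooth_cmul (V : normedModType R) p q r (f : V -> coords R p q) (g : V -> coords R q r) :
  smooth f -> smooth g -> smooth (fun x => cmul (f x) (g x)).
Proof.
by move=> sf sg; apply: smooth_rvec; apply: csmooth_mulmx => i j; exact: csmooth_cmat.
Qed.

Lemma smooth_id n : smooth (fun x : 'rV[R]_n => x).
Proof. by apply/(smooth_on_mxP _ openT) => i j; exact: smooth_coord. Qed.

Lemma smooth_lsubmx n p : smooth (fun x : 'rV[R]_(n + p) => lsubmx x).
Proof.
apply/(smooth_on_mxP _ openT) => i j; under eq_fun do rewrite mxE; exact: smooth_coord.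
Qed.

Lemma smooth_rsubmx n p : smooth (fun x : 'rV[R]_(n + p) => rsubmx x).
Proof.
apply/(smooth_on_mxP _ openT) => i j; under eq_fun do rewrite mxE; exact: smooth_coord.
Qed.

End Coordinates.

(** * Elementary bivectors *)

Section Wedge.
Context {R : realType}.

Lemma mul_lin1 m n (f : 'rV[R]_m -> 'rV[R]_n) (u : 'rV[R]_m) : linear f ->
  u *m lin1_mx f = f u.
Proof.
move=> lf; pose L : {linear 'rV[R]_m -> 'rV[R]_n} :=
  HB.pack f (GRing.isLinear.Build _ _ _ _ _ lf).
exact: (mul_rV_lin1 L u).
Qed.

Lemma eq_mulmxl m n (A B : 'M[R]_(m, n)) : (forall u : 'rV[R]_m, u *m A = u *m B) -> A = B.
Proof. by move=> AB; apply/row_matrixP => i; rewrite !rowE. Qed.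

Lemma wedge_push m n (J : 'M[R]_(m, n)) (Y Z : 'rV[R]_m) :
  J^T *m wedge Y Z *m J = wedge (Y *m J) (Z *m J).
Proof. by rewrite /wedge mulmxBr mulmxBl !trmx_mul !mulmxA. Qed.

Lemma wedgeC n (Y Z : 'rV[R]_n) : wedge Z Y = - wedge Y Z.
Proof. by rewrite /wedge opprB. Qed.

Lemma wedgeNl n (Y Z : 'rV[R]_n) : wedge (- Y) Z = - wedge Y Z.
Proof. by rewrite /wedge linearN /= mulNmx mulmxN opprB opprK addrC. Qed.

Lemma wedgeNr n (Y Z : 'rV[R]_n) : wedge Y (- Z) = - wedge Y Z.
Proof. by rewrite (wedgeC (- Z) Y) wedgeNl opprK wedgeC. Qed.

Lemma wedgeZl n a (Y Z : 'rV[R]_n) : wedge (a *: Y) Z = a *: wedge Y Z.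
Proof. by rewrite /wedge linearZ /= -scalemxAl -scalemxAr scalerBr. Qed.

Lemma wedgeZr n a (Y Z : 'rV[R]_n) : wedge Y (a *: Z) = a *: wedge Y Z.
Proof. by rewrite wedgeC wedgeZl [wedge Y Z]wedgeC scalerN. Qed.

Lemma wedge0l n (Z : 'rV[R]_n) : wedge 0 Z = 0.
Proof. by rewrite -(scale0r 0) wedgeZl scale0r. Qed.

Lemma wedgexx n (Y : 'rV[R]_n) : wedge Y Y = 0.
Proof. exact: subrr. Qed.

Lemma wedge0r n (Z : 'rV[R]_n) : wedge Z 0 = 0.
Proof. by rewrite wedgeC wedge0l oppr0. Qed.

Lemma wedge_form n (Y Z : 'rV[R]_n) (a b : 'rV[R]_n) :
  (a *m wedge Y Z *m b^T) 0 0 =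
  (a *m Y^T) 0 0 * (b *m Z^T) 0 0 - (a *m Z^T) 0 0 * (b *m Y^T) 0 0.
Proof.
rewrite /wedge mulmxBr mulmxBl !mulmxA -![_ *m _ *m b^T]mulmxA [Y *m b^T]dotC [Z *m b^T]dotC.
move: (a *m Y^T) (b *m Z^T) (a *m Z^T) (b *m Y^T) => A B A' B'.
by rewrite !mxE !big_ord1.
Qed.

End Wedge.

(** * The Lie algebra u(4) and its r-matrix *)

Section RootVectors.
Context {C : numClosedFieldType} {n : nat}.
Implicit Types i j k l : 'I_n.

(** The compact root vectors of [u(n)]: in the notation of the paper [E_i] and [F_i]
    are [- Vm i (i+1) 'i / 2] and [Vm i (i+1) 1 / 2], while [Vm i i 'i] is [2 'i e_ii]. *)
Definition Vm i j (c : C) : 'M[C]_n := c *: delta_mx i j - c^* *: delta_mx j i.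

Lemma VmD i j c d : Vm i j (c + d) = Vm i j c + Vm i j d.
Proof. by rewrite /Vm rmorphD /= !scalerDl opprD addrACA. Qed.

Lemma VmZ i j a c : a^* = a -> Vm i j (a * c) = a *: Vm i j c.
Proof. by move=> ra; rewrite /Vm rmorphM /= ra -!scalerA scalerBr. Qed.

Lemma Vm_sym i j c : Vm j i c = - Vm i j c^*.
Proof. by rewrite /Vm opprB conjCK. Qed.

Lemma Vm_diag i c : c^* = - c -> Vm i i c = (2 * c) *: delta_mx i i.
Proof. by rewrite /Vm => ->; rewrite scaleNr opprK -scalerDl mulr_natl. Qed.

Lemma comm_Vm i j k c d : i != j -> j != k -> i != k ->
  Vm i j c *m Vm j k d - Vm j k d *m Vm i j c = Vm i k (c * d).
Proof.
move=> ij jk ik; rewrite /Vm !mulmxBl !mulmxBr -!scalemxAl -!scalemxAr.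
rewrite !mul_delta_mx_cond !eqxx ![k == _]eq_sym ![j == i]eq_sym.
rewrite (negPf ij) (negPf jk) (negPf ik) !mulr1n !mulr0n !scaler0 !subr0 !sub0r !opprK.
by rewrite !scalerA rmorphM /= [in RHS](mulrC c^*).
Qed.

Lemma comm_Vm_same i j c d : i != j ->
  Vm i j c *m Vm i j d - Vm i j d *m Vm i j c =
  (c^* * d - c * d^*) *: (delta_mx i i - delta_mx j j).
Proof.
move=> ij; rewrite /Vm !mulmxBl !mulmxBr -!scalemxAl -!scalemxAr.
rewrite !mul_delta_mx_cond !eqxx ![j == i]eq_sym (negPf ij) !mulr1n !mulr0n !scaler0.
rewrite !subr0 !sub0r !scalerA; apply/matrixP => a b; rewrite !mxE; ring.
Qed.

Lemma comm_Vm_disjoint i j k l c d : i != k -> i != l -> j != k -> j != l ->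
  Vm i j c *m Vm k l d - Vm k l d *m Vm i j c = 0.
Proof.
move=> ik il jk jl; rewrite /Vm !mulmxBl !mulmxBr -!scalemxAl -!scalemxAr.
rewrite !mul_delta_mx_cond ![k == _]eq_sym ![l == _]eq_sym.
by rewrite (negPf ik) (negPf il) (negPf jk) (negPf jl) !mulr0n !scaler0 !subr0.
Qed.

Lemma comm_diag_Vm i j s c : i != j -> s^* = - s ->
  (s *: delta_mx i i) *m Vm i j c - Vm i j c *m (s *: delta_mx i i) = Vm i j (s * c).
Proof.
move=> ij sN; rewrite /Vm !mulmxBl !mulmxBr -!scalemxAl -!scalemxAr.
rewrite !mul_delta_mx_cond !eqxx ![j == i]eq_sym (negPf ij) !mulr1n !mulr0n !scaler0.
by rewrite !subr0 !sub0r opprK !scalerA rmorphM /= sN mulNr scaleNr opprK (mulrC c^*).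
Qed.

Lemma comm_diag_Vm0 i j k s c : k != i -> k != j ->
  (s *: delta_mx k k) *m Vm i j c - Vm i j c *m (s *: delta_mx k k) = 0.
Proof.
move=> ki kj; rewrite /Vm !mulmxBl !mulmxBr -!scalemxAl -!scalemxAr.
rewrite !mul_delta_mx_cond ![i == _]eq_sym ![j == _]eq_sym.
by rewrite (negPf ki) (negPf kj) !mulr0n !scaler0 !subr0.
Qed.

(** Antihermiticity gives [Vm i j (X i j) = X i j e_ij + X j i e_ji], so the sum over all ordered
    pairs counts [X] twice. *)
Lemma antiherm_Vm (X : 'M[C]_n) : map_mx Num.conj X^T = - X ->
  X = 2^-1 *: \sum_i \sum_j Vm i j (X i j).
Proof.
move=> Xa; have Xji i j : (X i j)^* = - X j i.
  by have := congr1 (fun A : 'M[C]_n => A j i) Xa; rewrite !mxE.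
under eq_bigr => i _ do (under eq_bigr => j _ do rewrite /Vm Xji scaleNr opprK).
under eq_bigr do rewrite big_split.
rewrite big_split /= [X in _ + X]exchange_big -!matrix_sum_delta -[X in X + X]scale1r -scalerDl.
by rewrite scalerA mulVf ?pnatr_eq0// scale1r.
Qed.

End RootVectors.

Section Wedges.
Context {R : realType} {n : nat}.
Implicit Types (X Y Z : 'rV[R]_n) (A T : 'M[R]_n).

(** The action of [A] on 2-tensors as a derivation, where matrices act on row vectors from the
    right; [ad2 X] is the case of the matrix of [ad X]. *)
Definition deriv2 A T : 'M[R]_n := A^T *m T + T *m A.

Lemma deriv2_wedge A Y Z : deriv2 A (wedge Y Z) = wedge (Y *m A) Z + wedge Y (Z *m A).
Proof.
by rewrite /deriv2 /wedge mulmxBr mulmxBl !trmx_mul !mulmxA addrACA -opprD [X in _ - X]addrC opprD addrACA.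
Qed.

Lemma deriv2_linearl T : linear (deriv2^~ T).
Proof.
move=> a A B; rewrite /deriv2 linearP mulmxDl mulmxDr -scalemxAl -scalemxAr scalerDr.
by rewrite addrACA.
Qed.

Lemma deriv2_linearr A : linear (deriv2 A).
Proof.
move=> a T T'; rewrite /deriv2 mulmxDl mulmxDr -scalemxAl -scalemxAr scalerDr.
by rewrite addrACA.
Qed.

Lemma deriv2D A T T' : deriv2 A (T + T') = deriv2 A T + deriv2 A T'.
Proof. by have := deriv2_linearr A 1 T T'; rewrite !scale1r. Qed.

Lemma deriv2Z A a T : deriv2 A (a *: T) = a *: deriv2 A T.
Proof. by rewrite /deriv2 -scalemxAr -scalemxAl scalerDr. Qed.

Lemma deriv2N A T : deriv2 A (- T) = - deriv2 A T.
Proof. by rewrite -scaleN1r deriv2Z scaleN1r. Qed.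

Lemma deriv2_comm A B T :
  deriv2 (B *m A - A *m B) T = deriv2 A (deriv2 B T) - deriv2 B (deriv2 A T).
Proof.
rewrite /deriv2 linearB /= !trmx_mul mulmxBl mulmxBr !mulmxDr !mulmxDl !mulmxA.
move: (A^T *m B^T *m T) (B^T *m A^T *m T) (A^T *m T *m B) (B^T *m T *m A) (T *m B *m A)
  (T *m A *m B) => a b c d e f.
by apply/matrixP => i j; rewrite !mxE; ring.
Qed.

(** The matrices whose derivations agree on [T] and [T'] are stable under commutators. This is what
    makes a coboundary determined by its values on Lie algebra generators. *)
Lemma deriv2_comm_eq A B T T' : deriv2 A T = deriv2 A T' -> deriv2 B T = deriv2 B T' ->
  deriv2 (B *m A - A *m B) T = deriv2 (B *m A - A *m B) T'.
Proof. by move=> hA hB; rewrite !deriv2_comm hA hB. Qed.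

Lemma linear_sub (U W : lmodType R) (f g : U -> W) :
  linear f -> linear g -> linear (fun x => f x - g x).
Proof. by move=> lf lg a x y; rewrite lf lg scalerBr opprD addrACA. Qed.

Lemma lin_opp (U W : lmodType R) (f : U -> W) x : linear f -> f (- x) = - f x.
Proof.
move=> lf; pose L : {linear U -> W} := HB.pack f (GRing.isLinear.Build _ _ _ _ _ lf).
exact: (raddfN L).
Qed.

Lemma lin1_mx_linear (f g h : 'rV[R]_n -> 'rV[R]_n) a : linear f -> linear g -> linear h ->
  (forall u, h u = a *: f u + g u) -> lin1_mx h = a *: lin1_mx f + lin1_mx g.
Proof.
move=> lf lg lh hE; apply: eq_mulmxl => u.
by rewrite mulmxDr -scalemxAr !mul_lin1.
Qed.

Lemma lin1_mx_comm (f g h : 'rV[R]_n -> 'rV[R]_n) : linear f -> linear g -> linear h ->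
  (forall u, h u = f (g u) - g (f u)) ->
  lin1_mx h = lin1_mx g *m lin1_mx f - lin1_mx f *m lin1_mx g.
Proof.
move=> lf lg lh hE; apply: eq_mulmxl => u.
by rewrite mulmxBr !mulmxA !mul_lin1.
Qed.

End Wedges.

(** The field [complex R] under a declared type [numClosedFieldType], through which the results over
    an arbitrary such field, with its conjugation, are instantiated. *)
Definition closedC (R : realType) : numClosedFieldType := complex R.

Section LieAlgebra.
Context {R : realType}.
Local Notation C' := (closedC R).
Local Notation C := (complex R).
Local Notation ci := (@ci R).
Local Notation ad X := (lin1_mx (lie_br X)).

Definition V (i j : 'I_4) (c : C) : coords R 4 4 := rvec (Vm i j c).

Lemma conj_ci : ci^* = - ci.
Proof. by apply/eqP; rewrite eq_complex /= oppr0 !eqxx. Qed.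

Lemma ciE : ci * ci = -1.
Proof. by apply/eqP; rewrite eq_complex /=; apply/andP; split; apply/eqP; ring. Qed.

Lemma conj_real (a : R) : ((a%:C)%C : C)^* = (a%:C)%C.
Proof. by apply/eqP; rewrite eq_complex /= oppr0 !eqxx. Qed.

Lemma complexE (c : C) : c = (complex.Re c)%:C%C * 1 + (complex.Im c)%:C%C * ci.
Proof. by apply/eqP; rewrite eq_complex; case: c => a b /=; apply/andP; split; apply/eqP; ring. Qed.

Lemma VD i j c d : V i j (c + d) = V i j c + V i j d.
Proof. by rewrite /V -rvecD; congr rvec; exact: VmD. Qed.

Lemma VZ i j (a : R) c : V i j ((a%:C)%C * c) = a *: V i j c.
Proof. by rewrite /V -rvecZ; congr rvec; apply: VmZ; exact: conj_real. Qed.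

Lemma VE i j c : V i j c = complex.Re c *: V i j 1 + complex.Im c *: V i j ci.
Proof. by rewrite {1}(complexE c) VD !VZ. Qed.

Lemma VN i j c : V i j (- c) = - V i j c.
Proof. by have := VZ i j (-1) c; rewrite scaleN1r rmorphN1 mulN1r. Qed.

Lemma V_sym i j c : V j i c = - V i j c^*.
Proof. by rewrite /V -rvecN; congr rvec; exact: Vm_sym. Qed.

Lemma lie_rvec (A B : 'M[C]_4) : lie_br (rvec A) (rvec B) = rvec (A *m B - B *m A).
Proof. by rewrite /lie_br /cmul !cmatK rvecD rvecN. Qed.

Lemma lie_linear (X : coords R 4 4) : linear (lie_br X).
Proof. apply: linear_sub; [exact: cmul_linearr|exact: cmul_linearl]. Qed.

Lemma lieC (X Y : coords R 4 4) : lie_br X Y = - lie_br Y X.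
Proof. by rewrite /lie_br opprB. Qed.

Lemma mul_ad (X Y : coords R 4 4) : Y *m ad X = lie_br X Y.
Proof. exact/mul_lin1/lie_linear. Qed.

Lemma lie_br_linearl (Y : coords R 4 4) : linear (fun X => lie_br X Y).
Proof. apply: linear_sub; [exact: cmul_linearl|exact: cmul_linearr]. Qed.

Lemma ad_linear (a : R) (X Y : coords R 4 4) : ad (a *: X + Y) = a *: ad X + ad Y.
Proof.
apply: lin1_mx_linear; [exact: lie_linear..|move=> u; exact: lie_br_linearl].
Qed.

Lemma jacobi_lie (X Y Z : coords R 4 4) :
  lie_br (lie_br X Y) Z = lie_br X (lie_br Y Z) - lie_br Y (lie_br X Z).
Proof.
rewrite -[X]rvecK -[Y]rvecK -[Z]rvecK !lie_rvec -rvecN -rvecD; congr rvec.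
move: (cmat X) (cmat Y) (cmat Z) => A B D; rewrite !mulmxBl !mulmxBr !mulmxA.
move: (_ *m _ *m _) (_ *m _ *m _) (_ *m _ *m _) (_ *m _ *m _) (_ *m _ *m _)
  (_ *m _ *m _) => a b c d e f.
by apply/matrixP => i j; rewrite !mxE; ring.
Qed.

Lemma ad_lie (X Y : coords R 4 4) : ad (lie_br X Y) = ad Y *m ad X - ad X *m ad Y.
Proof.
apply: lin1_mx_comm; [exact: lie_linear..|move=> u; exact: jacobi_lie].
Qed.

Lemma ad2E (X : coords R 4 4) T : ad2 X T = deriv2 (ad X) T.
Proof. by []. Qed.

Lemma ad2_linear (a : R) (X Y : coords R 4 4) T : ad2 (a *: X + Y) T = a *: ad2 X T + ad2 Y T.
Proof.
exact: etrans (congr1 (deriv2^~ T) (ad_linear a X Y)) (deriv2_linearl T a (ad X) (ad Y)).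
Qed.

Lemma lie_VV i j k c d : i != j -> j != k -> i != k ->
  lie_br (V i j c) (V j k d) = V i k (c * d).
Proof.
move=> ij jk ik; apply: etrans (lie_rvec (Vm i j c) (Vm j k d)) _.
exact: congr1 (@comm_Vm C' 4 i j k c d ij jk ik).
Qed.

Lemma lie_V_disjoint i j k l c d : i != k -> i != l -> j != k -> j != l ->
  lie_br (V i j c) (V k l d) = 0.
Proof.
move=> ik il jk jl; apply: etrans (lie_rvec (Vm i j c) (Vm k l d)) _; rewrite -rvec0.
exact: congr1 (@comm_Vm_disjoint C' 4 i j k l c d ik il jk jl).
Qed.

Definition dg (i : 'I_4) : coords R 4 4 := rvec (ci *: delta_mx i i).

Lemma lie_V_same i j : i != j -> lie_br (V i j 1) (V i j ci) = 2 *: (dg i - dg j).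
Proof.
move=> ij; apply: etrans (lie_rvec (Vm i j 1) (Vm i j ci)) _.
rewrite /dg -rvecN -rvecD -scalerBr -rvecZ scalerA.
apply: congr1; apply: etrans (@comm_Vm_same C' 4 i j 1 ci ij) _.
congr (_ *: _); rewrite conj_ci rmorph1 mul1r mulrN mul1r opprK.
by apply/eqP; rewrite eq_complex /=; apply/andP; split; apply/eqP; ring.
Qed.

Lemma lie_dg i j c : i != j -> lie_br (dg i) (V i j c) = V i j (ci * c).
Proof.
move=> ij; apply: etrans (lie_rvec (ci *: delta_mx i i) (Vm i j c)) _.
exact: congr1 (@comm_diag_Vm C' 4 i j ci c ij conj_ci).
Qed.

Lemma lie_dg0 i j k c : k != i -> k != j -> lie_br (dg k) (V i j c) = 0.
Proof.
move=> ki kj; apply: etrans (lie_rvec (ci *: delta_mx k k) (Vm i j c)) _; rewrite -rvec0.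
exact: congr1 (@comm_diag_Vm0 C' 4 i j k ci c ki kj).
Qed.

End LieAlgebra.

Section Ord4.

Lemma ord4P (P : 'I_4 -> Prop) :
  P (inord 0) -> P (inord 1) -> P (inord 2) -> P (inord 3) -> forall i, P i.
Proof. by move=> P0 P1 P2 P3 i; rewrite -(inord_val i); case: i => -[|[|[|[|]]]]. Qed.

Lemma inord4_eq a b : (a < 4)%N -> (b < 4)%N -> ((inord a : 'I_4) == inord b) = (a == b).
Proof. by move=> a4 b4; rewrite -val_eqE /= !inordK. Qed.

Lemma big_ord4 (W : nmodType) (F : 'I_4 -> W) :
  \sum_i F i = F (inord 0) + F (inord 1) + F (inord 2) + F (inord 3).
Proof.
rewrite !big_ord_recr /= big_ord0 Monoid.mul1m.
by do 3?congr (_ + _); congr F; apply: val_inj; rewrite /= inordK.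
Qed.

End Ord4.

Ltac neq4 := by rewrite inord4_eq.

(** * Generators of the Lie algebra u(4) *)

Section Generation.
Context {R : realType}.
Local Notation C' := (closedC R).
Local Notation C := (complex R).
Local Notation ci := (@ci R).

Lemma V_diag (i : 'I_4) (c : C) : V i i c = (2 * complex.Im c) *: dg i.
Proof.
rewrite VE; have -> : V i i (1 : C) = 0.
  rewrite /V -rvec0; congr rvec.
  by apply/matrixP => a b; rewrite !mxE rmorph1 subrr.
have -> : V i i ci = 2 *: dg i.
  rewrite /V /dg -rvecZ; apply: congr1; apply: etrans (@Vm_diag C' 4 i ci conj_ci) _.
  by rewrite scalerA; congr (_ *: _); rewrite rmorph_nat.
by rewrite scaler0 add0r scalerA mulrC.
Qed.

(** The constant comes from [1 / (2 i) = - i / 2]: the root vector with coefficient [ci] is [i]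
    times the symmetric combination of matrix units. *)
Lemma E_V k : E_ k = (- 2^-1) *: V (inord k) (inord k.+1) ci :> coords R 4 4.
Proof.
rewrite /E_ /V -rvecZ; apply: congr1.
have -> : Vm (inord k) (inord k.+1) ci = ci *: (e_ k k.+1 + e_ k.+1 k) :> 'M[C]_4.
  by rewrite /Vm conj_ci scaleNr opprK scalerDr.
rewrite scalerA; congr (_ *: _).
have n2 : (2 : C) != 0 by rewrite (pnatr_eq0 C').
have cN : ci != 0 by apply/eqP => c0; have /eqP := @ciE R; rewrite c0 mul0r eq_sym oppr_eq0 oner_eq0.
apply: (mulfI (mulf_neq0 n2 cN)); rewrite divff ?mulf_neq0//.
have -> : ((- 2^-1)%:C)%C = - 2^-1 :> C by rewrite rmorphN fmorphV rmorph_nat.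
by transitivity (- (ci * ci)); [rewrite ciE opprK|field].
Qed.

Lemma F_V k : F_ k = 2^-1 *: V (inord k) (inord k.+1) 1 :> coords R 4 4.
Proof.
rewrite /F_ /V -rvecZ; apply: congr1.
have -> : Vm (inord k) (inord k.+1) 1 = e_ k k.+1 - e_ k.+1 k :> 'M[C]_4.
  by rewrite /Vm rmorph1 !scale1r.
by congr (_ *: _); rewrite fmorphV rmorph_nat.
Qed.

Lemma H_dg k : H_ k = dg (inord k) - dg (inord k.+1) :> coords R 4 4.
Proof. by rewrite /H_ /dg -rvecN -rvecD scalerBr. Qed.

Lemma sum_dg : Hc = \sum_i dg i :> coords R 4 4.
Proof.
rewrite /Hc /dg -(big_morph _ (@rvecD R 4 4) (@rvec0 R 4 4)); apply: congr1.
rewrite -scaler_sumr; congr (_ *: _).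
by rewrite -diag_const_mx diag_mx_sum_delta; apply: eq_bigr => i _; rewrite mxE scale1r.
Qed.

(** Brackets of adjacent root vectors yield the remaining ones, and the differences [H_ k] together
    with the trace part [Hc] span the diagonal matrices. An induction principle is the convenient
    form, since agreement of two coboundaries is itself stable under linear combinations and
    brackets. *)
Lemma u4_ind (P : coords R 4 4 -> Prop) :
  (forall a X Y, P X -> P Y -> P (a *: X + Y)) ->
  (forall X Y, P X -> P Y -> P (lie_br X Y)) ->
  P Hc -> (forall k, (k < 3)%N -> [/\ P (H_ k), P (E_ k) & P (F_ k)]) ->
  forall X, u4 R X -> P X.
Proof.
move=> Plin Plie PHc Pgen.
have P0 : P 0 by have := Plin (-1) _ _ PHc PHc; rewrite scaleN1r addNr.
have PZ a X : P X -> P (a *: X) by move=> PX; have := Plin a _ _ PX P0; rewrite addr0.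
have PD X Y : P X -> P Y -> P (X + Y) by move=> PX PY; have := Plin 1 _ _ PX PY; rewrite scale1r.
have PN X : P X -> P (- X) by move=> PX; rewrite -scaleN1r; exact: PZ.
pose Q i j := forall c : C, P (V i j c).
have Qsym i j : Q i j -> Q j i by move=> Qij c; rewrite V_sym; exact: PN.
have Qtr i j k : i != j -> j != k -> i != k -> Q i j -> Q j k -> Q i k.
  by move=> ij jk ik Qij Qjk c; rewrite -[c]mulr1 -(lie_VV _ _ ij jk ik); exact: Plie.
have Qadj k : (k < 3)%N -> Q (inord k) (inord k.+1).
  move=> /Pgen[_ PE PF] c; rewrite VE; apply: PD; apply: (PZ).
    by have := PZ 2 _ PF; rewrite F_V scalerA mulfV ?pnatr_eq0// scale1r.
  by have := PZ (-2) _ PE; rewrite E_V scalerA mulNr mulrN opprK mulfV ?pnatr_eq0// scale1r.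
have Q01 := Qadj 0%N isT; have Q12 := Qadj 1%N isT; have Q23 := Qadj 2%N isT.
have Q02 : Q (inord 0) (inord 2) by apply: Qtr Q01 Q12; neq4.
have Q13 : Q (inord 1) (inord 3) by apply: Qtr Q12 Q23; neq4.
have Q03 : Q (inord 0) (inord 3) by apply: Qtr Q01 Q13; neq4.
have Pd : forall i, P (dg i).
  have PH k : (k < 3)%N -> P (dg (inord k) - dg (inord k.+1)).
    by move=> /Pgen[+ _ _]; rewrite H_dg.
  suff [? ? ? ?] : [/\ P (dg (inord 0)), P (dg (inord 1)), P (dg (inord 2))
    & P (dg (inord 3))] by exact: (ord4P (P := fun i => P (dg i))).
  have := PHc; rewrite sum_dg big_ord4.
  have := PH 0%N isT; have := PH 1%N isT; have := PH 2%N isT.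
  move: (dg (inord 0)) (dg (inord 1)) (dg (inord 2)) (dg (inord 3)) => d0 d1 d2 d3.
  move=> P23 P12 P01 PS.
  have Pd3 : P d3.
    (* [(d0 + d1 + d2 + d3) - ((d0 - d1) + 2 (d1 - d2) + 3 (d2 - d3)) = 4 d3]. *)
    have := PZ 4^-1 _ (PD _ _ PS (PN _ (PD _ _ P01 (PD _ _ (PZ 2 _ P12) (PZ 3 _ P23))))).
    rewrite (_ : 4^-1 *: _ = d3) //; apply/rowP => i; rewrite !mxE; by field.
  have Pd2 : P d2 by rewrite -(subrK d3 d2); exact: (PD _ _ P23 Pd3).
  have Pd1 : P d1 by rewrite -(subrK d2 d1); exact: (PD _ _ P12 Pd2).
  have Pd0 : P d0 by rewrite -(subrK d1 d0); exact: (PD _ _ P01 Pd1).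
  by split.
have QV : forall i j, Q i j.
  have Qd i : Q i i by move=> c; rewrite V_diag; exact: (PZ _ _ (Pd i)).
  apply: (ord4P (P := fun i => forall j, Q i j)); apply: (ord4P (P := Q _)).
  - exact: (Qd (inord 0)). - exact: Q01. - exact: Q02. - exact: Q03.
  - exact: (Qsym _ _ Q01). - exact: (Qd (inord 1)). - exact: Q12. - exact: Q13.
  - exact: (Qsym _ _ Q02). - exact: (Qsym _ _ Q12). - exact: (Qd (inord 2)). - exact: Q23.
  - exact: (Qsym _ _ Q03). - exact: (Qsym _ _ Q13). - exact: (Qsym _ _ Q23).
  - exact: (Qd (inord 3)).
move=> X uX; rewrite -[X]rvecK.
have -> : cmat X = (2^-1 : R)%:C%C *: \sum_i \sum_j Vm i j (cmat X i j).
  apply: etrans (@antiherm_Vm C' 4 _ uX) _.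
  by congr (_ *: _); rewrite fmorphV rmorph_nat.
rewrite rvecZ; apply: PZ.
rewrite (big_morph _ (@rvecD R 4 4) (@rvec0 R 4 4)); apply: big_ind => // i _.
rewrite (big_morph _ (@rvecD R 4 4) (@rvec0 R 4 4)); apply: big_ind => // j _.
exact: QV.
Qed.

End Generation.

(** * Derivations of bivectors and the standard r-matrix *)

Section AbstractRMatrix.
Context {R : realType} {n : nat} (A : 'M[R]_n).
Implicit Types a b c d h : 'rV[R]_n.

Lemma deriv2_rotation a b : a *m A = b -> b *m A = - a -> deriv2 A (wedge a b) = 0.
Proof. by move=> aA bA; rewrite deriv2_wedge aA bA wedgeNr !wedgexx subrr. Qed.

Lemma deriv2_kernel a b : a *m A = 0 -> b *m A = 0 -> deriv2 A (wedge a b) = 0.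
Proof. by move=> aA bA; rewrite deriv2_wedge aA bA wedge0l wedge0r addr0. Qed.

Lemma deriv2_same_l a b h : a *m A = 0 -> b *m A = h -> deriv2 A (wedge a b) = wedge a h.
Proof. by move=> aA bA; rewrite deriv2_wedge aA bA wedge0l add0r. Qed.

Lemma deriv2_same_r a b h : a *m A = - h -> b *m A = 0 -> deriv2 A (wedge a b) = wedge b h.
Proof. by move=> aA bA; rewrite deriv2_wedge aA bA wedge0r addr0 wedgeNl [RHS]wedgeC. Qed.

(** [A] turns the pairs [(a, c)] and [(b, d)] by the same infinitesimal rotation, under which
    [a /\ b + c /\ d] is invariant. *)
Lemma deriv2_pair_l a b c d : a *m A = - c -> b *m A = - d -> c *m A = a -> d *m A = b ->
  deriv2 A (wedge a b + wedge c d) = 0.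
Proof.
move=> aA bA cA dA; rewrite deriv2D !deriv2_wedge aA bA cA dA wedgeNl wedgeNr.
by rewrite -opprD [wedge c b + _]addrC addNr.
Qed.

(** Here the pairs rotated alike are [(a, d)] and [(c, b)]; this is the pattern of the root vectors
    with imaginary coefficient. *)
Lemma deriv2_pair_r a b c d : a *m A = d -> b *m A = - c -> c *m A = b -> d *m A = - a ->
  deriv2 A (wedge a b + wedge c d) = 0.
Proof.
move=> aA bA cA dA; rewrite deriv2D !deriv2_wedge aA bA cA dA !wedgeNr.
by rewrite [wedge d b]wedgeC [wedge c a]wedgeC opprK addrACA !addNr addr0.
Qed.

Lemma deriv2_half_sum t1 t2 t3 t4 t5 t6 q : deriv2 A t1 = q -> deriv2 A (t2 + t3) = 0 ->
  deriv2 A (t4 + t5) = 0 -> deriv2 A t6 = 0 ->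
  deriv2 A (2^-1 *: (t1 + (t2 + t3) + (t4 + t5) + t6)) = 2^-1 *: q.
Proof. by move=> h1 h2 h3 h4; rewrite deriv2Z !deriv2D h1 -!deriv2D h2 h3 h4 !addr0. Qed.

End AbstractRMatrix.

(* Locked, since comparing two of these by conversion unfolds all their real coordinates. *)
HB.lock Definition Vr (R : realType) (i j : 'I_4) : coords R 4 4 := V i j 1.
HB.lock Definition Vi (R : realType) (i j : 'I_4) : coords R 4 4 := V i j (@ci R).
HB.lock Definition rt (R : realType) (i j : 'I_4) : 'M[R]_(4 * 4 + 4 * 4) :=
  wedge (Vr R i j) (Vi R i j).

Section RMatrix.
Context {R : realType}.
Local Notation C' := (closedC R).
Local Notation C := (complex R).
Local Notation ci := (@ci R).
Implicit Types (X Y Z : coords R 4 4) (i j k l : 'I_4) (c : C).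

Local Notation Vr := (Vr R).
Local Notation Vi := (Vi R).
Local Notation rt := (rt R).

Lemma Vr_sym i j : Vr j i = - Vr i j.
Proof. by rewrite Vr.unlock V_sym rmorph1. Qed.

Lemma Vi_sym i j : Vi j i = Vi i j.
Proof. by rewrite Vi.unlock V_sym conj_ci VN opprK. Qed.

Lemma lie_dg_Vr i j : i != j -> lie_br (dg i) (Vr i j) = Vi i j.
Proof. by move=> ij; rewrite Vr.unlock Vi.unlock; apply: etrans (lie_dg 1 ij) _; rewrite mulr1. Qed.

Lemma lie_dg_Vi i j : i != j -> lie_br (dg i) (Vi i j) = - Vr i j.
Proof. by move=> ij; rewrite Vr.unlock Vi.unlock; apply: etrans (lie_dg ci ij) _; rewrite ciE VN. Qed.

Section Triple.
Variables (i j k : 'I_4) (ij : i != j) (jk : j != k) (ik : i != k).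

Lemma lie_VrVr : lie_br (Vr i j) (Vr j k) = Vr i k.
Proof. by rewrite Vr.unlock; apply: etrans (lie_VV 1 1 ij jk ik) _; rewrite mulr1. Qed.

Lemma lie_VrVi : lie_br (Vr i j) (Vi j k) = Vi i k.
Proof. by rewrite Vr.unlock Vi.unlock; apply: etrans (lie_VV 1 ci ij jk ik) _; rewrite mul1r. Qed.

Lemma lie_ViVr : lie_br (Vi i j) (Vr j k) = Vi i k.
Proof. by rewrite Vr.unlock Vi.unlock; apply: etrans (lie_VV ci 1 ij jk ik) _; rewrite mulr1. Qed.

Lemma lie_ViVi : lie_br (Vi i j) (Vi j k) = - Vr i k.
Proof. by rewrite Vr.unlock Vi.unlock; apply: etrans (lie_VV ci ci ij jk ik) _; rewrite ciE VN. Qed.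

End Triple.

Lemma rt_sym i j : rt j i = - rt i j.
Proof. by rewrite rt.unlock Vr_sym Vi_sym wedgeNl. Qed.

Lemma lieNl X Y : lie_br (- X) Y = - lie_br X Y.
Proof. exact: (lin_opp X (lie_br_linearl Y)). Qed.

Lemma lie_dg_Vr0 i j k : k != i -> k != j -> lie_br (dg k) (Vr i j) = 0.
Proof. rewrite Vr.unlock; exact: lie_dg0. Qed.

Lemma lie_dg_Vi0 i j k : k != i -> k != j -> lie_br (dg k) (Vi i j) = 0.
Proof. rewrite Vi.unlock; exact: lie_dg0. Qed.

Section Disjoint.
Variables (i j k l : 'I_4) (ik : i != k) (il : i != l) (jk : j != k) (jl : j != l).

Lemma lie_VrVr0 : lie_br (Vr i j) (Vr k l) = 0. Proof. rewrite Vr.unlock; exact: lie_V_disjoint. Qed.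
Lemma lie_VrVi0 : lie_br (Vr i j) (Vi k l) = 0. Proof. rewrite Vr.unlock Vi.unlock; exact: lie_V_disjoint. Qed.
Lemma lie_ViVr0 : lie_br (Vi i j) (Vr k l) = 0. Proof. rewrite Vr.unlock Vi.unlock; exact: lie_V_disjoint. Qed.
Lemma lie_ViVi0 : lie_br (Vi i j) (Vi k l) = 0. Proof. rewrite Vi.unlock; exact: lie_V_disjoint. Qed.

End Disjoint.

Definition rmat : 'M[R]_(4 * 4 + 4 * 4) := 2^-1 *: (rt (inord 0) (inord 1)
  + rt (inord 0) (inord 2) + rt (inord 0) (inord 3) + rt (inord 1) (inord 2)
  + rt (inord 1) (inord 3) + rt (inord 2) (inord 3)).

(** [dg k] rotates the plane of [Vr i j] and [Vi i j] if [k] is [i] or [j], and kills both vectors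
    otherwise. The case [k = j] is reduced to [k = i] by the antisymmetry of [rt]. *)
Lemma ad2_dg_rt i j k : i != j -> ad2 (dg k) (rt i j) = 0.
Proof.
have H a b : a != b -> ad2 (dg a) (rt a b) = 0.
  move=> ab; rewrite rt.unlock; apply: deriv2_rotation.
    exact: etrans (mul_ad _ _) (lie_dg_Vr ab).
  exact: etrans (mul_ad _ _) (lie_dg_Vi ab).
move=> ij; have [<-|ki] := eqVneq i k; first exact: H.
have [<-|kj] := eqVneq j k.
  rewrite rt_sym; apply: etrans (deriv2N _ _) _.
  by rewrite eq_sym in ij; apply: etrans (congr1 -%R (H _ _ ij)) (oppr0 _).
rewrite eq_sym in ki; rewrite eq_sym in kj.
rewrite rt.unlock; apply: deriv2_kernel; first exact: etrans (mul_ad _ _) (lie_dg_Vr0 ki kj).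
exact: etrans (mul_ad _ _) (lie_dg_Vi0 ki kj).
Qed.

Section Pairs.
Variables (i j k l : 'I_4) (ij : i != j) (ik : i != k) (il : i != l) (jk : j != k)
  (jl : j != l).
Let ji : j != i. Proof. by rewrite eq_sym. Qed.

Lemma ad2_Vr_disjoint : ad2 (Vr i j) (rt k l) = 0.
Proof.
rewrite rt.unlock; apply: deriv2_kernel; first exact: etrans (mul_ad _ _) (lie_VrVr0 ik il jk jl).
exact: etrans (mul_ad _ _) (lie_VrVi0 ik il jk jl).
Qed.

Lemma ad2_Vi_disjoint : ad2 (Vi i j) (rt k l) = 0.
Proof.
rewrite rt.unlock; apply: deriv2_kernel; first exact: etrans (mul_ad _ _) (lie_ViVr0 ik il jk jl).
exact: etrans (mul_ad _ _) (lie_ViVi0 ik il jk jl).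
Qed.

(** [Vr i j] rotates the indices [i] and [j] into each other, hence also the root planes of [i k]
    and [j k]; their bivectors are preserved only in sum. *)
Lemma ad2_Vr_pair : ad2 (Vr i j) (rt i k + rt j k) = 0.
Proof.
have s Y Z : lie_br (Vr j i) Y = Z -> lie_br (Vr i j) Y = - Z.
  by move=> <-; rewrite (Vr_sym j i) lieNl.
rewrite rt.unlock; apply: deriv2_pair_l.
- exact: etrans (mul_ad _ _) (s _ _ (lie_VrVr ji ik jk)).
- exact: etrans (mul_ad _ _) (s _ _ (lie_VrVi ji ik jk)).
- exact: etrans (mul_ad _ _) (lie_VrVr ij jk ik).
- exact: etrans (mul_ad _ _) (lie_VrVi ij jk ik).
Qed.

Lemma ad2_Vi_pair : ad2 (Vi i j) (rt i k + rt j k) = 0.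
Proof.
have s Y Z : lie_br (Vi j i) Y = Z -> lie_br (Vi i j) Y = Z by rewrite (Vi_sym j i).
rewrite rt.unlock; apply: deriv2_pair_r.
- exact: etrans (mul_ad _ _) (s _ _ (lie_ViVr ji ik jk)).
- exact: etrans (mul_ad _ _) (s _ _ (lie_ViVi ji ik jk)).
- exact: etrans (mul_ad _ _) (lie_ViVr ij jk ik).
- exact: etrans (mul_ad _ _) (lie_ViVi ij jk ik).
Qed.

Lemma lie_self X : lie_br X X = 0.
Proof. exact: subrr. Qed.

Lemma ad2_Vr_same : ad2 (Vr i j) (rt i j) = wedge (Vr i j) (2 *: (dg i - dg j)).
Proof.
rewrite rt.unlock; apply: deriv2_same_l; first exact: etrans (mul_ad _ _) (lie_self _).
by apply: etrans (mul_ad _ _) _; rewrite Vr.unlock Vi.unlock; exact: lie_V_same ij.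
Qed.

Lemma ad2_Vi_same : ad2 (Vi i j) (rt i j) = wedge (Vi i j) (2 *: (dg i - dg j)).
Proof.
rewrite rt.unlock; apply: deriv2_same_r; last exact: etrans (mul_ad _ _) (lie_self _).
by apply: etrans (mul_ad _ _) _; rewrite lieC; apply: congr1; rewrite Vr.unlock Vi.unlock; exact: lie_V_same ij.
Qed.

End Pairs.

(** An index other than [k] and [k + 1] lies on the same side of both, so its two terms enter [rmat]
    with equal orientation and are killed together. The term of the two remaining indices commutes
    with the generator, and only the term of the root itself contributes. For a non-adjacent root an
    index in between would enter with opposite orientations. *)
Lemma ad2_rmat_adjacent (k : nat) : (k < 3)%N ->
  ad2 (Vr (inord k) (inord k.+1)) rmat = wedge (Vr (inord k) (inord k.+1)) (H_ k) /\
  ad2 (Vi (inord k) (inord k.+1)) rmat = wedge (Vi (inord k) (inord k.+1)) (H_ k).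
Proof.
have half Y Z : 2^-1 *: wedge Y (2 *: Z) = wedge Y Z :> 'M[R]_(4 * 4 + 4 * 4).
  by rewrite wedgeZr scalerA mulVf ?pnatr_eq0// scale1r.
have pairN X t1 t2 : ad2 X (- t1 + - t2) = 0 -> ad2 X (t1 + t2) = 0.
  rewrite -opprD => h; apply: oppr_inj; rewrite oppr0 -h.
  exact: esym (deriv2N _ _).
have P i j k' : i != j -> j != k' -> i != k' ->
    ad2 (Vr i j) (rt i k' + rt j k') = 0 /\ ad2 (Vi i j) (rt i k' + rt j k') = 0.
  by move=> ij jk ik; split; [exact: ad2_Vr_pair|exact: ad2_Vi_pair].
have P' i j k' : i != j -> j != k' -> i != k' ->
    ad2 (Vr i j) (rt k' i + rt k' j) = 0 /\ ad2 (Vi i j) (rt k' i + rt k' j) = 0.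
  move=> ij jk ik; have [hr hi] := P _ _ _ ij jk ik.
  have e : - rt k' i + - rt k' j = rt i k' + rt j k'.
    by rewrite (rt_sym k' i) (rt_sym k' j).
  split; apply: pairN.
    exact: etrans (congr1 (ad2 (Vr i j)) e) hr.
  exact: etrans (congr1 (ad2 (Vi i j)) e) hi.
have S i j : i != j -> ad2 (Vr i j) (rt i j) = wedge (Vr i j) (2 *: (dg i - dg j)) /\
    ad2 (Vi i j) (rt i j) = wedge (Vi i j) (2 *: (dg i - dg j)).
  by move=> ij; split; [exact: ad2_Vr_same|exact: ad2_Vi_same].
have D i j k' l : i != k' -> i != l -> j != k' -> j != l ->
    ad2 (Vr i j) (rt k' l) = 0 /\ ad2 (Vi i j) (rt k' l) = 0.
  by move=> ik il jk jl; split; [exact: ad2_Vr_disjoint|exact: ad2_Vi_disjoint].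
have fin X Z t1 t2 t3 t4 t5 t6 : ad2 X t1 = wedge X (2 *: Z) -> ad2 X (t2 + t3) = 0 ->
    ad2 X (t4 + t5) = 0 -> ad2 X t6 = 0 -> rmat = 2^-1 *: (t1 + (t2 + t3) + (t4 + t5) + t6) ->
    ad2 X rmat = wedge X Z.
  move=> h1 h2 h3 h4 ->; rewrite -[RHS]half; exact: deriv2_half_sum.
have n a b : (a < 4)%N -> (b < 4)%N -> a != b -> (inord a : 'I_4) != inord b.
  by move=> a4 b4 ab; rewrite inord4_eq.
(* Each regrouping isolates the term of the root, the two cancelling pairs and the disjoint term,
   for [k] equal to 0, 1 and 2 respectively. *)
have E3 (a b c d e f : 'M[R]_(4 * 4 + 4 * 4)) : a + b + c + d + e + f = a + (b + d) + (c + e) + f.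
  by apply/matrixP => x y; rewrite !mxE; ring.
have E2 (a b c d e f : 'M[R]_(4 * 4 + 4 * 4)) : a + b + c + d + e + f = d + (a + b) + (e + f) + c.
  by apply/matrixP => x y; rewrite !mxE; ring.
have E1 (a b c d e f : 'M[R]_(4 * 4 + 4 * 4)) : a + b + c + d + e + f = f + (b + c) + (d + e) + a.
  by apply/matrixP => x y; rewrite !mxE; ring.
case: k => [|[|[|k]]] // _; rewrite H_dg.
- have [sr si] := S (inord 0) (inord 1) (n 0%N 1%N isT isT isT).
  have [ar ai] := P (inord 0) (inord 1) (inord 2) (n 0%N 1%N isT isT isT) (n 1%N 2%N isT isT isT) (n 0%N 2%N isT isT isT).
  have [br bi] := P (inord 0) (inord 1) (inord 3) (n 0%N 1%N isT isT isT) (n 1%N 3%N isT isT isT) (n 0%N 3%N isT isT isT).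
  have [dr di] := D (inord 0) (inord 1) (inord 2) (inord 3) (n 0%N 2%N isT isT isT) (n 0%N 3%N isT isT isT) (n 1%N 2%N isT isT isT) (n 1%N 3%N isT isT isT).
  split; [exact: fin sr ar br dr (congr1 _ (E3 _ _ _ _ _ _))|
          exact: fin si ai bi di (congr1 _ (E3 _ _ _ _ _ _))].
- have [sr si] := S (inord 1) (inord 2) (n 1%N 2%N isT isT isT).
  have [ar ai] := P' (inord 1) (inord 2) (inord 0) (n 1%N 2%N isT isT isT) (n 2%N 0%N isT isT isT) (n 1%N 0%N isT isT isT).
  have [br bi] := P (inord 1) (inord 2) (inord 3) (n 1%N 2%N isT isT isT) (n 2%N 3%N isT isT isT) (n 1%N 3%N isT isT isT).
  have [dr di] := D (inord 1) (inord 2) (inord 0) (inord 3) (n 1%N 0%N isT isT isT) (n 1%N 3%N isT isT isT) (n 2%N 0%N isT isT isT) (n 2%N 3%N isT isT isT).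
  split; [exact: fin sr ar br dr (congr1 _ (E2 _ _ _ _ _ _))|
          exact: fin si ai bi di (congr1 _ (E2 _ _ _ _ _ _))].
- have [sr si] := S (inord 2) (inord 3) (n 2%N 3%N isT isT isT).
  have [ar ai] := P' (inord 2) (inord 3) (inord 0) (n 2%N 3%N isT isT isT) (n 3%N 0%N isT isT isT) (n 2%N 0%N isT isT isT).
  have [br bi] := P' (inord 2) (inord 3) (inord 1) (n 2%N 3%N isT isT isT) (n 3%N 1%N isT isT isT) (n 2%N 1%N isT isT isT).
  have [dr di] := D (inord 2) (inord 3) (inord 0) (inord 1) (n 2%N 0%N isT isT isT) (n 2%N 1%N isT isT isT) (n 3%N 0%N isT isT isT) (n 3%N 1%N isT isT isT).
  split; [exact: fin sr ar br dr (congr1 _ (E1 _ _ _ _ _ _))|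
          exact: fin si ai bi di (congr1 _ (E1 _ _ _ _ _ _))].
Qed.

End RMatrix.

(** * Identification of the cobracket *)

Section Cobracket.
Context {R : realType}.
Local Notation C' := (closedC R).
Local Notation C := (complex R).
Local Notation ci := (@ci R).
Local Notation Vr := (Vr R).
Local Notation Vi := (Vi R).
Implicit Types (X Y : coords R 4 4).

Lemma ad20l T : ad2 (0 : coords R 4 4) T = 0.
Proof.
by apply: (@addrI _ (ad2 0 T)); have := ad2_linear 1 0 0 T; rewrite !scale1r !addr0.
Qed.

Lemma ad2Zl X a T : ad2 (a *: X) T = a *: ad2 X T.
Proof. by have := ad2_linear a X 0 T; rewrite ad20l !addr0. Qed.

Lemma ad2Dl X Y T : ad2 (X + Y) T = ad2 X T + ad2 Y T.
Proof. by have := ad2_linear 1 X Y T; rewrite !scale1r. Qed.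

Lemma ad2_dg_rmat k : ad2 (dg k) rmat = 0 :> 'M[R]_(4 * 4 + 4 * 4).
Proof.
have H (i j : nat) : (i < 4)%N -> (j < 4)%N -> i != j ->
    deriv2 (lin1_mx (lie_br (dg k))) (rt R (inord i) (inord j)) = 0.
  by move=> i4 j4 ij; apply: ad2_dg_rt; rewrite inord4_eq.
rewrite ad2E /rmat deriv2Z !deriv2D (H 0%N 1%N isT isT isT) (H 0%N 2%N isT isT isT).
rewrite (H 0%N 3%N isT isT isT) (H 1%N 2%N isT isT isT) (H 1%N 3%N isT isT isT).
by rewrite (H 2%N 3%N isT isT isT) !addr0 scaler0.
Qed.

Lemma u4P X : u4 R X <-> forall i j, (cmat X j i)^* = - cmat X i j.
Proof.
rewrite /u4 /=; move: (cmat X) => A; split=> [/matrixP uA i j|uA].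
  by have := uA i j; rewrite !mxE.
by apply/matrixP => i j; rewrite !mxE uA.
Qed.

Lemma u4_linear a X Y : u4 R X -> u4 R Y -> u4 R (a *: X + Y).
Proof.
move=> /u4P uX /u4P uY; apply/u4P => i j; rewrite cmatP.
move: (cmat X) (cmat Y) uX uY => A B uA uB; rewrite !mxE rmorphD rmorphM /= uA uB conj_real.
by rewrite mulrN -opprD.
Qed.

Lemma u4_V i j c : u4 R (V i j c).
Proof.
apply/u4P => a b; rewrite /V cmatK /Vm !mxE rmorphB !rmorphM !rmorph_nat /=.
by rewrite conjCK opprB ![(b == _) && _]andbC.
Qed.

Lemma u4_dg k : u4 R (dg k).
Proof.
by apply/u4P => a b; rewrite /dg cmatK !mxE rmorphM rmorph_nat /= conj_ci mulNr andbC.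
Qed.

Lemma u4_D X Y : u4 R X -> u4 R Y -> u4 R (X + Y).
Proof. by move=> uX uY; have := u4_linear 1 uX uY; rewrite scale1r. Qed.

Lemma u4_0 : u4 R 0.
Proof. by have := u4_linear (-1) (u4_dg 0) (u4_dg 0); rewrite scaleN1r addNr. Qed.

(** Only the coboundary of [r] is identified with that of [rmat], not the tensor [r] itself: the two
    agree on the generators and hence, by [deriv2_comm_eq], on the Lie algebra generated. *)
Lemma cobracket_rmat (delta : coords R 4 4 -> 'M[R]_(4 * 4 + 4 * 4)) X :
  coboundary_lie_bialgebra delta -> standard_values delta -> u4 R X ->
  delta X = ad2 X rmat.
Proof.
move=> [[r _ dr] _] [dHc dgen] uX; rewrite dr//; move: X uX.
have uZ a Y : u4 R Y -> u4 R (a *: Y).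
  by move=> uY; have := u4_linear a uY u4_0; rewrite addr0.
have uB Y Z : u4 R Y -> u4 R Z -> u4 R (Y - Z).
  by move=> uY /(uZ (-1)); rewrite scaleN1r; exact: u4_D.
apply: u4_ind.
- move=> a X Y hX hY; apply: etrans (ad2_linear a X Y r) _; rewrite hX hY.
  exact: esym (ad2_linear a X Y _).
- by move=> X Y hX hY; rewrite !ad2E ad_lie; exact: (deriv2_comm_eq hX hY).
- have uHc : u4 R Hc by rewrite sum_dg; apply: big_ind => [|Y Z|k _]; [exact: u4_0|exact: u4_D|exact: u4_dg].
  rewrite -dr// dHc sum_dg.
  apply: esym; apply: (big_ind (fun Y => ad2 Y rmat = 0)) => [|Y Z hY hZ|k _].
  + exact: ad20l.
  + by apply: etrans (ad2Dl Y Z _) _; rewrite hY hZ addr0.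
  + exact: ad2_dg_rmat.
- move=> k k3; have [dH dE dF] := dgen k k3; have [ar ai] := @ad2_rmat_adjacent R k k3.
  split.
  + rewrite -dr; last by rewrite H_dg; apply: uB; exact: u4_dg.
    rewrite dH H_dg -scaleN1r addrC; apply: esym.
    apply: etrans (ad2_linear _ _ _ _) _.
    by rewrite !ad2_dg_rmat scaler0 addr0.
  + rewrite -dr; last by rewrite E_V; apply: uZ; exact: u4_V.
    rewrite dE E_V ad2Zl wedgeZl; congr (_ *: _).
    by have := ai; rewrite Vi.unlock => ->.
  + rewrite -dr; last by rewrite F_V; apply: uZ; exact: u4_V.
    rewrite dF F_V ad2Zl wedgeZl; congr (_ *: _).
    by have := ar; rewrite Vr.unlock => ->.
Qed.

End Cobracket.

(** * Multiplicative bivectors on U(4) *)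

Section CocycleODE.
Context {R : realType}.

Lemma is_derive_translate (f : R -> R) (t d : R) :
  is_derive (0 : R) (1 : R) (fun s => f (s + t)) d -> is_derive t (1 : R) f d.
Proof.
have E : (fun h : R => h^-1 *: (((fun s => f (s + t)) \o shift 0) (h *: (1 : R)) - f (0 + t))) =
         (fun h : R => h^-1 *: ((f \o shift t) (h *: (1 : R)) - f t)).
  by apply/funext => h /=; rewrite addr0 add0r.
move=> [df fd]; split; first by move: df; rewrite /derivable E.
by move: fd; rewrite /derive E.
Qed.

(** Every Leibniz term contains either [d 0] or the derivative of [d] at 0. *)
Lemma is_derive_flat (p d q : R -> R) : derivable p 0 (1 : R) -> derivable q 0 (1 : R) ->
  d 0 = 0 -> is_derive (0 : R) (1 : R) d 0 ->
  is_derive (0 : R) (1 : R) (fun s => p s * d s * q s) 0.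
Proof.
move=> dp dq d0 dd.
have dp' := derivableP dp; have dq' := derivableP dq.
have H := @is_deriveM _ _ (p * d) q 0 1 _ _ (@is_deriveM _ _ p d 0 1 _ _ dp' dd) dq'.
apply: (is_derive_eq H); rewrite -[(p * d) 0]/(p 0 * d 0) d0 mulr0 scale0r add0r.
by rewrite scaler0 scale0r addr0 scaler0.
Qed.

(** The trivialisation [h t = A(-t)^T D(t) A(-t)] turns the cocycle rule into
    [h (s + t) = h t + B^T h(s) B], where [B = L t *m A (- t)] does not involve [s]. The derivative
    of [h] at [t] is thus a linear image of its derivative at 0, which vanishes, so [h] is constant
    and equal to [h 0 = 0]. *)
Lemma cocycle_zero n (D L A : R -> 'M[R]_n) :
  (forall s t, D (t + s) = (A s)^T *m D t *m A s + (L t)^T *m D s *m L t) ->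
  (forall s t, A (s + t) = A s *m A t) -> A 0 = 1%:M -> L 0 = 1%:M ->
  (forall s t, L t *m A s = A s *m L t) ->
  (forall i j, derivable (fun s => A s i j) 0 (1 : R)) ->
  (forall i j, is_derive (0 : R) (1 : R) (fun s => D s i j) 0) ->
  forall t, D t = 0.
Proof.
move=> DD AD A0 L0 LA dA dD.
have D0 : D 0 = 0.
  have := DD 0 0; rewrite addr0 A0 L0 !trmx1 !mul1mx !mulmx1.
  by move=> /eqP; rewrite -subr_eq subrr eq_sym => /eqP.
have AN t : A (- t) *m A t = 1%:M by rewrite -AD addNr.
have AN' t : A t *m A (- t) = 1%:M by rewrite -AD subrr.
pose h t := (A (- t))^T *m D t *m A (- t).
have hD t s : h (s + t) =
    h t + (L t *m A (- t))^T *m h s *m (L t *m A (- t)).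
  rewrite /h (addrC s t) DD.
  have E1 : A s *m A (- (t + s)) = A (- t) by rewrite -AD; congr A; ring.
  have E2 : L t *m A (- (t + s)) = A (- s) *m (L t *m A (- t)).
    by rewrite mulmxA -LA -mulmxA -AD; congr (_ *m A _); ring.
  rewrite mulmxDr mulmxDl; congr (_ + _).
    by rewrite !mulmxA -[in LHS]trmx_mul E1 -!mulmxA E1.
  by rewrite !mulmxA -[in LHS]trmx_mul E2 -!mulmxA E2 !trmx_mul !mulmxA.
have dAN i j : derivable (fun s => A (- s) i j) 0 (1 : R).
  have d1 : differentiable (fun s => A s i j) (- 0 : R).
    by rewrite oppr0; apply/derivable1_diffP; exact: dA.
  have d2 : differentiable (fun s : R => - s) (0 : R).
    by apply: differentiableN; exact: differentiable_id.
  by apply/derivable1_diffP; exact: (differentiable_comp d2 d1).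
have h0 : h 0 = 0 by rewrite /h D0 mulmx0 mul0mx.
have dh0 i j : is_derive (0 : R) (1 : R) (fun s => h s i j) 0.
  have -> : (fun s => h s i j) =
      \sum_k \sum_l (fun s => A (- s) l i * D s l k * A (- s) k j).
    apply/funext => s; rewrite /h mxE fct_sumE; apply: eq_bigr => k _.
    rewrite fct_sumE mxE mulr_suml; apply: eq_bigr => l _; by rewrite mxE.
  have z : (0 : R) = \sum_(k < n) \sum_(l < n) 0.
    by rewrite big1// => k _; rewrite big1.
  rewrite [X in is_derive _ _ _ X]z; apply: is_derive_sum => k; apply: is_derive_sum => l.
  by apply: is_derive_flat => //; rewrite D0 mxE.
have dh t i j : is_derive t (1 : R) (fun s => h s i j) 0.
  apply: is_derive_translate; pose B := L t *m A (- t).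
  have -> : (fun s => h (s + t) i j) =
      cst (h t i j) + \sum_k \sum_l (fun s => B l i * h s l k * B k j).
    apply/funext => s; rewrite hD mxE.
    rewrite -[RHS]/(h t i j + (\sum_k \sum_l (fun s => B l i * h s l k * B k j)) s).
    congr (_ + _).
    rewrite mxE fct_sumE; apply: eq_bigr => k _.
    rewrite fct_sumE mxE mulr_suml; apply: eq_bigr => l _; by rewrite mxE.
  have z : (0 : R) = 0 + \sum_(k < n) \sum_(l < n) 0.
    by rewrite add0r big1// => k _; rewrite big1.
  rewrite [X in is_derive _ _ _ X]z; apply: is_deriveD.
  apply: is_derive_sum => k; apply: is_derive_sum => l.
  apply: is_derive_flat => //; try exact: derivable_cst.
  by rewrite h0 mxE.
move=> t; have ht : h t = 0.
  apply/matrixP => i j; rewrite -h0.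
  exact: (is_derive_0_is_cst _ _ (fun x => dh x i j)).
have : (A t)^T *m h t *m A t = 0 by rewrite ht mulmx0 mul0mx.
by rewrite /h !mulmxA -trmx_mul -!mulmxA AN mulmx1 trmx1 mul1mx.
Qed.

End CocycleODE.

(** * Spectral decomposition and one-parameter subgroups *)

Section Spectral.
Local Open Scope sesquilinear_scope.
Context {C : numClosedFieldType} {n : nat}.

(** A unitary matrix is normal, hence diagonalised by a unitary [Q], and [P k] is the diagonal
    matrix unit conjugated by [Q]. With projections, products and adjoints reduce to operations on
    the coefficients [d]. *)
Lemma spectral_unitary (A : 'M[C]_n) : A \is unitarymx ->
  exists (d : 'I_n -> C) (P : 'I_n -> 'M[C]_n),
   [/\ A = \sum_k d k *: P k,
       forall k l, P k *m P l = if k == l then P k else 0,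
       \sum_k P k = 1%:M,
       forall k, map_mx Num.conj (P k)^T = P k
     & forall k, d k * (d k)^* = 1].
Proof.
move=> uA; have uA1 : A *m A^t* = 1%:M by exact/unitarymxP.
have uA2 : A^t* *m A = 1%:M by rewrite -invmx_unitary// mulVmx// unitarymx_unit.
have nA : A \is normalmx by apply/normalmxP; rewrite uA1 uA2.
have := orthomx_spectralP nA.
set Q := spectralmx A; set d := spectral_diag A => AE.
have uQ : Q \is unitarymx by exact: spectral_unitarymx.
have QQ : Q *m Q^t* = 1%:M by exact/unitarymxP.
have QQ' : Q^t* *m Q = 1%:M.
  by rewrite -invmx_unitary// mulVmx// unitarymx_unit.
rewrite invmx_unitary// in AE.
exists (d 0), (fun k => Q^t* *m delta_mx k k *m Q); split.
- rewrite {1}AE diag_mx_sum_delta mulmx_sumr mulmx_suml; apply: eq_bigr => k _.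
  by rewrite -scalemxAr -scalemxAl.
- move=> k l; rewrite !mulmxA -[_ *m Q *m Q^t*]mulmxA QQ mulmx1.
  rewrite -[_ *m delta_mx k k *m _]mulmxA mul_delta_mx_cond.
  by case: eqP => [->|]; rewrite ?mulr0n ?mulmx0 ?mul0mx.
- rewrite -mulmx_suml -mulmx_sumr.
  have -> : \sum_k delta_mx k k = 1%:M :> 'M[C]_n.
    by rewrite -diag_const_mx diag_mx_sum_delta; apply: eq_bigr => k _; rewrite mxE scale1r.
  by rewrite mulmx1.
- by move=> k; rewrite !trmx_mul !map_mxM trmx_delta map_delta_mx trmxCK mulmxA.
- move=> k; have uD : diag_mx d *m (diag_mx d)^t* = 1%:M.
    have -> : diag_mx d = Q *m A *m Q^t*.
      by rewrite AE !mulmxA QQ mul1mx -mulmxA QQ mulmx1.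
    rewrite !trmx_mul !map_mxM trmxCK !mulmxA -[_ *m Q^t* *m Q]mulmxA QQ' mulmx1.
    by rewrite -[Q *m A *m _]mulmxA uA1 mulmx1.
  have := congr1 (fun M : 'M[C]_n => M k k) uD.
  rewrite mul_diag_mx !mxE eqxx mulr1n.
  by rewrite ?mulr1n.
Qed.

Section Projections.
Variable P : 'I_n -> 'M[C]_n.
Hypotheses (PP : forall k l, P k *m P l = if k == l then P k else 0)
  (P1 : \sum_k P k = 1%:M) (Padj : forall k, map_mx Num.conj (P k)^T = P k).

Lemma mul_projections (d e : 'I_n -> C) :
  (\sum_k d k *: P k) *m (\sum_k e k *: P k) = \sum_k (d k * e k) *: P k.
Proof.
rewrite mulmx_suml; apply: eq_bigr => k _; rewrite mulmx_sumr (bigD1 k)//= big1 => [|l lk].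
  by rewrite addr0 -scalemxAl -scalemxAr PP eqxx scalerA.
by rewrite -scalemxAl -scalemxAr PP eq_sym (negPf lk) !scaler0.
Qed.

Lemma adj_projections (d : 'I_n -> C) :
  map_mx Num.conj (\sum_k d k *: P k)^T = \sum_k (d k)^* *: P k.
Proof.
rewrite linear_sum raddf_sum /=; apply: eq_bigr => k _.
by rewrite linearZ /= map_mxZ Padj.
Qed.

Lemma unitary_projections (d : 'I_n -> C) : (forall k, d k * (d k)^* = 1) ->
  (\sum_k d k *: P k) \is unitarymx.
Proof.
move=> d1; apply/unitarymxP; rewrite adj_projections mul_projections -P1.
by apply: eq_bigr => k _; rewrite d1 scale1r.
Qed.

End Projections.

End Spectral.

Section OneParameter.
Context {R : realType}.
Local Notation C := (complex R).
Local Notation C' := (closedC R).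
Local Notation ci := (@ci R).

Lemma unit_circle (a b : R) : a ^+ 2 + b ^+ 2 = 1 -> exists th, a = cos th /\ b = sin th.
Proof.
move=> ab; have a1 : -1 <= a <= 1.
  rewrite -ler_norml -(expr_le1 (n := 2))// -normrX ger0_norm ?sqr_ge0// -ab lerDl.
  exact: sqr_ge0.
have sa : Num.sqrt (1 - a ^+ 2) = `|b| by rewrite -ab addrC addKr sqrtr_sqr.
have ac : cos (acos a) = a by rewrite acosK.
have [b0|b0] := leP 0 b.
  by exists (acos a); rewrite ac sin_acos// sa ger0_norm.
by exists (- acos a); rewrite cosN sinN ac sin_acos// sa ltr0_norm// opprK.
Qed.

Lemma rvec_complexZ m n (a b : R) (A : 'M[C]_(m, n)) :
  rvec (Complex a b *: A) = a *: rvec A + b *: rvec (ci *: A).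
Proof.
rewrite -!rvecZ -rvecD scalerA -scalerDl; congr (rvec (_ *: _)).
by apply/eqP; rewrite eq_complex /=; apply/andP; split; apply/eqP; ring.
Qed.

(** The eigenvalues [exp (i th_k)] of [x] are replaced by [exp (i t th_k)] on the same projections.
    This gives a smooth homomorphism through [x] without a matrix exponential; its velocity at 0 is
    [i] times the sum of the [th_k P_k], which is antihermitian. *)
Lemma U4_one_parameter (x : coords R 4 4) : U4 R x ->
  exists g : R -> coords R 4 4,
    [/\ smooth g, forall t, U4 R (g t), g 0 = cone /\ g 1 = x,
        forall s t, g (s + t) = cmul (g s) (g t) & u4 R ('D_1 g 0)].
Proof.
move=> Ux; have [d [P [xE PP P1 Padj d1]]] := @spectral_unitary C' 4 (cmat x) Ux.
have ex : forall k, exists th, d k = Complex (cos th) (sin th).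
  move=> k; have := d1 k; case: (d k) => a b /eqP; rewrite eq_complex /= => /andP[/eqP ab _].
  have [th [-> ->]] : exists th, a = cos th /\ b = sin th.
    by apply: unit_circle; rewrite -ab; ring.
  by exists th.
have [th thE] := choice ex.
pose e t k : C := Complex (cos (t * th k)) (sin (t * th k)).
pose gm t : 'M[C]_4 := \sum_k (e t k : C') *: P k.
pose g t : coords R 4 4 := rvec (gm t).
have e1 t k : (e t k : C') * (e t k)^* = 1.
  apply/eqP; rewrite eq_complex /=; apply/andP; split; apply/eqP; last by ring.
  by rewrite -(cos2Dsin2 (t * th k)); ring.
have eD s t k : e (s + t) k = (e s k : C') * e t k.
  rewrite /e mulrDl cosD sinD; apply/eqP; rewrite eq_complex /=.
  by apply/andP; split; apply/eqP; ring.
have gE : g = fun t => \sum_k (cos (t * th k) *: rvec (P k) +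
    sin (t * th k) *: rvec (ci *: P k)).
  apply/funext => t; rewrite /g /gm (big_morph _ (@rvecD R 4 4) (@rvec0 R 4 4)).
  by apply: eq_bigr => k _; exact: rvec_complexZ.
exists g; split.
- rewrite gE => k; apply: Ck_sum => [|l _]; first exact: openT.
  exact: smooth_rot.
- move=> t; rewrite /U4 /= /g cmatK; exact: (unitary_projections PP P1 Padj (e1 t)).
- split; rewrite /g.
    rewrite /cone; congr rvec; rewrite -P1; apply: eq_bigr => k _.
    by rewrite /e mul0r cos0 sin0; exact: scale1r.
  rewrite -[RHS]rvecK; congr rvec; rewrite xE; apply: eq_bigr => k _.
  by rewrite thE /e mul1r.
- move=> s t; rewrite /g /cmul !cmatK; congr rvec.
  apply: etrans (esym (mul_projections PP (e s) (e t))).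
  by apply: eq_bigr => k _; rewrite eD.
- have -> : 'D_1 g 0 = \sum_k th k *: rvec (ci *: P k).
    rewrite gE.
    have -> : (fun t : R => \sum_k (cos (t * th k) *: rvec (P k) + sin (t * th k) *: rvec (ci *: P k)))
      = \sum_k (fun t : R => cos (t * th k) *: rvec (P k) + sin (t * th k) *: rvec (ci *: P k)).
      by apply/funext => t; rewrite fct_sumE.
    rewrite derive_sum => [|k]; last first.
      by apply: diff_derivable; have [] := derive_rot (th k) (rvec (P k)) (rvec (ci *: P k)) 0.
    apply: eq_bigr => k _.
    have [_ /(_ 1)] := derive_rot (th k) (rvec (P k)) (rvec (ci *: P k)) 0 => ->.
    by rewrite mul0r cos0 sin0 scale0r addr0 scale1r mul1r.
  apply: big_ind => [|Y Z|k _]; [exact: u4_0|exact: u4_D|].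
  have uP : u4 R (rvec (ci *: P k)).
    apply/u4P => i j; rewrite cmatK.
    have Pij : (P k j i)^* = P k i j.
      by have := congr1 (fun A : 'M[C']_4 => A i j) (Padj k); rewrite !mxE.
    move: (P k) Pij => A Aij; rewrite [X in X^*]mxE [in RHS]mxE rmorphM /= Aij conj_ci.
    by rewrite mulNr.
  by have := u4_linear (th k) uP (@u4_0 R); rewrite addr0.
Qed.

End OneParameter.

(** * Coboundary bivectors and the determination of the Poisson structure *)

Section MatrixSmooth.
Context {R : realType}.

Lemma smooth_mulmx (U : normedModType R) m n p (f : U -> 'M[R]_(m, n)) (g : U -> 'M[R]_(n, p)) :
  smooth f -> smooth g -> smooth (fun x => f x *m g x).
Proof.
move=> /(smooth_on_mxP _ openT) sf /(smooth_on_mxP _ openT) sg.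
apply/(smooth_on_mxP _ openT) => i j; under eq_fun do rewrite mxE.
by apply: (smooth_on_sum _ openT) => k _; exact: (smooth_onM openT).
Qed.

Lemma smooth_trmx (U : normedModType R) m n (f : U -> 'M[R]_(m, n)) :
  smooth f -> smooth (fun x => (f x)^T).
Proof.
move=> /(smooth_on_mxP _ openT) sf.
by apply/(smooth_on_mxP _ openT) => i j; under eq_fun do rewrite mxE; exact: sf.
Qed.

Lemma smooth_subr (U : normedModType R) m n (f g : U -> 'M[R]_(m, n)) :
  smooth f -> smooth g -> smooth (fun x => f x - g x).
Proof.
move=> /(smooth_on_mxP _ openT) sf /(smooth_on_mxP _ openT) sg.
apply/(smooth_on_mxP _ openT) => i j; under eq_fun do rewrite !mxE.
by apply: (smooth_onD openT) => //; exact: (smooth_onN openT).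
Qed.

(** The multiplicative bivector [x . r - r . x], for [L], [A] the matrices of the left and
    right multiplication by [x]. *)
Definition coboundary n (r L A : 'M[R]_n) : 'M[R]_n := L^T *m r *m L - A^T *m r *m A.

(** The two mixed terms, in which [r] is translated on one side by each factor, coincide because
    left and right multiplications commute; they cancel. *)
Lemma coboundary_cocycle n (r L L' A A' : 'M[R]_n) : L *m A' = A' *m L ->
  coboundary r (L' *m L) (A *m A') =
  A'^T *m coboundary r L A *m A' + L^T *m coboundary r L' A' *m L.
Proof.
move=> LA; rewrite /coboundary !mulmxBr !mulmxBl !trmx_mul.
have -> : L^T *m (A'^T *m r *m A') *m L = A'^T *m (L^T *m r *m L) *m A'.
  transitivity ((A' *m L)^T *m r *m (A' *m L)); first by rewrite trmx_mul !mulmxA.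
  by rewrite -LA trmx_mul !mulmxA.
rewrite !mulmxA; move: (L^T *m L'^T *m r *m L' *m L) (A'^T *m L^T *m r *m L *m A')
  (A'^T *m A^T *m r *m A *m A') => a b c.
by apply/matrixP => i j; rewrite !mxE; ring.
Qed.

Lemma cocycle_sub n (A L W W' K K' : 'M[R]_n) :
  A^T *m W *m A + L^T *m W' *m L - (A^T *m K *m A + L^T *m K' *m L) =
  A^T *m (W - K) *m A + L^T *m (W' - K') *m L.
Proof. by rewrite !mulmxBr !mulmxBl opprD addrACA. Qed.

(** The exact expansion along a line through the identity, in the form asked for by [derive_quad].
    The linear coefficient is [ad2] of the direction once [L - A] is the matrix of its adjoint
    action. *)
Lemma derive_coboundary n (r L A : 'M[R]_n) (h : R) :
  coboundary r (h *: L + 1%:M) (h *: A + 1%:M) =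
  coboundary r 1%:M 1%:M + h *: deriv2 (L - A) r + h ^+ 2 *: coboundary r L A.
Proof.
have E (X : 'M[R]_n) : (h *: X + 1%:M)^T *m r *m (h *: X + 1%:M) =
    r + h *: (X^T *m r + r *m X) + h ^+ 2 *: (X^T *m r *m X).
  rewrite [_^T]linearP /= trmx1 mulmxDl mul1mx mulmxDr mulmx1 -scalemxAl mulmxDl.
  rewrite -!scalemxAr -scalemxAl scalerDr scalerA -expr2.
  move: (X^T *m r *m X) (X^T *m r) (r *m X) => a b c.
  by apply/matrixP => i j; rewrite !mxE; ring.
rewrite /coboundary !E subrr add0r /deriv2 [(L - A)^T]linearB /= mulmxBl mulmxBr.
move: (L^T *m r *m L) (A^T *m r *m A) (L^T *m r) (A^T *m r) (r *m L) (r *m A) => a b c d e f.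
by apply/matrixP => i j; rewrite !mxE; ring.
Qed.

Lemma lin1_mx_comp n (f g h : 'rV[R]_n -> 'rV[R]_n) : linear f -> linear g -> linear h ->
  (forall u, h u = g (f u)) -> lin1_mx h = lin1_mx f *m lin1_mx g.
Proof. by move=> lf lg lh hE; apply: eq_mulmxl => u; rewrite mulmxA !mul_lin1. Qed.

Section Bilinear.
Variables (n : nat) (B : 'rV[R]_n -> 'rV[R]_n -> 'rV[R]_n).
Hypotheses (Bl : forall y, linear (B^~ y)) (Br : forall x, linear (B x)).
Hypothesis sB : smooth (fun z : 'rV[R]_(n + n) => B (lsubmx z) (rsubmx z)).

(** The Jacobian stacks the matrix of right multiplication over that of left multiplication, so that
    pushing a product bivector forward produces the two terms of the cocycle rule. *)
Lemma jacobian_bilinear (z : 'rV[R]_(n + n)) :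
  jacobian (fun z : 'rV[R]_(n + n) => B (lsubmx z) (rsubmx z)) z =
  col_mx (lin1_mx (B^~ (rsubmx z))) (lin1_mx (B (lsubmx z))).
Proof.
apply: eq_mulmxl => u; rewrite -(deriveEjacobian u (smooth_diff z sB)).
rewrite -[u in RHS]hsubmxK mul_row_col !mul_lin1//.
apply: (derive_quad (c := B (lsubmx u) (rsubmx u))) => h.
rewrite !linearP Bl !Br scalerDr scalerA -expr2.
move: (B _ _) (B _ _) (B _ _) (B _ _) => b1 b2 b3 b4.
by apply/matrixP => i j; rewrite !mxE; ring.
Qed.

Lemma push_bilinear (w1 w2 : 'M[R]_n) (A L : 'M[R]_n) :
  (col_mx A L)^T *m block_mx w1 0 0 w2 *m col_mx A L = A^T *m w1 *m A + L^T *m w2 *m L.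
Proof.
by rewrite tr_col_mx mul_row_block mul_row_col !mulmx0 addr0 add0r.
Qed.

End Bilinear.

End MatrixSmooth.

Section Determination.
Context {R : realType}.
Local Notation coords44 := (coords R 4 4).

(** As matrices act on row vectors from the right, composition is reversed: [Lmx] is
    antimultiplicative while [Rmx] is multiplicative. *)
Definition Lmx (x : coords44) : 'M[R]_(4 * 4 + 4 * 4) := lin1_mx (cmul x : coords44 -> coords44).
Definition Rmx (x : coords44) : 'M[R]_(4 * 4 + 4 * 4) :=
  lin1_mx (fun y : coords44 => cmul y x).

Lemma mul_Lmx (x y : coords44) : y *m Lmx x = cmul x y.
Proof. exact/mul_lin1/cmul_linearr. Qed.

Lemma mul_Rmx (x y : coords44) : y *m Rmx x = cmul y x.
Proof. exact: (mul_lin1 y (cmul_linearl x)). Qed.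

Lemma Lmx_mul x y : Lmx (cmul x y) = Lmx y *m Lmx x.
Proof.
by apply: lin1_mx_comp; [exact: cmul_linearr..|move=> u; exact: esym (cmulA x y u)].
Qed.

Lemma Rmx_mul x y : Rmx (cmul x y) = Rmx x *m Rmx y.
Proof.
by apply: lin1_mx_comp; [exact: cmul_linearl..|move=> u; exact: cmulA].
Qed.

Lemma LRmx x y : Lmx x *m Rmx y = Rmx y *m Lmx x.
Proof.
have l : linear (fun u : coords44 => cmul (cmul x u) y).
  by move=> a u v; rewrite (cmul_linearr x) (cmul_linearl y).
apply: etrans (esym (lin1_mx_comp (cmul_linearr x) (cmul_linearl y) l (fun=> erefl))) _.
exact: (lin1_mx_comp (cmul_linearl y) (cmul_linearr x) l (fun u => esym (cmulA x u y))).
Qed.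

Lemma Lmx1 : Lmx cone = 1%:M.
Proof. by apply: eq_mulmxl => u; rewrite mulmx1; apply: etrans (mul_Lmx _ _) (mul1c u). Qed.

Lemma Rmx1 : Rmx cone = 1%:M.
Proof. by apply: eq_mulmxl => u; rewrite mulmx1; apply: etrans (mul_Rmx _ _) (cmul1 u). Qed.

Lemma smooth_Lmx : smooth (Lmx : coords44 -> 'M[R]_(4 * 4 + 4 * 4)).
Proof.
apply/(smooth_on_mxP _ openT) => i j; rewrite /Lmx; under eq_fun do rewrite mxE.
have s : smooth (fun x : coords44 => cmul x (delta_mx 0 i) : coords44).
  by apply: smooth_cmul; [exact: smooth_id|exact: smooth_on_cst].
exact: ((smooth_on_mxP _ openT).1 s).
Qed.

Lemma smooth_Rmx : smooth (Rmx : coords44 -> 'M[R]_(4 * 4 + 4 * 4)).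
Proof.
apply/(smooth_on_mxP _ openT) => i j; rewrite /Rmx; under eq_fun do rewrite mxE.
have s : smooth (fun x : coords44 => cmul (delta_mx 0 i : coords44) x : coords44).
  by apply: smooth_cmul; [exact: smooth_on_cst|exact: smooth_id].
exact: ((smooth_on_mxP _ openT).1 s).
Qed.

Lemma Lmx_linear a x y : Lmx (a *: x + y) = a *: Lmx x + Lmx y.
Proof. by apply: lin1_mx_linear; [exact: cmul_linearr..|move=> u; exact: cmul_linearl]. Qed.

Lemma Rmx_linear a x y : Rmx (a *: x + y) = a *: Rmx x + Rmx y.
Proof. by apply: lin1_mx_linear; [exact: cmul_linearl..|move=> u; exact: cmul_linearr]. Qed.

Lemma poisson_lie_U4 (w delta : coords44 -> 'M[R]_(4 * 4 + 4 * 4)) r :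
  poisson_lie w -> tangent_cobracket w delta ->
  (forall X, u4 R X -> delta X = ad2 X r) ->
  forall x, U4 R x -> w x = coboundary r (Lmx x) (Rmx x).
Proof.
move=> [[_ sw _ _] pm] tc dr.
have wM x y : U4 R x -> U4 R y ->
    w (cmul x y) = (Rmx y)^T *m w x *m Rmx y + (Lmx x)^T *m w y *m Lmx x.
  move=> Ux Uy.
  have Uz : prod_set (U4 R) (U4 R) (row_mx x y) by rewrite /prod_set /= row_mxKl row_mxKr.
  have := poisson_map_jacobian pm Uz.
  rewrite (jacobian_bilinear (@cmul_linearl R 4 4 4) (@cmul_linearr R 4 4 4)); last first.
    by apply: smooth_cmul; [exact: smooth_lsubmx|exact: smooth_rsubmx].
  by rewrite /prod_bivector push_bilinear row_mxKl row_mxKr => <-.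
pose F x := w x - coboundary r (Lmx x) (Rmx x).
have FM x y : U4 R x -> U4 R y ->
    F (cmul x y) = (Rmx y)^T *m F x *m Rmx y + (Lmx x)^T *m F y *m Lmx x.
  move=> Ux Uy; rewrite /F wM// Lmx_mul Rmx_mul (coboundary_cocycle r _ _ (LRmx x y)).
  exact: cocycle_sub.
have sc : smooth (fun x : coords44 => coboundary r (Lmx x) (Rmx x)).
  rewrite /coboundary; apply: smooth_subr; apply: smooth_mulmx.
  - apply: smooth_mulmx; last exact: smooth_on_cst.
    exact/smooth_trmx/smooth_Lmx.
  - exact: smooth_Lmx.
  - apply: smooth_mulmx; last exact: smooth_on_cst.
    exact/smooth_trmx/smooth_Rmx.
  - exact: smooth_Rmx.
have sF : smooth F by exact: smooth_subr.
have DF X : u4 R X -> 'D_X F cone = 0.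
  move=> uX.
  (* On two coordinate functions the bracket is an entry of [w], and [pair2] is the same entry of
     [delta X]. *)
  have Dw : 'D_X w cone = delta X.
    apply/matrixP => i j; rewrite -(derive_entry _ _ _ (smooth_diff _ sw)).
    have c k : smooth (fun y : coords44 => y 0 k) by exact: smooth_coord.
    have := tc X uX _ _ (c i) (c j); rewrite pair2_coord => <-.
    by congr ('D_X _ cone); apply/funext => y; rewrite /bracket pair2_coord.
  have Dc : 'D_X (fun x : coords44 => coboundary r (Lmx x) (Rmx x)) cone = ad2 X r.
    have L1 h : Lmx (h *: X + cone) = h *: Lmx X + 1%:M by rewrite Lmx_linear Lmx1.
    have R1 h : Rmx (h *: X + cone) = h *: Rmx X + 1%:M by rewrite Rmx_linear Rmx1.
    apply: (derive_quad (c := coboundary r (Lmx X) (Rmx X))) => h.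
    rewrite L1 R1 Lmx1 Rmx1 derive_coboundary.
    suff -> : ad2 X r = deriv2 (Lmx X - Rmx X) r by [].
    rewrite ad2E; congr (deriv2 _ r).
    have := @lin1_mx_linear R _ (fun y => cmul y X) (cmul X) (lie_br X) (-1).
    rewrite scaleN1r addrC; apply.
    - exact: cmul_linearl.
    - exact: cmul_linearr.
    - exact: lie_linear.
    - by move=> u; rewrite scaleN1r addrC.
  rewrite /F (deriveB (diff_derivable (smooth_diff _ sw)) (diff_derivable (smooth_diff _ sc))).
  by rewrite Dw Dc dr// subrr.
move=> x Ux; have [g [sg Ug [g0 g1] gD ug]] := U4_one_parameter Ux.
suff : F (g 1) = 0 by rewrite g1 => /subr0_eq.
(* From here on only the cocycle rule, smoothness and the vanishing derivative of [F] at the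
   identity enter. *)
move: (F) FM sF DF => {}F {}FM {}sF {}DF.
have sgE (f : coords44 -> 'M[R]_(4 * 4 + 4 * 4)) i j : smooth f ->
    differentiable (fun t => f (g t) i j) (0 : R).
  move=> sf; apply: differentiable_entry.
  exact: (differentiable_comp (smooth_diff 0 sg) (smooth_diff _ sf)).
apply: (cocycle_zero (D := F \o g) (L := Lmx \o g) (A := Rmx \o g)).
- by move=> s t; apply: etrans (congr1 F (gD t s)) (FM (g t) (g s) (Ug t) (Ug s)).
- by move=> s t; apply: etrans (congr1 Rmx (gD s t)) _; exact: Rmx_mul.
- by rewrite /= g0 Rmx1.
- by rewrite /= g0 Lmx1.
- by move=> s t; exact: LRmx.
- by move=> i j; apply: diff_derivable; exact: sgE smooth_Rmx.
- move=> i j; have d := sgE F i j sF.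
  split; first exact: diff_derivable d.
  have dgF := differentiable_comp (smooth_diff 0 sg) (smooth_diff (g 0) sF).
  rewrite (derive_entry (1 : R) i j dgF).
  rewrite (derive_comp (1 : R) (smooth_diff 0 sg) (smooth_diff (g 0) sF)) g0 DF//.
  by rewrite mxE.
Qed.

End Determination.

Lemma linear_zero (R : pzRingType) (U W : lmodType R) (f : U -> W) : linear f -> f 0 = 0.
Proof. by move=> lf; have := lf (-1) 0 0; rewrite !scaleN1r !addNr. Qed.

Lemma scale_linear (R : pzRingType) (U W : lmodType R) (f : U -> W) a x :
  linear f -> f (a *: x) = a *: f x.
Proof. by move=> lf; have := lf a x 0; rewrite (linear_zero lf) !addr0. Qed.

(** * The subgroup of matrices diag(u, conj u) *)

Section Block44.

Lemma ord4_split : [/\ inord 0 = lshift 2 (0 : 'I_2), inord 1 = lshift 2 (1 : 'I_2),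
  inord 2 = rshift 2 (0 : 'I_2) & inord 3 = rshift 2 (1 : 'I_2)].
Proof. by split; apply: val_inj; rewrite /= inordK. Qed.

Section Block4.
Variables (T : Type) (A B D E : 'M[T]_2) (i j : 'I_2).
Local Notation M := (block_mx A B D E : 'M[T]_4).

Lemma block4Eul : M (lshift 2 i) (lshift 2 j) = A i j. Proof. exact: block_mxEul. Qed.
Lemma block4Eur : M (lshift 2 i) (rshift 2 j) = B i j. Proof. exact: block_mxEur. Qed.
Lemma block4Edl : M (rshift 2 i) (lshift 2 j) = D i j. Proof. exact: block_mxEdl. Qed.
Lemma block4Edr : M (rshift 2 i) (rshift 2 j) = E i j. Proof. exact: block_mxEdr. Qed.

End Block4.

Definition block4E := (block4Eul, block4Eur, block4Edl, block4Edr).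

Lemma matrix4P (T : Type) (A B : 'M[T]_4) :
  (forall i j : nat, (i < 4)%N -> (j < 4)%N -> A (inord i) (inord j) = B (inord i) (inord j)) ->
  A = B.
Proof.
move=> AB; apply/matrixP => i j; rewrite -(inord_val i) -(inord_val j).
exact: AB (ltn_ord i) (ltn_ord j).
Qed.

End Block44.

Section SpecialUnitary2.
Context {C : numClosedFieldType}.
Local Open Scope sesquilinear_scope.

Lemma ord2P (P : 'I_2 -> Prop) : P 0 -> P 1 -> forall i, P i.
Proof.
move=> P0 P1 [[|[|//]] i2]; first by rewrite (_ : Ordinal i2 = 0) //; exact: val_inj.
by rewrite (_ : Ordinal i2 = 1) //; exact: val_inj.
Qed.

Lemma big_ord2 (W : nmodType) (F : 'I_2 -> W) : \sum_i F i = F 0 + F 1.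
Proof.
rewrite !big_ord_recl big_ord0 Monoid.mulm1; congr (_ + F _); exact: val_inj.
Qed.

Lemma det2 (A : 'M[C]_2) : \det A = A 0 0 * A 1 1 - A 0 1 * A 1 0.
Proof.
rewrite (expand_det_row _ 0) big_ord2 /cofactor !det_mx11 !mxE /= expr0 expr1.
rewrite !mul1r !mulN1r mulrN.
by do ![congr (_ - _) | congr (_ * _) | congr (A _ _)]; exact: val_inj.
Qed.

Definition su2 (a b : C) : 'M[C]_2 :=
  \matrix_(i, j) (if i == 0 then (if j == 0 then a else b) else (if j == 0 then - b^* else a^*)).

(** Orthogonality to the first row and determinant 1 are two linear equations that determine the
    second row. *)
Lemma su2P (u : 'M[C]_2) : (u \is unitarymx /\ \det u = 1) <->
  (u = su2 (u 0 0) (u 0 1) /\ u 0 0 * (u 0 0)^* + u 0 1 * (u 0 1)^* = 1).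
Proof.
split=> [[/unitarymxP/matrixP uu]|[uE nu]].
  rewrite det2 => du.
  have h1 := uu 0 0; have h0 := uu 1 0; rewrite !mxE !big_ord2 !mxE /= ?mulr1n ?mulr0n in h1 h0.
  split=> //; apply/matrixP.
  have c10 : u 1 0 = - (u 0 1)^*.
    apply/eqP; rewrite -subr_eq0 opprK; apply/eqP.
    (* One factor 1 is written as the squared norm of the first row, the other as the determinant;
       the difference becomes a multiple of the orthogonality relation. *)
    rewrite -[u 1 0]mulr1 -[_^*]mulr1 -{1}h1 -du.
    by transitivity (u 0 0 * (u 1 0 * (u 0 0)^* + u 1 1 * (u 0 1)^*)); [ring|rewrite h0 mulr0].
  have c11 : u 1 1 = (u 0 0)^*.
    apply/eqP; rewrite -subr_eq0; apply/eqP.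
    rewrite -[u 1 1]mulr1 -[X in _ - X]mulr1 -{1}h1 -du.
    by transitivity (u 0 1 * (u 1 0 * (u 0 0)^* + u 1 1 * (u 0 1)^*)); [ring|rewrite h0 mulr0].
  apply: ord2P; apply: ord2P; rewrite mxE //=.
move: (u 0 0) (u 0 1) uE nu => a b -> nu; split; last by rewrite det2 !mxE /= mulrN opprK.
apply/unitarymxP/matrixP.
apply: ord2P; apply: ord2P; rewrite !mxE big_ord2 !mxE /= ?rmorphN /= ?conjCK //.
- by ring.
- by ring.
- by rewrite -nu; ring.
Qed.

(** In the notation of the statement [jmx] is the lower right block of [g]; conjugation by
    it is complex conjugation on [SU(2)]. *)
Definition jmx : 'M[C]_2 := \matrix_(i, j) (if i == 0 then (j != 0)%:R else - (j == 0)%:R).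

Lemma jmx_su2 (a b : C) : jmx *m su2 a b = su2 a^* b^* *m jmx.
Proof.
apply/matrixP; apply: ord2P; apply: ord2P; rewrite !mxE !big_ord2 !mxE /= ?conjCK; ring.
Qed.

Lemma jmx_unit : jmx \in unitmx.
Proof.
suff : jmx *m (- jmx) = 1%:M by case/mulmx1_unit.
apply/matrixP; apply: ord2P; apply: ord2P; rewrite !mxE !big_ord2 !mxE /=; ring.
Qed.

Definition hmx (a b : C) : 'M[C]_4 := block_mx (su2 a b) 0 0 (su2 a^* b^*).

Lemma su2_linear (r a b c d : C) : r^* = r ->
  su2 (r * a + c) (r * b + d) = r *: su2 a b + su2 c d.
Proof.
move=> rr; apply/matrixP; apply: ord2P; apply: ord2P; rewrite !mxE //=.
  by rewrite rmorphD rmorphM /= rr opprD mulrN.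
by rewrite rmorphD rmorphM /= rr.
Qed.

Lemma hmx_linear (r a b c d : C) : r^* = r ->
  hmx (r * a + c) (r * b + d) = r *: hmx a b + hmx c d.
Proof.
move=> rr; have : (block_mx (su2 (r * a + c) (r * b + d)) 0 0
    (su2 (r * a + c)^* (r * b + d)^*) : 'M[C]_(2 + 2)) =
    r *: block_mx (su2 a b) 0 0 (su2 a^* b^*) + block_mx (su2 c d) 0 0 (su2 c^* d^*).
  rewrite scale_block_mx add_block_mx !scaler0 !addr0 -!su2_linear//.
  by rewrite !rmorphD !rmorphM /= rr.
exact.
Qed.

Lemma hmx0 : hmx 0 0 = 0.
Proof.
have := @hmx_linear (-1) 0 0 0 0; rewrite rmorphN rmorph1 !mulr0 !addr0 => /(_ erefl) ->.
by rewrite scaleN1r addNr.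
Qed.

Lemma su2_mul (a b c d : C) : su2 a b *m su2 c d = su2 (a * c - b * d^*) (a * d + b * c^*).
Proof.
apply/matrixP; apply: ord2P; apply: ord2P; rewrite !mxE !big_ord2 !mxE /=;
  rewrite ?rmorphD ?rmorphN ?rmorphM /= ?conjCK; ring.
Qed.

Lemma hmx_mul (a b c d : C) : hmx a b *m hmx c d = hmx (a * c - b * d^*) (a * d + b * c^*).
Proof.
have : (block_mx (su2 a b) 0 0 (su2 a^* b^*) : 'M[C]_(2 + 2)) *m
    block_mx (su2 c d) 0 0 (su2 c^* d^*) =
    block_mx (su2 (a * c - b * d^*) (a * d + b * c^*)) 0 0
      (su2 (a * c - b * d^*)^* (a * d + b * c^*)^*).
  rewrite mulmx_block !mulmx0 !mul0mx !addr0 !add0r !su2_mul conjCK.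
  by rewrite !rmorphD rmorphN !rmorphM /= !conjCK.
exact.
Qed.

Lemma su2_1 : su2 1 0 = 1%:M.
Proof.
by apply/matrixP; apply: ord2P; apply: ord2P; rewrite !mxE //= ?rmorph0 ?oppr0 ?rmorph1.
Qed.

Lemma hmx1 : hmx 1 0 = 1%:M.
Proof.
by rewrite /hmx rmorph1 rmorph0 su2_1; exact: esym (@scalar_mx_block C 2 2 1).
Qed.

Lemma norm_mul (a b c d : C) : a * a^* + b * b^* = 1 -> c * c^* + d * d^* = 1 ->
  (a * c - b * d^*) * (a * c - b * d^*)^* + (a * d + b * c^*) * (a * d + b * c^*)^* = 1.
Proof.
move=> ab cd; rewrite !rmorphD rmorphN !rmorphM /= !conjCK -[RHS]mulr1 -{1}ab -cd.
by ring.
Qed.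

Lemma hmx_inv (a b : C) : a * a^* + b * b^* = 1 -> hmx a b *m hmx a^* (- b) = 1%:M.
Proof.
move=> ab; rewrite hmx_mul rmorphN mulrN opprK ab conjCK -hmx1; congr hmx; ring.
Qed.

Lemma hmx_adj (a b : C) : map_mx Num.conj (hmx a b)^T = hmx a^* (- b).
Proof.
have sa c d : map_mx Num.conj (su2 c d)^T = su2 c^* (- d).
  by apply/matrixP; apply: ord2P; apply: ord2P; rewrite !mxE //= ?rmorphN /= ?conjCK ?opprK.
have : map_mx Num.conj (block_mx (su2 a b) 0 0 (su2 a^* b^*) : 'M[C]_(2 + 2))^T =
    block_mx (su2 a^* (- b)) 0 0 (su2 a^*^* (- b)^*).
  by rewrite tr_block_mx map_block_mx !trmx0 !map_mx0 !sa rmorphN.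
exact.
Qed.

Lemma hmx_unitary (a b : C) : a * a^* + b * b^* = 1 -> hmx a b \is unitarymx.
Proof. by move=> ab; apply/unitarymxP; rewrite hmx_adj hmx_inv. Qed.

Lemma hmx_Vm (c : C) :
  Vm (inord 0) (inord 1) c + Vm (inord 2) (inord 3) c^* = hmx 0 c.
Proof.
have [e0 e1 e2 e3] := ord4_split; apply: matrix4P.
case=> [|[|[|[|//]]]] [|[|[|[|//]]]] _ _;
  rewrite /Vm ![in LHS]mxE !inord4_eq//= ?e0 ?e1 ?e2 ?e3 block4E !mxE /=;
  by rewrite ?rmorph0 ?conjCK ?mulr0n ?mulr1n ?mulr0 ?mulr1 ?subr0 ?sub0r ?addr0 ?add0r ?oppr0.
Qed.

End SpecialUnitary2.

Section Subgroup.
Context {R : realType}.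
Local Notation C := (complex R).
Local Notation C' := (closedC R).
Local Notation ci := (@ci R).

Lemma gmx_block : gmx = (block_mx 1%:M 0 0 jmx : 'M[C']_(2 + 2)) :> 'M[C']_4.
Proof.
have [e0 e1 e2 e3] := ord4_split; apply/matrix4P.
case=> [|[|[|[|//]]]] [|[|[|[|//]]]] _ _;
  by rewrite [LHS]mxE !inordK// ?e0 ?e1 ?e2 ?e3 block4E !mxE /= ?mulr1n ?mulr0n ?oppr0.
Qed.

Lemma SU2dgP (x : coords R 4 4) : SU2dg R x <->
  exists a b : C', a * a^* + b * b^* = 1 /\ cmat x = hmx a b.
Proof.
have gu : (gmx : 'M[C']_4) \in unitmx.
  rewrite gmx_block; suff : (block_mx 1%:M 0 0 jmx : 'M[C']_(2 + 2)) \in unitmx by [].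
  by rewrite unitmxE det_ublock det1 mul1r -unitmxE jmx_unit.
have E a b : gmx *m (block_mx (su2 a b) 0 0 (su2 a b) : 'M[C']_4) = hmx a b *m gmx.
  rewrite gmx_block; have : (block_mx 1%:M 0 0 jmx : 'M[C']_(2 + 2)) *m
    block_mx (su2 a b) 0 0 (su2 a b) = block_mx (su2 a b) 0 0 (su2 a^* b^*) *m
    block_mx 1%:M 0 0 jmx.
    by rewrite !mulmx_block !mulmx0 !mul0mx !addr0 !add0r mul1mx mulmx1 jmx_su2.
  exact.
split=> [[A [u [uu du ->]] ->]|[a [b [ab xE]]]].
  have [uE ab] := (su2P u).1 (conj uu du).
  exists (u 0 0), (u 0 1); split=> //.
  by rewrite [in LHS]uE E mulmxK.
exists (block_mx (su2 a b) 0 0 (su2 a b)).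
  have [] := (su2P (su2 a b)).2; first by rewrite !mxE.
  by move=> uu du; exists (su2 a b).
by rewrite E mulmxK.
Qed.

Lemma SU2dg_mul x y : SU2dg R x -> SU2dg R y -> SU2dg R (cmul x y).
Proof.
move=> /SU2dgP[a [b [ab xE]]] /SU2dgP[c [d [cd yE]]]; apply/SU2dgP.
exists (a * c - b * d^*), (a * d + b * c^*); split; first exact: norm_mul.
by rewrite cmat_cmul xE yE; exact: hmx_mul.
Qed.

Lemma SU2dg_U4 x : SU2dg R x -> U4 R x.
Proof.
by move=> /SU2dgP[a [b [ab xE]]]; rewrite /U4 /= xE; exact: hmx_unitary.
Qed.

Lemma SU2dg_cone : SU2dg R cone.
Proof.
apply/SU2dgP; exists 1, 0; split; first by rewrite rmorph1 mulr1 mul0r addr0.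
by rewrite /cone cmatK; exact: esym hmx1.
Qed.

Lemma SU2dg_inv x : SU2dg R x -> SU2dg R (cinv x).
Proof.
move=> /SU2dgP[a [b [ab xE]]]; apply/SU2dgP; exists a^*, (- b); split.
  by rewrite conjCK rmorphN mulrNN mulrC.
have hi := hmx_inv ab; have [u _] := mulmx1_unit hi.
rewrite /cinv cmatK xE; apply: etrans (esym (mulmx1 _)) _.
by apply: etrans (congr1 (mulmx _) (esym hi)) _; exact: mulKmx.
Qed.

Definition iota4 (a : 'rV[R]_4) : coords R 4 4 :=
  rvec (hmx (Complex (a 0 (inord 0)) (a 0 (inord 1)) : C')
            (Complex (a 0 (inord 2)) (a 0 (inord 3)))).

Lemma iota4_linear : linear iota4.
Proof.
move=> r a b; rewrite /iota4 -rvecP; congr rvec.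
have rE (u v x y : R) : Complex (r * u + x) (r * v + y) =
    ((r%:C)%C : C') * Complex u v + Complex x y.
  by apply/eqP; rewrite eq_complex /=; apply/andP; split; apply/eqP; ring.
by rewrite !mxE !rE; apply: hmx_linear; exact: conj_real.
Qed.

Definition coord4 (x : coords R 4 4) : 'rV[R]_4 :=
  \row_k x 0 (nth (lshift _ (mxvec_index (inord 0) (inord 0)))
    [:: lshift _ (mxvec_index (inord 0) (inord 0)); rshift _ (mxvec_index (inord 0) (inord 0));
        lshift _ (mxvec_index (inord 0) (inord 1)); rshift _ (mxvec_index (inord 0) (inord 1))] k).

Lemma coord4_linear : linear coord4.
Proof. by move=> r a b; apply/rowP => k; rewrite !mxE. Qed.

Lemma iota4K : cancel iota4 coord4.
Proof.
have [e0 e1 _ _] := ord4_split.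
have E00 (c d : C') : hmx c d (inord 0) (inord 0) = c by rewrite e0 block4Eul mxE.
have E01 (c d : C') : hmx c d (inord 0) (inord 1) = d by rewrite e0 e1 block4Eul mxE.
move=> a; apply/rowP; apply: ord4P; rewrite mxE inordK//=.
- by rewrite (rvec_entry _ _ _).1 E00.
- by rewrite (rvec_entry _ _ _).2 E00.
- by rewrite (rvec_entry _ _ _).1 E01.
- by rewrite (rvec_entry _ _ _).2 E01.
Qed.

(** In the real parameters of [a] and [b] the subgroup is the unit 3-sphere ([sphere] is indexed by
    the ambient dimension), embedded by a linear map with a linear left inverse. This is the
    situation of [sphere_image_submanifold]. *)
Lemma SU2dg_iota4 : SU2dg R = iota4 @` @sphere R 4.
Proof.
have nE (a b : C') : a * a^* + b * b^* = 1 <->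
    complex.Re a ^+ 2 + complex.Im a ^+ 2 + complex.Re b ^+ 2 + complex.Im b ^+ 2 = 1.
  case: a b => a0 a1 [b0 b1] /=; split=> [/eqP|E].
    by rewrite eq_complex /= => /andP[/eqP <- _]; ring.
  apply/eqP; rewrite eq_complex /=; apply/andP; split; apply/eqP; last by ring.
  by rewrite -E; ring.
apply/seteqP; split=> x.
  move=> /SU2dgP[a [b [/nE ab xE]]].
  exists (\row_(k < 4) nth 0 [:: complex.Re a; complex.Im a; complex.Re b; complex.Im b] k).
    by rewrite /sphere /= big_ord4 !mxE !inordK.
  rewrite /iota4 !mxE !inordK//= -[RHS]rvecK xE.
  by case: a b {ab xE} => a0 a1 [b0 b1].
move=> [a a1 <-]; apply/SU2dgP; exists (Complex (a 0 (inord 0)) (a 0 (inord 1))).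
exists (Complex (a 0 (inord 2)) (a 0 (inord 3))); split; last by rewrite /iota4 cmatK.
by apply/nE => /=; move: a1; rewrite /sphere /= big_ord4.
Qed.

Lemma SU2dg_lie_subgroup : lie_subgroup (SU2dg R).
Proof.
split; [exact: SU2dg_U4|exact: SU2dg_cone|exact: SU2dg_mul|exact: SU2dg_inv|].
rewrite SU2dg_iota4.
pose L : {linear 'rV[R]_4 -> coords R 4 4} :=
  HB.pack iota4 (GRing.isLinear.Build _ _ _ _ _ iota4_linear).
pose c : {linear coords R 4 4 -> 'rV[R]_4} :=
  HB.pack coord4 (GRing.isLinear.Build _ _ _ _ _ coord4_linear).
exact: (@sphere_image_submanifold R 4 _ L c iota4K).
Qed.

Definition hV (c : C) : coords R 4 4 := V (inord 0) (inord 1) c + V (inord 2) (inord 3) c^*.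

Lemma hV_hmx (c : C) : hV c = rvec (hmx (0 : C') c).
Proof.
rewrite /hV /V -rvecD; exact: congr1 (@hmx_Vm C' c).
Qed.

(** For [|c| = 1] the curve [cos t + sin t hV c] is the one-parameter subgroup of the matrices
    [hmx (cos t) (c sin t)], and its left and right translates by [x] remain in the subgroup. *)
Lemma tangent_SU2dg (x : coords R 4 4) (c : C) : SU2dg R x -> c * c^* = 1 ->
  tangent (SU2dg R) x (cmul x (hV c)) /\ tangent (SU2dg R) x (cmul (hV c) x).
Proof.
move=> Hx c1.
have Ht t : SU2dg R (cos (t * 1) *: cone + sin (t * 1) *: hV c).
  apply/SU2dgP; exists ((cos (t * 1))%:C)%C, (((sin (t * 1))%:C)%C * c); split.
    rewrite (rmorphM _ _ c) /= !conj_real mulrACA c1 mulr1.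
    apply/eqP; rewrite eq_complex /=; apply/andP; split; apply/eqP; last by ring.
    by transitivity (cos t ^+ 2 + sin t ^+ 2); [ring|exact: cos2Dsin2].
  rewrite cmatP cmatZ hV_hmx /cone !cmatK -hmx1.
  have := @hmx_linear C' ((sin (t * 1))%:C)%C 0 c ((cos (t * 1))%:C)%C 0 (conj_real _).
  rewrite mulr0 add0r addr0 => ->; rewrite [RHS]addrC; congr (_ + _).
  have := @hmx_linear C' ((cos (t * 1))%:C)%C 1 0 0 0 (conj_real _).
  by rewrite !addr0 mulr1 mulr0 hmx0 addr0 => ->.
have T (Y : coords R 4 4) :
    (forall t, SU2dg R (cos (t * 1) *: x + sin (t * 1) *: Y)) -> tangent (SU2dg R) x Y.
  move=> HY; exists (fun t : R => cos (t * 1) *: x + sin (t * 1) *: Y); split=> //.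
  - exact: smooth_rot.
  - by rewrite mul0r cos0 sin0 scale1r scale0r addr0.
  - have [_ /(_ 1) ->] := derive_rot 1 x Y 0.
    by rewrite mul0r cos0 sin0 scale0r addr0 scale1r mul1r scale1r.
split; apply: T => t.
  have -> : cos (t * 1) *: x + sin (t * 1) *: cmul x (hV c) =
      cmul x (cos (t * 1) *: cone + sin (t * 1) *: hV c).
    apply: esym; apply: etrans (cmul_linearr x (cos (t * 1)) cone _) _; rewrite cmul1.
    by congr (_ + _); exact: scale_linear (cmul_linearr x).
  exact: SU2dg_mul.
have -> : cos (t * 1) *: x + sin (t * 1) *: cmul (hV c) x =
    cmul (cos (t * 1) *: cone + sin (t * 1) *: hV c) x.
  apply: esym; apply: etrans (cmul_linearl x (cos (t * 1)) cone _) _; rewrite mul1c.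
  by congr (_ + _); exact: scale_linear (cmul_linearl x).
exact: SU2dg_mul.
Qed.

End Subgroup.

(** * The hermitian pairing of blocks and coisotropy *)

Section Invariance.
Context {C : numClosedFieldType}.
Local Open Scope sesquilinear_scope.

Lemma sum_Vm n (M : 'M[C]_n) : \sum_j \sum_l Vm j l (M j l) = M - M^t*.
Proof.
rewrite /Vm; under eq_bigr => i _ do rewrite sumrB.
rewrite sumrB -matrix_sum_delta exchange_big; congr (_ - _).
by rewrite [RHS]matrix_sum_delta; apply: eq_bigr => i _; apply: eq_bigr => j _; rewrite !mxE.
Qed.

(** The conjugate of [Vm i k c] by [x] is [M] minus its adjoint, where [M] is the conjugate of
    [c e_ik], and [sum_Vm] expands such a difference in root vectors. *)
Lemma mul_Vm n (x : 'M[C]_n) i k c : x^t* *m x = 1%:M ->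
  x *m Vm i k c = (\sum_j \sum_l Vm j l (c * (x j i * (x l k)^*))) *m x.
Proof.
move=> xx; pose M := x *m (c *: delta_mx i k) *m x^t*.
have ME j l : M j l = c * (x j i * (x l k)^*).
  rewrite /M -scalemxAr -scalemxAl mxE; congr (_ * _).
  rewrite -(mul_delta_mx (0 : 'I_1) i k) mulmxA -colE -mulmxA -rowE.
  by rewrite mxE big_ord1 !mxE.
under eq_bigr => j _ do (under eq_bigr => l _ do rewrite -ME).
rewrite sum_Vm mulmxBl /M !trmx_mul !map_mxM trmxCK -!mulmxA xx !mulmx1 -mulmxBr.
congr (_ *m (_ - _)); apply/matrixP => y z; rewrite !mxE rmorphM rmorph_nat /=.
by rewrite andbC.
Qed.

Definition ur_form (F G : 'M[C]_4) : C :=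
  (F (inord 0) (inord 2))^* * G (inord 0) (inord 2) +
  (F (inord 0) (inord 3))^* * G (inord 0) (inord 3) +
  (F (inord 1) (inord 2))^* * G (inord 1) (inord 2) +
  (F (inord 1) (inord 3))^* * G (inord 1) (inord 3).

Lemma ur_formE (F G : 'M[C]_4) :
  ur_form F G = \tr ((@ursubmx _ 2 2 2 2 F)^t* *m @ursubmx _ 2 2 2 2 G).
Proof.
have [e0 e1 e2 e3] := ord4_split.
rewrite /ur_form /mxtrace big_ord2 !mxE !big_ord2 !mxE e0 e1 e2 e3; ring.
Qed.

(** Conjugation by the block diagonal [hmx a b] multiplies the upper right block by unitary 2 x 2
    matrices on both sides, which the trace form of [ur_formE] does not notice. *)
Lemma ur_form_hmx (a b : C) (F G : 'M[C]_4) : a * a^* + b * b^* = 1 ->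
  let x := hmx a b in ur_form (x^t* *m F *m x) (x^t* *m G *m x) = ur_form F G.
Proof.
move=> ab /=; rewrite !ur_formE hmx_adj.
pose u := su2 a b; pose v := su2 a^* b^*.
pose u' := su2 a^* (- b); pose v' := su2 a^*^* (- b)^*.
have sI c d : c * c^* + d * d^* = 1 -> su2 c d *m su2 c^* (- d) = 1%:M.
  move=> cd; rewrite su2_mul rmorphN mulrN opprK conjCK cd -su2_1; congr su2; ring.
have uu : u *m u' = 1%:M by exact: sI.
have vv : v *m v' = 1%:M.
  by rewrite /v' rmorphN; apply: sI; rewrite !conjCK mulrC [_ * b]mulrC.
have uadj : u'^t* = u.
  by apply/matrixP; apply: ord2P; apply: ord2P; rewrite !mxE //= ?rmorphN /= ?conjCK ?opprK.
have vadj : v^t* = v'.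
  by apply/matrixP; apply: ord2P; apply: ord2P; rewrite !mxE //= ?rmorphN /= ?conjCK ?opprK.
have E (K : 'M[C]_4) : @ursubmx _ 2 2 2 2 (hmx a^* (- b) *m K *m hmx a b) =
    u' *m @ursubmx _ 2 2 2 2 K *m v.
  have := @submxK _ 2 2 2 2 K.
  move: (ulsubmx _) (ursubmx _) (dlsubmx _) (drsubmx _) => K1 K2 K3 K4 <-.
  have : @ursubmx _ 2 2 2 2 (block_mx u' 0 0 v' *m block_mx K1 K2 K3 K4 *m block_mx u 0 0 v) =
    u' *m K2 *m v.
    by rewrite !mulmx_block block_mxKur !mulmx0 !mul0mx !addr0 !add0r.
  exact.
rewrite !E; move: (@ursubmx _ 2 2 2 2 F) (@ursubmx _ 2 2 2 2 G) => A B.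
rewrite !trmx_mul !map_mxM uadj vadj -!mulmxA [u *m _]mulmxA uu mul1mx mxtrace_mulC.
by rewrite -!mulmxA vv mulmx1.
Qed.

End Invariance.

Section Coisotropy.
Context {R : realType}.
Local Notation C := (complex R).
Local Notation C' := (closedC R).
Local Notation ci := (@ci R).
Local Notation coords44 := (coords R 4 4).
Implicit Types (a b x X Y : coords44).

Definition pairing n (a v : 'rV[R]_n) : R := (a *m v^T) 0 0.

Lemma pairing_linear n (a : 'rV[R]_n) c v v' :
  pairing a (c *: v + v') = c * pairing a v + pairing a v'.
Proof. by rewrite /pairing linearP mulmxDr -scalemxAr [LHS]mxE [X in X + _]mxE. Qed.

Lemma pairing0 n (a : 'rV[R]_n) : pairing a 0 = 0.
Proof. by rewrite /pairing trmx0 mulmx0 mxE. Qed.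

Lemma pairingD n (a : 'rV[R]_n) v v' : pairing a (v + v') = pairing a v + pairing a v'.
Proof. by have := pairing_linear a 1 v v'; rewrite scale1r mul1r. Qed.

Lemma pairingZ n (a : 'rV[R]_n) c v : pairing a (c *: v) = c * pairing a v.
Proof. by have := pairing_linear a c v 0; rewrite pairing0 !addr0. Qed.

Lemma pairing_sum n (a : 'rV[R]_n) (I : Type) (r : seq I) (P : pred I) F :
  pairing a (\sum_(i <- r | P i) F i) = \sum_(i <- r | P i) pairing a (F i).
Proof. exact: (big_morph _ (@pairingD n a) (@pairing0 n a)). Qed.

(** A real covector on the left translates of the root vectors, encoded by one complex number for
    each pair of indices: its value on [V i k c], translated, is the real part of [conj c] times the
    entry. *)
Definition PhiL a x : 'M[C']_4 := \matrix_(i, k)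
  Complex (pairing a (cmul x (V i k 1))) (pairing a (cmul x (V i k ci))).
Definition PhiR a x : 'M[C']_4 := \matrix_(i, k)
  Complex (pairing a (cmul (V i k 1) x)) (pairing a (cmul (V i k ci) x)).

Lemma cmul_suml (I : Type) (r : seq I) (P : pred I) (F : I -> coords44) x :
  cmul (\sum_(i <- r | P i) F i) x = \sum_(i <- r | P i) cmul (F i) x.
Proof.
apply: (big_morph (fun y : coords44 => cmul y x)) => [y z|].
  by have := cmul_linearl x 1 y z; rewrite !scale1r.
exact: (linear_zero (cmul_linearl x)).
Qed.

Lemma cmul_V x i k c : U4 R x -> cmul x (V i k c) =
  \sum_j \sum_l cmul (V j l (c * (cmat x j i * (cmat x l k)^*))) x.
Proof.
move=> Ux.
have xx : map_mx Num.conj (cmat x)^T *m cmat x = 1%:M :> 'M[C']_4.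
  by have U : (cmat x : 'M[C']_4) \is unitarymx := Ux; rewrite -invmx_unitary// mulVmx// unitarymx_unit.
under eq_bigr => j _ do rewrite -cmul_suml.
rewrite -cmul_suml; apply: cmat_inj; rewrite !cmat_cmul {1}/V cmatK.
apply: etrans (@mul_Vm C' 4 (cmat x) i k c xx) _; congr (_ *m _).
rewrite -[LHS]cmatK; congr cmat.
rewrite (big_morph _ (@rvecD R 4 4) (@rvec0 R 4 4)); apply: eq_bigr => j _.
by rewrite (big_morph _ (@rvecD R 4 4) (@rvec0 R 4 4)).
Qed.

Lemma pairing_V a x j l c : pairing a (cmul (V j l c) x) =
  complex.Re c * pairing a (cmul (V j l 1) x) + complex.Im c * pairing a (cmul (V j l ci) x).
Proof.
rewrite VE (cmul_linearl x) pairing_linear (scale_linear _ _ (cmul_linearl x)).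
by congr (_ + _); exact: pairingZ.
Qed.

(** A left translate [x V] is the right translate by [x] of the conjugate [x V x^-1], which [cmul_V]
    expands in root vectors. The left and right matrices of a covector thus differ by conjugation
    with the unitary [x]. *)
Lemma PhiLR a x : U4 R x ->
  PhiL a x = map_mx Num.conj (cmat x)^T *m PhiR a x *m cmat x :> 'M[C']_4.
Proof.
move=> Ux; apply/matrixP => i k.
have PE c : pairing a (cmul x (V i k c)) =
    \sum_j \sum_l (complex.Re (c * (cmat x j i * (cmat x l k)^*)) * complex.Re (PhiR a x j l) +
      complex.Im (c * (cmat x j i * (cmat x l k)^*)) * complex.Im (PhiR a x j l)).
  rewrite (cmul_V i k c Ux) pairing_sum; apply: eq_bigr => j _.
  rewrite pairing_sum; apply: eq_bigr => l _.
  have -> : PhiR a x j l =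
      Complex (pairing a (cmul (V j l 1) x)) (pairing a (cmul (V j l ci) x)) by rewrite mxE.
  exact: pairing_V.
have -> : PhiL a x i k = Complex (pairing a (cmul x (V i k 1))) (pairing a (cmul x (V i k ci))).
  by rewrite mxE.
apply: etrans (congr2 (@Complex R) (PE 1) (PE ci)) _; move: (PhiR a x) (cmat x) => F M.
have cplx_sum (I : finType) (f g : I -> R) :
    Complex (\sum_j f j) (\sum_j g j) = \sum_j (Complex (f j) (g j) : C').
  have ReD : {morph (@complex.Re R : C' -> R) : u v / u + v >-> u + v} by case=> ? ? [].
  have ImD : {morph (@complex.Im R : C' -> R) : u v / u + v >-> u + v} by case=> ? ? [].
  apply/eqP; rewrite eq_complex (big_morph _ ReD (erefl _)) (big_morph _ ImD (erefl _)) /=.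
  by rewrite !eqxx.
rewrite cplx_sum [RHS]mxE.
under [RHS]eq_bigr => l _ do rewrite mxE mulr_suml.
rewrite [RHS]exchange_big /=; apply: eq_bigr => j _; rewrite cplx_sum; apply: eq_bigr => l _.
rewrite [in RHS]mxE [in RHS]mxE.
case: (F j l) (M j i) (M l k) => p q [u1 u2] [v1 v2].
by apply/eqP; rewrite eq_complex /=; apply/andP; split; apply/eqP; ring.
Qed.

End Coisotropy.

Section SixWedges.
Context {R : realType} {m n : nat}.

Definition wpair (Y Z : 'rV[R]_n) (a b : 'rV[R]_n) : R :=
  pairing a Y * pairing b Z - pairing a Z * pairing b Y.

Lemma wedge_wpair (Y Z a b : 'rV[R]_n) : (a *m wedge Y Z *m b^T) 0 0 = wpair Y Z a b.
Proof. exact: wedge_form. Qed.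

Lemma push_six (J : 'M[R]_(m, n)) (c : R) (Y1 Y2 Y3 Y4 Y5 Y6 Z1 Z2 Z3 Z4 Z5 Z6 : 'rV[R]_m) :
  J^T *m (c *: (wedge Y1 Z1 + wedge Y2 Z2 + wedge Y3 Z3 + wedge Y4 Z4 + wedge Y5 Z5
    + wedge Y6 Z6)) *m J =
  c *: (wedge (Y1 *m J) (Z1 *m J) + wedge (Y2 *m J) (Z2 *m J) + wedge (Y3 *m J) (Z3 *m J)
    + wedge (Y4 *m J) (Z4 *m J) + wedge (Y5 *m J) (Z5 *m J) + wedge (Y6 *m J) (Z6 *m J)).
Proof. by rewrite -scalemxAr -scalemxAl 5!mulmxDr 5!mulmxDl !wedge_push. Qed.

Lemma form_six (c : R) (Y1 Y2 Y3 Y4 Y5 Y6 Z1 Z2 Z3 Z4 Z5 Z6 a b : 'rV[R]_n) :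
  (a *m (c *: (wedge Y1 Z1 + wedge Y2 Z2 + wedge Y3 Z3 + wedge Y4 Z4 + wedge Y5 Z5
    + wedge Y6 Z6)) *m b^T) 0 0 =
  c * (wpair Y1 Z1 a b + wpair Y2 Z2 a b + wpair Y3 Z3 a b + wpair Y4 Z4 a b
    + wpair Y5 Z5 a b + wpair Y6 Z6 a b).
Proof.
rewrite -scalemxAr -scalemxAl 5!mulmxDr 5!mulmxDl -!wedge_wpair.
move: (a *m wedge Y1 Z1 *m b^T) (a *m wedge Y2 Z2 *m b^T) (a *m wedge Y3 Z3 *m b^T)
  (a *m wedge Y4 Z4 *m b^T) (a *m wedge Y5 Z5 *m b^T) (a *m wedge Y6 Z6 *m b^T).
by move=> *; rewrite !mxE.
Qed.

Lemma form_push_six (J : 'M[R]_(m, n)) (c : R) (Y1 Y2 Y3 Y4 Y5 Y6 Z1 Z2 Z3 Z4 Z5 Z6 : 'rV[R]_m)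
    (a b : 'rV[R]_n) T q1 q2 q3 q4 q5 q6 :
  T = c *: (wedge Y1 Z1 + wedge Y2 Z2 + wedge Y3 Z3 + wedge Y4 Z4 + wedge Y5 Z5
    + wedge Y6 Z6) ->
  wpair (Y1 *m J) (Z1 *m J) a b = q1 -> wpair (Y2 *m J) (Z2 *m J) a b = q2 ->
  wpair (Y3 *m J) (Z3 *m J) a b = q3 -> wpair (Y4 *m J) (Z4 *m J) a b = q4 ->
  wpair (Y5 *m J) (Z5 *m J) a b = q5 -> wpair (Y6 *m J) (Z6 *m J) a b = q6 ->
  (a *m (J^T *m T *m J) *m b^T) 0 0 = c * (q1 + q2 + q3 + q4 + q5 + q6).
Proof. by move=> -> <- <- <- <- <- <-; rewrite push_six form_six. Qed.

Lemma push_six_eq (J : 'M[R]_(m, n)) (c : R) (Y1 Y2 Y3 Y4 Y5 Y6 Z1 Z2 Z3 Z4 Z5 Z6 : 'rV[R]_m)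
    (A1 A2 A3 A4 A5 A6 B1 B2 B3 B4 B5 B6 : 'rV[R]_n) T :
  T = c *: (wedge Y1 Z1 + wedge Y2 Z2 + wedge Y3 Z3 + wedge Y4 Z4 + wedge Y5 Z5
    + wedge Y6 Z6) ->
  Y1 *m J = A1 -> Y2 *m J = A2 -> Y3 *m J = A3 -> Y4 *m J = A4 -> Y5 *m J = A5 -> Y6 *m J = A6 ->
  Z1 *m J = B1 -> Z2 *m J = B2 -> Z3 *m J = B3 -> Z4 *m J = B4 -> Z5 *m J = B5 -> Z6 *m J = B6 ->
  J^T *m T *m J = c *: (wedge A1 B1 + wedge A2 B2 + wedge A3 B3 + wedge A4 B4 + wedge A5 B5
    + wedge A6 B6).
Proof. by move=> -> <- <- <- <- <- <- <- <- <- <- <- <-; exact: push_six. Qed.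

Lemma form_sub (A B : 'M[R]_n) (a b : 'rV[R]_n) :
  (a *m (A - B) *m b^T) 0 0 = (a *m A *m b^T) 0 0 - (a *m B *m b^T) 0 0.
Proof. by rewrite mulmxBr mulmxBl [LHS]mxE [X in _ + X]mxE. Qed.

End SixWedges.

Section Coisotropic.
Context {R : realType}.
Local Notation C := (complex R).
Local Notation C' := (closedC R).
Local Notation ci := (@ci R).
Local Notation coords44 := (coords R 4 4).
Implicit Types (a b x X Y : coords44).

Lemma Im_conjM (u v : C') :
  complex.Im (u^* * v) = complex.Re u * complex.Im v - complex.Im u * complex.Re v.
Proof. by case: u => p q; case: v => r s /=; ring. Qed.

Lemma Complex_opp_conj (p1 p2 q1 q2 : R) : p1 + q1 = 0 -> p2 - q2 = 0 ->
  Complex q1 q2 = - (Complex p1 p2 : C')^*.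
Proof.
move=> h1 h2; apply/eqP; rewrite eq_complex /=; apply/andP; split; apply/eqP; lra.
Qed.

Lemma rmatE : rmat = 2^-1 *: (wedge (V (inord 0) (inord 1) 1) (V (inord 0) (inord 1) ci)
  + wedge (V (inord 0) (inord 2) 1) (V (inord 0) (inord 2) ci)
  + wedge (V (inord 0) (inord 3) 1) (V (inord 0) (inord 3) ci)
  + wedge (V (inord 1) (inord 2) 1) (V (inord 1) (inord 2) ci)
  + wedge (V (inord 1) (inord 3) 1) (V (inord 1) (inord 3) ci)
  + wedge (V (inord 2) (inord 3) 1) (V (inord 2) (inord 3) ci)) :> 'M[R]_(4 * 4 + 4 * 4).
Proof.
have e i k : rt R i k = wedge (V i k 1) (V i k ci).
  by rewrite rt.unlock Vr.unlock Vi.unlock.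
rewrite /rmat (e (inord 0) (inord 1)) (e (inord 0) (inord 2)) (e (inord 0) (inord 3)).
by rewrite (e (inord 1) (inord 2)) (e (inord 1) (inord 3)) (e (inord 2) (inord 3)).
Qed.

Lemma sub_congr (T : Type) (f : T -> R) p q : p = q -> f p - f q = 0.
Proof. by move=> ->; exact: subrr. Qed.

Section Form.
Variables (J : 'M[R]_(4 * 4 + 4 * 4)) (F G : 'M[C']_4) (a b : coords44).
Hypotheses
  (aF : forall i k, F i k = Complex (pairing a (V i k 1 *m J)) (pairing a (V i k ci *m J)))
  (bG : forall i k, G i k = Complex (pairing b (V i k 1 *m J)) (pairing b (V i k ci *m J)))
  (F23 : F (inord 2) (inord 3) = - (F (inord 0) (inord 1))^*)
  (G23 : G (inord 2) (inord 3) = - (G (inord 0) (inord 1))^*).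

(** The term of [r] with indices [i], [k] takes the value [Im (conj F_ik G_ik)]. For the index pairs
    01 and 23 these values are opposite by [F23] and [G23], and the other four add up to
    [ur_form]. *)
Lemma form_rmat : (a *m (J^T *m rmat *m J) *m b^T) 0 0 = 2^-1 * complex.Im (ur_form F G).
Proof.
have pE i k : wpair (V i k 1 *m J) (V i k ci *m J) a b = complex.Im ((F i k)^* * G i k).
  by rewrite Im_conjM aF bG.
rewrite (form_push_six rmatE (pE _ _) (pE _ _) (pE _ _) (pE _ _) (pE _ _) (pE _ _)).
have ImD (u v : C') : complex.Im (u + v) = complex.Im u + complex.Im v by case: u; case: v.
have c : complex.Im ((F (inord 2) (inord 3))^* * G (inord 2) (inord 3)) =
    - complex.Im ((F (inord 0) (inord 1))^* * G (inord 0) (inord 1)).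
  rewrite F23 G23 rmorphN /= mulrNN conjCK.
  by case: (F _ _) (G _ _) => p q [r s] /=; ring.
congr (_ * _); rewrite c /ur_form !ImD; ring.
Qed.

End Form.

Lemma SU2dg_coisotropic (w : coords44 -> 'M[R]_(4 * 4 + 4 * 4)) :
  (forall x, U4 R x -> w x = coboundary rmat (Lmx x) (Rmx x)) ->
  coisotropic (U4 R) w (SU2dg R).
Proof.
move=> wE; split; [by have [] := @SU2dg_lie_subgroup R|exact: SU2dg_U4|].
move=> x Hx a b Ha Hb; have Ux := SU2dg_U4 Hx.
(* Vanishing on the translates of [hV 1] and [hV ci] makes the real parts of the entries 01 and 23
   opposite and their imaginary parts equal, because [hV] carries a conjugate in its second
   block. *)
have L23 d : annihilator (SU2dg R) x d ->
    PhiL d x (inord 2) (inord 3) = - (PhiL d x (inord 0) (inord 1))^* /\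
    PhiR d x (inord 2) (inord 3) = - (PhiR d x (inord 0) (inord 1))^*.
  move=> Hd.
  have n1 : (1 : C) * 1^* = 1 by rewrite rmorph1 mulr1.
  have ni : ci * ci^* = 1 by rewrite conj_ci mulrN ciE opprK.
  have [t1 s1] := tangent_SU2dg Hx n1; have [ti si] := tangent_SU2dg Hx ni.
  have z v : tangent (SU2dg R) x v -> pairing d v = 0.
    by move=> /Hd E; rewrite /pairing E mxE.
  have LV c : pairing d (cmul x (hV c)) =
      pairing d (cmul x (V (inord 0) (inord 1) c)) + pairing d (cmul x (V (inord 2) (inord 3) c^*)).
    rewrite -pairingD; congr (pairing d _).
    by have := cmul_linearr x 1 (V (inord 0) (inord 1) c) (V (inord 2) (inord 3) c^*);
      rewrite !scale1r.
  have RV c : pairing d (cmul (hV c) x) =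
      pairing d (cmul (V (inord 0) (inord 1) c) x) + pairing d (cmul (V (inord 2) (inord 3) c^*) x).
    rewrite -pairingD; congr (pairing d _).
    by have := cmul_linearl x 1 (V (inord 0) (inord 1) c) (V (inord 2) (inord 3) c^*);
      rewrite !scale1r.
  have LN : pairing d (cmul x (V (inord 2) (inord 3) (- ci))) =
      - pairing d (cmul x (V (inord 2) (inord 3) ci)).
    rewrite VN (lin_opp _ (cmul_linearr x)) -scaleN1r pairingZ mulN1r; exact: erefl.
  have RN : pairing d (cmul (V (inord 2) (inord 3) (- ci)) x) =
      - pairing d (cmul (V (inord 2) (inord 3) ci) x).
    rewrite VN (lin_opp _ (cmul_linearl x)) -scaleN1r pairingZ mulN1r; exact: erefl.
  have L1 : pairing d (cmul x (V (inord 0) (inord 1) 1)) +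
      pairing d (cmul x (V (inord 2) (inord 3) 1)) = 0.
    by have := LV 1; rewrite rmorph1 => <-; exact: z _ t1.
  have R1 : pairing d (cmul (V (inord 0) (inord 1) 1) x) +
      pairing d (cmul (V (inord 2) (inord 3) 1) x) = 0.
    by have := RV 1; rewrite rmorph1 => <-; exact: z _ s1.
  have Li : pairing d (cmul x (V (inord 0) (inord 1) ci)) -
      pairing d (cmul x (V (inord 2) (inord 3) ci)) = 0.
    rewrite -LN; have := LV ci; rewrite conj_ci => <-; exact: z _ ti.
  have Ri : pairing d (cmul (V (inord 0) (inord 1) ci) x) -
      pairing d (cmul (V (inord 2) (inord 3) ci) x) = 0.
    rewrite -RN; have := RV ci; rewrite conj_ci => <-; exact: z _ si.
  have PL i k : PhiL d x i k = Complex (pairing d (cmul x (V i k 1)))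
    (pairing d (cmul x (V i k ci))) by rewrite mxE.
  have PR i k : PhiR d x i k = Complex (pairing d (cmul (V i k 1) x))
    (pairing d (cmul (V i k ci) x)) by rewrite mxE.
  split.
    rewrite (PL (inord 2)) (PL (inord 0)); exact: Complex_opp_conj L1 Li.
  rewrite (PR (inord 2)) (PR (inord 0)); exact: Complex_opp_conj R1 Ri.
have [aL aR] := L23 a Ha; have [bL bR] := L23 b Hb.
have fL : (a *m ((Lmx x)^T *m rmat *m Lmx x) *m b^T) 0 0 =
    2^-1 * complex.Im (ur_form (PhiL a x) (PhiL b x)).
  apply: form_rmat aL bL => i k; rewrite mxE; congr Complex; by rewrite mul_Lmx.
have fR : (a *m ((Rmx x)^T *m rmat *m Rmx x) *m b^T) 0 0 =
    2^-1 * complex.Im (ur_form (PhiR a x) (PhiR b x)).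
  apply: form_rmat aR bR => i k; rewrite mxE; congr Complex; by rewrite mul_Rmx.
have E : ur_form (PhiL a x) (PhiL b x) = ur_form (PhiR a x) (PhiR b x).
  rewrite !PhiLR//; have [p [q [pq xE]]] := (SU2dgP x).1 Hx.
  by rewrite xE; exact: (ur_form_hmx _ _ pq).
apply/matrixP => i j; rewrite (ord1 i) (ord1 j) [RHS]mxE.
apply: etrans (congr1 (fun T => (a *m T *m b^T) 0 0) (wE _ Ux)) _.
apply: etrans (form_sub _ _ _ _) _.
apply: etrans (congr2 (fun p q => p - q) fL fR) _.
exact: (sub_congr (fun u => 2^-1 * complex.Im u) E).
Qed.

End Coisotropic.

(** * The Poisson 7-sphere *)

Section UnitaryRows.
Context {C : numClosedFieldType}.
Local Open Scope sesquilinear_scope.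

Lemma unitarymx_adj n (X : 'M[C]_n) : X \is unitarymx -> X^t* *m X = 1%:M.
Proof. by move=> uX; rewrite -invmx_unitary// mulVmx// unitarymx_unit. Qed.

(** Gram-Schmidt orthonormalisation of a basis of the kernel of the adjoint of [z], which has rank
    3, supplies the first three rows. *)
Lemma unitary_complete (z : 'rV[C]_4) : z \is unitarymx ->
  exists2 X : 'M[C]_4, X \is unitarymx & row ord_max X = z.
Proof.
move=> uz; have zz : z *m z^t* = 1%:M by exact/unitarymxP.
pose r := \rank (kermx (z^t*)).
have rE : r = 3%N by rewrite /r mxrank_ker mxrank_map mxrank_tr mxrank_unitary.
have : exists2 W : 'M[C]_(r, 4), W \is unitarymx & W *m z^t* = 0.
  exists (schmidt (row_base (kermx (z^t*)))).
    by apply: schmidt_unitarymx; exact: rank_leq_col.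
  by apply/sub_kermxP; rewrite eqmx_schmidt_free ?row_base_free// eq_row_base.
rewrite rE => -[W /unitarymxP WW Wz].
have zW : z *m W^t* = 0.
  by rewrite -[LHS]trmxCK trmx_mul map_mxM trmxCK Wz trmx0 map_mx0.
exists (col_mx W z : 'M[C]_(3 + 1, 4)).
  apply/unitarymxP.
  have : (col_mx W z : 'M[C]_(3 + 1, 4)) *m (col_mx W z : 'M[C]_(3 + 1, 4))^t* = 1%:M.
    rewrite tr_col_mx map_row_mx mul_col_row WW Wz zW zz.
    by rewrite -scalar_mx_block.
  exact.
apply/rowP => j; rewrite mxE.
have -> : (ord_max : 'I_4) = rshift 3 (0 : 'I_1) by exact: val_inj.
exact: col_mxEd.
Qed.

(** The unitary matrix [K], the product of [Y] and the adjoint of [X], and its own adjoint both have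
    the last row of the identity, so [K] is block diagonal. *)
Lemma unitary_same_row (X Y : 'M[C]_4) : X \is unitarymx -> Y \is unitarymx ->
  row ord_max X = row ord_max Y ->
  exists2 v : 'M[C]_3, v \is unitarymx & Y = (block_mx v 0 0 1%:M : 'M[C]_(3 + 1)) *m X.
Proof.
move=> uX uY XY; pose K := Y *m X^t*.
have XX' : X *m X^t* = 1%:M by exact/unitarymxP.
have YY' : Y *m Y^t* = 1%:M by exact/unitarymxP.
have XX := unitarymx_adj uX; have YY := unitarymx_adj uY.
have YE : Y = K *m X by rewrite /K -mulmxA XX mulmx1.
have KK : K *m K^t* = 1%:M.
  rewrite /K trmx_mul map_mxM trmxCK -mulmxA [X^t* *m _]mulmxA XX mul1mx.
  by apply/unitarymxP.
have rK : row ord_max K = row ord_max 1%:M.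
  by rewrite /K row_mul -XY -row_mul XX'.
have rKt : row ord_max (K^t*) = row ord_max 1%:M.
  by rewrite /K trmx_mul map_mxM trmxCK row_mul XY -row_mul YY'.
have eM : (ord_max : 'I_4) = rshift 3 (0 : 'I_1) by exact: val_inj.
clearbody K; pose v := @ulsubmx _ 3 1 3 1 K.
have K2 : @ursubmx _ 3 1 3 1 K = 0.
  apply/matrixP => i j; rewrite !mxE ord1 -eM.
  have /rowP/(_ (lshift 1 i)) := rKt; rewrite !mxE => /(congr1 Num.conj).
  by rewrite conjCK => ->; rewrite eM (@eq_rlshift 3 1) rmorph0.
have K3 : @dlsubmx _ 3 1 3 1 K = 0.
  apply/matrixP => i j; rewrite !mxE ord1 -eM.
  by have /rowP/(_ (lshift 1 j)) := rK; rewrite !mxE => ->; rewrite eM (@eq_rlshift 3 1).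
have K4 : @drsubmx _ 3 1 3 1 K = 1%:M.
  apply/matrixP => i j; rewrite !mxE !ord1 -eM.
  by have /rowP/(_ ord_max) := rK; rewrite !mxE => ->; rewrite eqxx.
have KE : K = (block_mx v 0 0 1%:M : 'M[C]_(3 + 1)).
  by rewrite -[LHS](@submxK _ 3 1 3 1 K) K2 K3 K4.
exists v; last by rewrite -KE.
apply/unitarymxP; have : (block_mx v 0 0 1%:M : 'M[C]_(3 + 1)) *m
    (block_mx v 0 0 1%:M : 'M[C]_(3 + 1))^t* = 1%:M by move: KK; rewrite KE; exact.
rewrite tr_block_mx map_block_mx !trmx0 !map_mx0 mulmx_block !mulmx0 !mul0mx !addr0.
by rewrite scalar_mx_block => /eq_block_mx[].
Qed.

Lemma row_block_last (v : 'M[C]_3) (X : 'M[C]_4) :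
  row ord_max ((block_mx v 0 0 1%:M : 'M[C]_(3 + 1)) *m X) = row ord_max X.
Proof.
have eM : (ord_max : 'I_(3 + 1)) = rshift 3 (0 : 'I_1) by exact: val_inj.
rewrite row_mul; suff -> : row ord_max (block_mx v 0 0 1%:M : 'M[C]_(3 + 1)) =
    row ord_max (1%:M : 'M[C]_(3 + 1)) by rewrite -row_mul; exact: congr1 (mul1mx _).
rewrite eM; have -> : (1%:M : 'M[C]_(3 + 1)) = block_mx 1%:M 0 0 1%:M by exact: scalar_mx_block.
exact: etrans (rowKd _ _ _) (esym (rowKd _ _ _)).
Qed.

Lemma row_unitary n (X : 'M[C]_n) k : X \is unitarymx -> row k X \is unitarymx.
Proof.
move=> /unitarymxP XX; apply/unitarymxP; apply/matrixP => i j.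
rewrite -row_mul !ord1 mxE; have /matrixP/(_ k k) := XX; rewrite !mxE !eqxx /= => <-.
by apply: eq_bigr => l _; rewrite !mxE.
Qed.

End UnitaryRows.

Section Quotient.
Context {R : realType}.
Local Notation C' := (closedC R).

Lemma cmat_last_row (x : coords R 4 4) : cmat (last_row x) = row ord_max (cmat x).
Proof. exact: cmatK. Qed.

Lemma last_row_cmul (x y : coords R 4 4) : last_row (cmul x y) = cmul (last_row x) y.
Proof. by apply: cmat_inj; rewrite cmat_last_row !cmat_cmul cmat_last_row row_mul. Qed.

Lemma last_row_S7 (x : coords R 4 4) : U4 R x -> S7 R (last_row x).
Proof.
rewrite /S7 /U4 /= cmat_last_row; exact: (@row_unitary C' 4 (cmat x) ord_max).
Qed.

Lemma last_row_quotient : quotient_map (U3 R) (U4 R) (S7 R) last_row.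
Proof.
split.
  apply/seteqP; split=> [_ [x Ux <-]|z Sz]; first exact: last_row_S7.
  have [X uX rX] := @unitary_complete C' (cmat z) Sz.
  exists (rvec X); first by rewrite /U4 /= cmatK.
  by rewrite /last_row cmatK -[RHS]rvecK; congr rvec.
move=> x y Ux Uy; split=> [xy|[k [v uv kE] ->]].
  have rxy : row ord_max (cmat x) = row ord_max (cmat y).
    by have := congr1 (@cmat R 1 4) xy; rewrite /last_row !cmatK.
  have [v uv yE] := @unitary_same_row C' (cmat x) (cmat y) Ux Uy rxy.
  exists (rvec (block_mx v 0 0 1%:M : 'M[C']_(3 + 1))).
    by exists v => //; rewrite cmatK.
  by apply: cmat_inj; rewrite cmat_cmul cmatK.
rewrite /last_row; congr rvec; rewrite cmat_cmul kE.
exact: esym (@row_block_last C' v (cmat x)).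
Qed.

End Quotient.

(** * The bivector induced on the 7-sphere *)

Section RowForm.
Context {R : realType}.
Local Notation C := (complex R).
Local Notation C' := (closedC R).
Local Notation ci := (@ci R).

Lemma wedge_entry n (Y Z : 'rV[R]_n) s t : wedge Y Z s t = Y 0 s * Z 0 t - Z 0 s * Y 0 t.
Proof. by rewrite !mxE !big_ord1 !mxE. Qed.

Definition row_form m n (X : 'M[C]_(m, n)) : 'M[R]_(1 * n + 1 * n) :=
  \sum_k wedge (rvec (ci *: row k X)) (rvec (row k X)).

Lemma Re_sum (I : finType) (F : I -> C) : complex.Re (\sum_i F i) = \sum_i complex.Re (F i).
Proof. by apply: big_morph => // -[? ?] [? ?]. Qed.

Lemma Im_sum (I : finType) (F : I -> C) : complex.Im (\sum_i F i) = \sum_i complex.Im (F i).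
Proof. by apply: big_morph => // -[? ?] [? ?]. Qed.

(** Up to sign, the entries of [row_form X] are the real and imaginary parts of the entries of the
    Gram matrix of the columns of [X]. For unitary [X] that matrix is the identity, whence
    [row_form_unitary]. *)
Lemma row_form_eq m n (X Y : 'M[C]_(m, n)) :
  (forall i j, \sum_k ((X k i)^* * X k j : C') = \sum_k ((Y k i)^* * Y k j : C')) ->
  row_form X = row_form Y.
Proof.
have reC (Z : 'M[C]_(m, n)) k i : let: (a, b) := (rvec (row k Z) 0 (lshift _ (mxvec_index 0 i)),
    rvec (row k Z) 0 (rshift _ (mxvec_index 0 i))) in
  [/\ a = complex.Re (Z k i), b = complex.Im (Z k i),
   rvec (ci *: row k Z) 0 (lshift _ (mxvec_index 0 i)) = - complex.Im (Z k i)
  & rvec (ci *: row k Z) 0 (rshift _ (mxvec_index 0 i)) = complex.Re (Z k i)].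
  have [-> ->] := rvec_entry (row k Z) 0 i.
  have [-> ->] := rvec_entry (ci *: row k Z) 0 i.
  rewrite !mxE; case: (Z k i) => a b /=; split=> //; ring.
have E (Z : 'M[C]_(m, n)) i j :
    let G := \sum_k ((Z k i)^* * Z k j : C') in
    let l a := lshift _ (mxvec_index 0 a) in let r a := rshift _ (mxvec_index 0 a) in
    [/\ row_form Z (l i) (l j) = complex.Im G, row_form Z (l i) (r j) = - complex.Re G,
        row_form Z (r i) (l j) = complex.Re G & row_form Z (r i) (r j) = complex.Im G].
  move=> G l r; rewrite /row_form !summxE /G Re_sum Im_sum -sumrN.
  split; apply: eq_bigr => k _; rewrite wedge_entry;
    have [a1 a2 a3 a4] := reC Z k i; have [b1 b2 b3 b4] := reC Z k j;
    rewrite /l /r ?a1 ?a2 ?a3 ?a4 ?b1 ?b2 ?b3 ?b4;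
    by case: (Z k i) => a b; case: (Z k j) => c d /=; ring.
move=> XY; apply/matrixP => s t.
case: (fintype.splitP s) => s' sl; case: (fintype.splitP t) => t' tl.
all: have [i si] : exists i, s' = mxvec_index 0 i by case/mxvec_indexP: s' {sl} => o i; exists i; rewrite (ord1 o).
all: have [j tj] : exists j, t' = mxvec_index 0 j by case/mxvec_indexP: t' {tl} => o j; exists j; rewrite (ord1 o).
all: have [X1 X2 X3 X4] := E X i j; have [Y1 Y2 Y3 Y4] := E Y i j.
- have -> : s = lshift _ s' by exact: val_inj.
  have -> : t = lshift _ t' by exact: val_inj.
  rewrite si tj; exact: etrans X1 (etrans (congr1 (@complex.Im R) (XY i j)) (esym Y1)).
- have -> : s = lshift _ s' by exact: val_inj.
  have -> : t = rshift _ t' by exact: val_inj.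
  rewrite si tj; exact: etrans X2 (etrans (congr1 (fun z => - complex.Re z) (XY i j)) (esym Y2)).
- have -> : s = rshift _ s' by exact: val_inj.
  have -> : t = lshift _ t' by exact: val_inj.
  rewrite si tj; exact: etrans X3 (etrans (congr1 (@complex.Re R) (XY i j)) (esym Y3)).
- have -> : s = rshift _ s' by exact: val_inj.
  have -> : t = rshift _ t' by exact: val_inj.
  rewrite si tj; exact: etrans X4 (etrans (congr1 (@complex.Im R) (XY i j)) (esym Y4)).
Qed.

Lemma row_form_unitary n (X : 'M[C]_n) : (X : 'M[C']_n) \is unitarymx ->
  row_form X = row_form (1%:M : 'M[C]_n).
Proof.
move=> uX; apply: row_form_eq => i j; have /matrixP/(_ i j) := @unitarymx_adj C' n X uX.
rewrite !mxE => E; transitivity ((i == j)%:R : C').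
  by rewrite -E; apply: eq_bigr => k _; rewrite !mxE.
rewrite (bigD1 j)//= big1 => [|k kj]; rewrite !mxE ?eqxx ?(negPf kj) ?mulr0//.
by rewrite addr0 mulr1 eq_sym; case: eqP => _; rewrite ?conjC1 ?conjC0.
Qed.

End RowForm.

Section LastRow.
Context {R : realType}.
Local Notation C := (complex R).
Local Notation C' := (closedC R).
Local Notation ci := (@ci R).
Local Notation o k := (inord k : 'I_4).
Local Open Scope sesquilinear_scope.

(** [cmul z Hc] is [i z], so the last bivector is the share of the last row in [row_form]. *)
Definition w7 (z : coords R 1 4) : 'M[R]_(1 * 4 + 1 * 4) :=
  2^-1 *: (wedge (cmul z (V (o 0) (o 1) 1)) (cmul z (V (o 0) (o 1) ci))
  + wedge (cmul z (V (o 0) (o 2) 1)) (cmul z (V (o 0) (o 2) ci))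
  + wedge (cmul z (V (o 0) (o 3) 1)) (cmul z (V (o 0) (o 3) ci))
  + wedge (cmul z (V (o 1) (o 2) 1)) (cmul z (V (o 1) (o 2) ci))
  + wedge (cmul z (V (o 1) (o 3) 1)) (cmul z (V (o 1) (o 3) ci))
  + wedge (cmul z (V (o 2) (o 3) 1)) (cmul z (V (o 2) (o 3) ci)))
  - 2^-1 *: (row_form (1%:M : 'M[C]_4) - wedge (cmul z Hc) z).

Lemma last_row_linear : linear (last_row : coords R 4 4 -> coords R 1 4).
Proof.
move=> a x y; apply: cmat_inj; rewrite cmat_last_row !cmatP !cmat_last_row.
by apply/rowP => j; move: (cmat x) (cmat y) => X Y; rewrite !mxE.
Qed.

Lemma smooth_last_row : smooth (last_row : coords R 4 4 -> coords R 1 4).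
Proof.
apply: smooth_rvec => i j; under eq_fun do rewrite mxE.
by apply: csmooth_cmat; exact: smooth_id.
Qed.

Lemma jacobian_last_row (x u : coords R 4 4) : u *m jacobian (last_row : _ -> coords R 1 4) x = last_row u.
Proof.
rewrite -(deriveEjacobian u (smooth_diff x smooth_last_row)).
apply: (derive_quad (c := 0)) => h; rewrite scaler0 addr0.
exact: etrans (last_row_linear h u x) (addrC _ _).
Qed.

Lemma push_coboundary m n (r L A : 'M[R]_m) (J : 'M[R]_(m, n)) :
  J^T *m coboundary r L A *m J = (L *m J)^T *m r *m (L *m J) - (A *m J)^T *m r *m (A *m J).
Proof. by rewrite /coboundary mulmxBr mulmxBl !trmx_mul !mulmxA. Qed.

Lemma last_row_V (i j : 'I_4) (c : C) : i != ord_max -> j != ord_max -> last_row (V i j c) = 0.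
Proof.
move=> im jm; rewrite -rvec0; apply: cmat_inj; rewrite cmat_last_row !cmatK.
apply/rowP => k; rewrite !mxE ![ord_max == _]eq_sym (negPf im) (negPf jm) /=.
by rewrite !mulr0 subr0.
Qed.

(** The last row of this root vector is [- conj c] times a basis vector, so right multiplication by
    [x] selects a row of [x]. *)
Lemma last_row_V_max (x : coords R 4 4) (i : 'I_4) (c : C) : i != ord_max ->
  cmul (last_row (V i ord_max c)) x = rvec (- (c^* *: row i (cmat x))).
Proof.
move=> im; apply: cmat_inj; rewrite cmat_cmul cmat_last_row !cmatK.
have -> : row ord_max (Vm i ord_max c) = - (c^* *: delta_mx 0 i) :> 'rV[C']_4.
  apply/rowP => k; rewrite !mxE ![ord_max == _]eq_sym (negPf im) eqxx /=.
  by rewrite !mulr0 sub0r.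
by rewrite mulNmx -scalemxAl -rowE.
Qed.

Lemma wedge_conj n (r : 'rV[C]_n) :
  wedge (rvec (- ((1 : C)^* *: r))) (rvec (- (ci^* *: r))) = wedge (rvec (ci *: r)) (rvec r).
Proof. by rewrite conj_ci rmorph1 scale1r scaleNr opprK rvecN wedgeNl -wedgeC. Qed.

Lemma sum_rows n (A1 A2 A3 A4 A5 A6 B1 B2 B3 B4 B5 B6 : 'rV[R]_n) (w0 w1 w2 w3 w S : 'M[R]_n) :
  A1 = 0 -> A2 = 0 -> A4 = 0 -> wedge A3 B3 = w0 -> wedge A5 B5 = w1 -> wedge A6 B6 = w2 ->
  w = w3 -> S = w0 + w1 + w2 + w3 ->
  wedge A1 B1 + wedge A2 B2 + wedge A3 B3 + wedge A4 B4 + wedge A5 B5 + wedge A6 B6 = S - w.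
Proof. by move=> -> -> -> -> -> -> -> ->; rewrite !wedge0l !add0r addr0 addrK. Qed.

Lemma last_row_push (x : coords R 4 4) : U4 R x ->
  (jacobian (last_row : _ -> coords R 1 4) x)^T *m coboundary rmat (Lmx x) (Rmx x)
    *m jacobian (last_row : _ -> coords R 1 4) x = w7 (last_row x).
Proof.
move=> Ux; rewrite push_coboundary.
have JL u : u *m (Lmx x *m jacobian (last_row : _ -> coords R 1 4) x) = cmul (last_row x) u.
  by rewrite mulmxA mul_Lmx jacobian_last_row last_row_cmul.
have JR u : u *m (Rmx x *m jacobian (last_row : _ -> coords R 1 4) x) = cmul (last_row u) x.
  by rewrite mulmxA mul_Rmx jacobian_last_row last_row_cmul.
apply: etrans (congr2 (fun p q => p - q) (push_six_eq rmatE (JL _) (JL _) (JL _) (JL _) (JL _) (JL _)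
  (JL _) (JL _) (JL _) (JL _) (JL _) (JL _)) (push_six_eq rmatE (JR _) (JR _) (JR _) (JR _) (JR _) (JR _)
  (JR _) (JR _) (JR _) (JR _) (JR _) (JR _))) _.
(* The left-invariant halves agree as they stand; after the sign and the factor 1/2 the
   right-invariant sum remains. *)
apply: congr1; apply: congr1; apply: congr1.
have m3 : ord_max = o 3 by apply: val_inj; rewrite /= inordK.
have c0 k : cmul (0 : coords R 1 4) (k : coords R 4 4) = 0 :> coords R 1 4.
  by rewrite (linear_zero (cmul_linearl k)).
have Z i j c : i != o 3 -> j != o 3 -> cmul (last_row (V i j c)) x = 0.
  by rewrite -m3 => i3 j3; rewrite last_row_V// c0.
have W i : i != o 3 -> wedge (cmul (last_row (V i (o 3) 1)) x) (cmul (last_row (V i (o 3) ci)) x) =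
   wedge (rvec (ci *: row i (cmat x))) (rvec (row i (cmat x))).
  rewrite -m3 => i3; apply: etrans (congr2 (@wedge R _) (last_row_V_max x 1 i3) (last_row_V_max x ci i3)) _.
  exact: wedge_conj.
have HcE : wedge (cmul (last_row x) Hc) (last_row x) =
    wedge (rvec (ci *: row (o 3) (cmat x))) (rvec (row (o 3) (cmat x))).
  rewrite -m3; congr wedge; apply: cmat_inj; rewrite cmat_cmul cmat_last_row !cmatK.
  by rewrite -scalemxAr mulmx1.
have S : row_form (1%:M : 'M[C]_4) = _ :=
  etrans (esym (row_form_unitary Ux)) (big_ord4 (W := 'M[R]_(1 * 4 + 1 * 4)) _).
have n a b (a4 : (a < 4)%N) (b4 : (b < 4)%N) (ab : a != b) : o a != o b by rewrite inord4_eq.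
have z1 := Z _ _ 1 (n 0%N 3%N isT isT isT) (n 1%N 3%N isT isT isT).
have z2 := Z _ _ 1 (n 0%N 3%N isT isT isT) (n 2%N 3%N isT isT isT).
have z4 := Z _ _ 1 (n 1%N 3%N isT isT isT) (n 2%N 3%N isT isT isT).
have Q := sum_rows (cmul (last_row (V (o 0) (o 1) ci)) x) (cmul (last_row (V (o 0) (o 2) ci)) x)
  (cmul (last_row (V (o 1) (o 2) ci)) x) z1 z2 z4 
  (W _ (n 0%N 3%N isT isT isT)) (W _ (n 1%N 3%N isT isT isT)) (W _ (n 2%N 3%N isT isT isT)) HcE S.
exact: Q.
Qed.

Lemma smooth_wedge (U : normedModType R) n (f g : U -> 'rV[R]_n) : smooth f -> smooth g ->
  smooth (fun x => wedge (f x) (g x)).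
Proof.
move=> sf sg; apply: smooth_subr; apply: smooth_mulmx => //; exact: smooth_trmx.
Qed.

Lemma smoothZ (U : normedModType R) m n a (f : U -> 'M[R]_(m, n)) : smooth f ->
  smooth (fun x => a *: f x).
Proof.
move=> /(smooth_on_mxP _ openT) sf.
apply/(smooth_on_mxP _ openT) => i j; under eq_fun do rewrite mxE.
by apply: (smooth_onM openT) => //; exact: smooth_on_cst.
Qed.

Lemma smooth_addr (U : normedModType R) m n (f g : U -> 'M[R]_(m, n)) :
  smooth f -> smooth g -> smooth (fun x => f x + g x).
Proof.
move=> /(smooth_on_mxP _ openT) sf /(smooth_on_mxP _ openT) sg.
by apply/(smooth_on_mxP _ openT) => i j; under eq_fun do rewrite !mxE; exact: (smooth_onD openT).
Qed.

Lemma smooth_w7 : smooth w7.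
Proof.
have sV c (i j : 'I_4) : smooth (fun z : coords R 1 4 => cmul z (V i j c)).
  by apply: smooth_cmul; [exact: smooth_id|exact: smooth_on_cst].
apply: smooth_subr; apply: smoothZ.
  by do 5 (apply: smooth_addr; last exact: smooth_wedge); exact: smooth_wedge.
apply: smooth_subr; first exact: smooth_on_cst.
apply: smooth_wedge; last exact: smooth_id.
by apply: smooth_cmul; [exact: smooth_id|exact: smooth_on_cst].
Qed.

Lemma sum_mxvec (T : nmodType) m n (F : 'I_(m * n) -> T) :
  \sum_i F i = \sum_i \sum_j F (mxvec_index i j).
Proof. by rewrite pair_bigA /= (reindex _ (curry_mxvec_bij m n)); apply: eq_bigr => -[]. Qed.

Lemma sqnorm_coords (z : coords R 1 4) : cmat z *m (cmat z)^t* = ((\sum_i z 0 i ^+ 2)%:C%C)%:M :> 'M[C']_1.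
Proof.
apply/matrixP => i j; rewrite !ord1 mxE [RHS]mxE mulr1n big_split_ord /= !sum_mxvec !big_ord1.
rewrite -big_split rmorph_sum; apply: eq_bigr => k _; rewrite !mxE.
by apply/eqP; rewrite eq_complex /=; apply/andP; split; apply/eqP; rewrite ?lshift0; ring.
Qed.

Lemma S7_sphere : S7 R = @sphere R (1 * 4 + 1 * 4).
Proof.
apply/seteqP; split=> z; rewrite /S7 /sphere /=.
  move=> /unitarymxP; rewrite sqnorm_coords => /matrixP/(_ 0 0); rewrite !mxE !mulr1n.
  by move=> /(congr1 (@complex.Re R)).
by move=> z1; apply/unitarymxP; apply: etrans (sqnorm_coords z) _; rewrite z1.
Qed.

Lemma coinduced_S7 (w : coords R 4 4 -> 'M[R]_(4 * 4 + 4 * 4)) :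
  poisson_manifold (U4 R) w ->
  (forall x, U4 R x -> w x = coboundary rmat (Lmx x) (Rmx x)) ->
  coinduced (U4 R) w (S7 R) w7 last_row.
Proof.
move=> pw wE; rewrite S7_sphere; apply: coinduced_sphere => //.
- exact: smooth_last_row.
- by rewrite -S7_sphere; case: (@last_row_quotient R).
- exact: smooth_w7.
- by move=> x Ux; rewrite wE//; exact: last_row_push.
Qed.

End LastRow.

(** * The Poisson 4-sphere *)

Section HopfPolynomials.
Context {R : realType}.

(** The real and imaginary parts of [q1 = z1 z3 + z2 z4] and [q2 = z2 z3^* - z1 z4^*], doubled,
    and [|z1|^2 + |z2|^2 - |z3|^2 - |z4|^2], polarised. *)
Definition hopf_pol (x y s t : seq R) : seq R :=
  [:: 2 * (x`_0 * s`_2 - y`_0 * t`_2 + x`_1 * s`_3 - y`_1 * t`_3);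
      2 * (x`_0 * t`_2 + y`_0 * s`_2 + x`_1 * t`_3 + y`_1 * s`_3);
      2 * (x`_1 * s`_2 + y`_1 * t`_2 - x`_0 * s`_3 - y`_0 * t`_3);
      2 * (y`_1 * s`_2 - x`_1 * t`_2 - y`_0 * s`_3 + x`_0 * t`_3);
      x`_0 * s`_0 + y`_0 * t`_0 + x`_1 * s`_1 + y`_1 * t`_1
      - x`_2 * s`_2 - y`_2 * t`_2 - x`_3 * s`_3 - y`_3 * t`_3].

(** [h] is the squared norm of the point of C^4 above, equal to 1 on the sphere; it keeps every
    entry homogeneous of degree 2 in [v] and [h]. *)
Definition w4_tab (h : R) (v : seq R) : seq (seq R) :=
  let: (a, b, c, d, e) := (v`_0, v`_1, v`_2, v`_3, v`_4) in
  let w01 := 2 * (c ^+ 2 + d ^+ 2 + e ^+ 2 + h * e) in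
  let w02 := - a * d - 2 * b * c in
  let w03 := a * c - 2 * b * d in
  let w04 := - 2 * b * e - 2 * h * b in
  let w12 := 2 * a * c - b * d in
  let w13 := 2 * a * d + b * c in
  let w14 := 2 * a * e + 2 * h * a in
  let w23 := - a ^+ 2 - b ^+ 2 - 2 * e ^+ 2 - 2 * h * e in
  let w24 := 2 * d * e + 2 * h * d in
  let w34 := - 2 * c * e - 2 * h * c in
  [:: [:: 0; w01; w02; w03; w04]; [:: - w01; 0; w12; w13; w14]; [:: - w02; - w12; 0; w23; w24];
      [:: - w03; - w13; - w23; 0; w34]; [:: - w04; - w14; - w24; - w34; 0]].

Definition wdg (k l : nat) (v w : seq R) := v`_k * w`_l - w`_k * v`_l.

Section Identity.
Variables (x0 x1 x2 x3 y0 y1 y2 y3 : R).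
Let x := [:: x0; x1; x2; x3].
Let y := [:: y0; y1; y2; y3].
(** The derivative at [x + i y] in the direction [s + i t], obtained by symmetrising the polarised
    form. *)
Definition dhopf (s t : seq R) : seq R :=
  [seq u.1 + u.2 | u <- zip (hopf_pol x y s t) (hopf_pol s t x y)].

(** Multiplying the constant part of [w7] by [h = |z|^2] makes both sides homogeneous of degree 4 in
    the eight real coordinates, so that the relation holds on all of C^4. The lists are the real and
    imaginary parts of the vectors wedged in [w7], and the factor 2 clears its 1/2. *)
Lemma hopf_identity h k l : (k < 5)%N -> (l < 5)%N ->
  h = x0 ^+ 2 + x1 ^+ 2 + x2 ^+ 2 + x3 ^+ 2 + y0 ^+ 2 + y1 ^+ 2 + y2 ^+ 2 + y3 ^+ 2 ->
  wdg k l (dhopf [:: - x1; x0; 0; 0] [:: - y1; y0; 0; 0])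
          (dhopf [:: - y1; - y0; 0; 0] [:: x1; x0; 0; 0])
  + wdg k l (dhopf [:: - x2; 0; x0; 0] [:: - y2; 0; y0; 0])
          (dhopf [:: - y2; 0; - y0; 0] [:: x2; 0; x0; 0])
  + wdg k l (dhopf [:: - x3; 0; 0; x0] [:: - y3; 0; 0; y0])
          (dhopf [:: - y3; 0; 0; - y0] [:: x3; 0; 0; x0])
  + wdg k l (dhopf [:: 0; - x2; x1; 0] [:: 0; - y2; y1; 0])
          (dhopf [:: 0; - y2; - y1; 0] [:: 0; x2; x1; 0])
  + wdg k l (dhopf [:: 0; - x3; 0; x1] [:: 0; - y3; 0; y1])
          (dhopf [:: 0; - y3; 0; - y1] [:: 0; x3; 0; x1])
  + wdg k l (dhopf [:: 0; 0; - x3; x2] [:: 0; 0; - y3; y2])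
          (dhopf [:: 0; 0; - y3; - y2] [:: 0; 0; x3; x2])
  - (h * wdg k l (dhopf [:: 0; 0; 0; 0] [:: 1; 0; 0; 0]) (dhopf [:: 1; 0; 0; 0] [:: 0; 0; 0; 0])
  + h * wdg k l (dhopf [:: 0; 0; 0; 0] [:: 0; 1; 0; 0]) (dhopf [:: 0; 1; 0; 0] [:: 0; 0; 0; 0])
  + h * wdg k l (dhopf [:: 0; 0; 0; 0] [:: 0; 0; 1; 0]) (dhopf [:: 0; 0; 1; 0] [:: 0; 0; 0; 0])
  + h * wdg k l (dhopf [:: 0; 0; 0; 0] [:: 0; 0; 0; 1]) (dhopf [:: 0; 0; 0; 1] [:: 0; 0; 0; 0])
  - wdg k l (dhopf [:: - y0; - y1; - y2; - y3] x) (dhopf x y))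
  = 2 * (nth [::] (w4_tab h (hopf_pol x y x y)) k)`_l.
Proof.
by move: k l => [|[|[|[|[|k]]]]] [|[|[|[|[|l]]]]] // _ _ ->; rewrite /wdg /=; ring.
Qed.

End Identity.
End HopfPolynomials.

Section PushEntries.
Context {R : realType} {m n : nat}.
Variables (J : 'M[R]_(m, n)) (D : 'rV[R]_m -> seq R).
Hypothesis JD : forall u, u *m J = \row_l (D u)`_l.

Lemma push_wedge_entry Y Z k l : (J^T *m wedge Y Z *m J) k l = wdg k l (D Y) (D Z).
Proof. by rewrite wedge_push !JD wedge_entry !mxE. Qed.

Lemma push_comb_entry (c : R) (Y1 Y2 Y3 Y4 Y5 Y6 Y7 Y8 Y9 Y10 Y11 : 'rV[R]_m)
    (Z1 Z2 Z3 Z4 Z5 Z6 Z7 Z8 Z9 Z10 Z11 : 'rV[R]_m) k l :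
  (J^T *m (c *: (wedge Y1 Z1 + wedge Y2 Z2 + wedge Y3 Z3 + wedge Y4 Z4 + wedge Y5 Z5 + wedge Y6 Z6)
    - c *: (wedge Y7 Z7 + wedge Y8 Z8 + wedge Y9 Z9 + wedge Y10 Z10 - wedge Y11 Z11)) *m J) k l =
  c * (wdg k l (D Y1) (D Z1) + wdg k l (D Y2) (D Z2) + wdg k l (D Y3) (D Z3)
    + wdg k l (D Y4) (D Z4) + wdg k l (D Y5) (D Z5) + wdg k l (D Y6) (D Z6)
    - (wdg k l (D Y7) (D Z7) + wdg k l (D Y8) (D Z8) + wdg k l (D Y9) (D Z9)
    + wdg k l (D Y10) (D Z10) - wdg k l (D Y11) (D Z11))).
Proof.
pose f (T : 'M[R]_m) := (J^T *m T *m J) k l.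
have fD A B : f (A + B) = f A + f B by rewrite /f mulmxDr mulmxDl mxE.
have fZ A a : f (a *: A) = a * f A by rewrite /f -scalemxAr -scalemxAl mxE.
have fN A : f (- A) = - f A by rewrite -scaleN1r fZ mulN1r.
have fw Y Z : f (wedge Y Z) = wdg k l (D Y) (D Z) by exact: push_wedge_entry.
rewrite -/(f _) -scalerBr fZ; congr (_ * _).
by rewrite !(fD, fN, fw).
Qed.

Lemma push_comb_eq (c : R) (Y1 Y2 Y3 Y4 Y5 Y6 Y7 Y8 Y9 Y10 Y11 : 'rV[R]_m)
    (Z1 Z2 Z3 Z4 Z5 Z6 Z7 Z8 Z9 Z10 Z11 : 'rV[R]_m)
    (d1 d2 d3 d4 d5 d6 d7 d8 d9 d10 d11 : seq R) (e1 e2 e3 e4 e5 e6 e7 e8 e9 e10 e11 : seq R) k l :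
  D Y1 = d1 -> D Y2 = d2 -> D Y3 = d3 -> D Y4 = d4 -> D Y5 = d5 -> D Y6 = d6 -> D Y7 = d7 -> D Y8 = d8 -> D Y9 = d9 -> D Y10 = d10 -> D Y11 = d11 ->
  D Z1 = e1 -> D Z2 = e2 -> D Z3 = e3 -> D Z4 = e4 -> D Z5 = e5 -> D Z6 = e6 -> D Z7 = e7 -> D Z8 = e8 -> D Z9 = e9 -> D Z10 = e10 -> D Z11 = e11 ->
  (J^T *m (c *: (wedge Y1 Z1 + wedge Y2 Z2 + wedge Y3 Z3 + wedge Y4 Z4 + wedge Y5 Z5 + wedge Y6 Z6)
    - c *: (wedge Y7 Z7 + wedge Y8 Z8 + wedge Y9 Z9 + wedge Y10 Z10 - wedge Y11 Z11)) *m J) k l =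
  c * (wdg k l d1 e1 + wdg k l d2 e2 + wdg k l d3 e3 + wdg k l d4 e4 + wdg k l d5 e5
    + wdg k l d6 e6 - (wdg k l d7 e7 + wdg k l d8 e8 + wdg k l d9 e9 + wdg k l d10 e10
    - wdg k l d11 e11)).
Proof. by do 22 move=> <-; exact: push_comb_entry. Qed.

End PushEntries.

Section Hopf.
Context {R : realType}.
Local Notation C := (complex R).
Local Notation C' := (closedC R).
Local Notation ci := (@ci R).
Local Notation o k := (inord k : 'I_4).
Implicit Types z u : coords R 1 4.

Definition re_seq z : seq R := mkseq (fun k => complex.Re (cmat z 0 (o k))) 4.
Definition im_seq z : seq R := mkseq (fun k => complex.Im (cmat z 0 (o k))) 4.

Definition hopf z : 'rV[R]_5 := \row_l (hopf_pol (re_seq z) (im_seq z) (re_seq z) (im_seq z))`_l.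

Definition w4 (y : 'rV[R]_5) : 'M[R]_5 :=
  \matrix_(k, l) (nth [::] (w4_tab 1 (mkseq (fun i => y 0 (inord i)) 5)) k)`_l.

Definition dhopf_at z u : seq R := [seq v.1 + v.2 |
  v <- zip (hopf_pol (re_seq z) (im_seq z) (re_seq u) (im_seq u))
           (hopf_pol (re_seq u) (im_seq u) (re_seq z) (im_seq z))].

Lemma smooth_hopf : smooth hopf.
Proof.
apply/(smooth_on_mxP _ openT) => i j.
have sc k : csmooth (fun z : coords R 1 4 => cmat z 0 k) by apply: csmooth_cmat; exact: smooth_id.
have sx k : smooth (fun z : coords R 1 4 => complex.Re (cmat z 0 k)) := (sc k).1.
have sy k : smooth (fun z : coords R 1 4 => complex.Im (cmat z 0 k)) := (sc k).2.
under eq_fun do rewrite mxE.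
have sE (f : coords R 1 4 -> R) : smooth f -> forall k, Ck_on k setT f by [].
have c2 : smooth (fun _ : coords R 1 4 => 2 : R) by exact: smooth_on_cst.
have sM (f g : coords R 1 4 -> R) : smooth f -> smooth g -> smooth (fun z => f z * g z).
  exact: (smooth_onM openT).
have sD (f g : coords R 1 4 -> R) : smooth f -> smooth g -> smooth (fun z => f z + g z).
  exact: (smooth_onD openT).
have sN (f : coords R 1 4 -> R) : smooth f -> smooth (fun z => - f z).
  exact: (smooth_onN openT).
by case: j => [[|[|[|[|[|j]]]]] ?] //=; rewrite ?/hopf_pol /=; apply: sE;
  repeat first [exact: c2 | exact: sx | exact: sy | apply: (sD) | apply: (sN) | apply: (sM)].
Qed.

Lemma smooth_w4 : smooth w4.
Proof.
apply/(smooth_on_mxP _ openT) => i j.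
have sx k : smooth (fun y : 'rV[R]_5 => y 0 k) by exact: smooth_coord.
under eq_fun do rewrite mxE.
have sE (f : 'rV[R]_5 -> R) : smooth f -> forall k, Ck_on k setT f by [].
have sc a : smooth (fun _ : 'rV[R]_5 => a : R) by exact: smooth_on_cst.
have sM (f g : 'rV[R]_5 -> R) : smooth f -> smooth g -> smooth (fun y => f y * g y).
  exact: (smooth_onM openT).
have sD (f g : 'rV[R]_5 -> R) : smooth f -> smooth g -> smooth (fun y => f y + g y).
  exact: (smooth_onD openT).
have sN (f : 'rV[R]_5 -> R) : smooth f -> smooth (fun y => - f y).
  exact: (smooth_onN openT).
by case: i => [[|[|[|[|[|i]]]]] ?] //=; case: j => [[|[|[|[|[|j]]]]] ?] //=; apply: sE; rewrite ?expr2;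
  repeat first [exact: sc | exact: sx | apply: (sD) | apply: (sN) | apply: (sM)].
Qed.

Lemma jacobian_hopf z u : u *m jacobian hopf z = \row_l (dhopf_at z u)`_l.
Proof.
rewrite -(deriveEjacobian u (smooth_diff z smooth_hopf)).
apply: (derive_quad (c := hopf u)) => h.
have E k : complex.Re (cmat (h *: u + z) 0 (o k)) =
      h * complex.Re (cmat u 0 (o k)) + complex.Re (cmat z 0 (o k)) /\
    complex.Im (cmat (h *: u + z) 0 (o k)) =
      h * complex.Im (cmat u 0 (o k)) + complex.Im (cmat z 0 (o k)).
  rewrite cmatP mxE [X in X + _]mxE; case: (cmat u 0 _) (cmat z 0 _) => a b [c d] /=.
  by split; ring.
apply/rowP => l; rewrite /hopf /dhopf_at /re_seq /im_seq /mkseq !mxE /=.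
rewrite (E 0).1 (E 1).1 (E 2).1 (E 3).1 (E 0).2 (E 1).2 (E 2).2 (E 3).2.
move: (cmat z 0 (o 0)) (cmat z 0 (o 1)) (cmat z 0 (o 2)) (cmat z 0 (o 3)).
move: (cmat u 0 (o 0)) (cmat u 0 (o 1)) (cmat u 0 (o 2)) (cmat u 0 (o 3)).
move=> [a0 b0] [a1 b1] [a2 b2] [a3 b3] [c0 d0] [c1 d1] [c2 d2] [c3 d3].
by case: l => [[|[|[|[|[|l]]]]] ?] //=; ring.
Qed.

Lemma re_im_V z i j : (i < 4)%N -> (j < 4)%N ->
  [/\ re_seq (cmul z (V (o i) (o j) 1)) =
        mkseq (fun k => (j == k)%:R * (re_seq z)`_i - (i == k)%:R * (re_seq z)`_j) 4,
      im_seq (cmul z (V (o i) (o j) 1)) =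
        mkseq (fun k => (j == k)%:R * (im_seq z)`_i - (i == k)%:R * (im_seq z)`_j) 4,
      re_seq (cmul z (V (o i) (o j) ci)) =
        mkseq (fun k => - (j == k)%:R * (im_seq z)`_i - (i == k)%:R * (im_seq z)`_j) 4
    & im_seq (cmul z (V (o i) (o j) ci)) =
        mkseq (fun k => (j == k)%:R * (re_seq z)`_i + (i == k)%:R * (re_seq z)`_j) 4].
Proof.
move=> i4 j4.
have E (c : C) k : (k < 4)%N -> cmat (cmul z (V (o i) (o j) c)) 0 (o k) =
    (j == k)%:R * (cmat z 0 (o i) * c) - (i == k)%:R * (cmat z 0 (o j) * (c : C')^*).
  move=> k4; rewrite cmat_cmul /V cmatK /Vm mulmxBr -!scalemxAr.
  rewrite [LHS]mxE [X in X + _]mxE [X in _ + X]mxE [X in _ - X]mxE.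
  have dE (a b : 'I_4) (X : 'rV[C]_4) : (X *m delta_mx a b) 0 (o k) = (b == o k)%:R * X 0 a.
    rewrite mxE (bigD1 a)//= big1 => [|s sa]; rewrite mxE ?eqxx ?(negPf sa) ?mulr0//=.
    by rewrite addr0 mulrC eq_sym.
  rewrite !dE !inord4_eq//; ring.
have N s k : (k < 4)%N -> (mkseq s 4)`_k = s k :> R by move=> k4; rewrite nth_mkseq.
rewrite /re_seq /im_seq !N//.
have c1 : ((1 : C) : C')^* = 1 by rewrite rmorph1.
have c2 : ((ci : C) : C')^* = - ci by exact: conj_ci.
split; apply: (@eq_from_nth _ 0); rewrite ?size_mkseq// => k k4; rewrite !N// E// ?c1 ?c2.
all: case: (cmat z 0 (o i)) (cmat z 0 (o j)) => a b [c d]; case: (j == k); case: (i == k) => /=; ring.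
Qed.

Lemma re_im_row k : (k < 4)%N ->
  [/\ re_seq (rvec (row (o k) (1%:M : 'M[C]_4))) = mkseq (fun l => (k == l)%:R) 4,
      im_seq (rvec (row (o k) (1%:M : 'M[C]_4))) = mkseq (fun l => 0) 4,
      re_seq (rvec (ci *: row (o k) (1%:M : 'M[C]_4))) = mkseq (fun l => 0) 4
    & im_seq (rvec (ci *: row (o k) (1%:M : 'M[C]_4))) = mkseq (fun l => (k == l)%:R) 4].
Proof.
move=> k4; have N s l : (l < 4)%N -> (mkseq s 4)`_l = s l :> R by move=> l4; rewrite nth_mkseq.
split; apply: (@eq_from_nth _ 0); rewrite ?size_mkseq// => l l4.
all: rewrite !N// cmatK !mxE inord4_eq//; case: (k == l) => /=; ring.
Qed.

Lemma re_im_Hc z :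
  re_seq (cmul z Hc) = mkseq (fun l => - (im_seq z)`_l) 4 /\
  im_seq (cmul z Hc) = mkseq (fun l => (re_seq z)`_l) 4.
Proof.
have N s l : (l < 4)%N -> (mkseq s 4)`_l = s l :> R by move=> l4; rewrite nth_mkseq.
split; apply: (@eq_from_nth _ 0); rewrite ?size_mkseq// => l l4.
all: rewrite !N// cmat_cmul cmatK -scalemxAr mulmx1 mxE; case: (cmat z 0 _) => a b /=; ring.
Qed.

Lemma S7_seq z : S7 R z <-> 1 = (re_seq z)`_0 ^+ 2 + (re_seq z)`_1 ^+ 2 + (re_seq z)`_2 ^+ 2
  + (re_seq z)`_3 ^+ 2 + (im_seq z)`_0 ^+ 2 + (im_seq z)`_1 ^+ 2 + (im_seq z)`_2 ^+ 2
  + (im_seq z)`_3 ^+ 2.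
Proof.
rewrite S7_sphere /sphere /= big_split_ord /= !sum_mxvec !big_ord1 !big_ord4.
have [e0 f0] := cmat_entry z 0 (o 0); have [e1 f1] := cmat_entry z 0 (o 1).
have [e2 f2] := cmat_entry z 0 (o 2); have [e3 f3] := cmat_entry z 0 (o 3).
by rewrite -e0 -e1 -e2 -e3 -f0 -f1 -f2 -f3 !addrA; split=> ->.
Qed.

Lemma dhopf_atE z u a b : re_seq u = a -> im_seq u = b ->
  dhopf_at z u = dhopf (re_seq z)`_0 (re_seq z)`_1 (re_seq z)`_2 (re_seq z)`_3
    (im_seq z)`_0 (im_seq z)`_1 (im_seq z)`_2 (im_seq z)`_3 a b.
Proof. by move=> <- <-. Qed.

Lemma dhopf_V z i j : (i < 4)%N -> (j < 4)%N -> i != j ->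
  let D := dhopf (re_seq z)`_0 (re_seq z)`_1 (re_seq z)`_2 (re_seq z)`_3
    (im_seq z)`_0 (im_seq z)`_1 (im_seq z)`_2 (im_seq z)`_3 in
  let x i := (re_seq z)`_i in let y i := (im_seq z)`_i in
  let e a b := mkseq (fun k => if k == i then a else if k == j then b else 0) 4 in
  dhopf_at z (cmul z (V (o i) (o j) 1)) = D (e (- x j) (x i)) (e (- y j) (y i)) /\
  dhopf_at z (cmul z (V (o i) (o j) ci)) = D (e (- y j) (- y i)) (e (x j) (x i)).
Proof.
move=> i4 j4 ij D x y e; have [r1 i1 r2 i2] := re_im_V z i4 j4.
have E (a b : R) : mkseq (fun k => (j == k)%:R * b + (i == k)%:R * a) 4 = e a b.
  apply: eq_mkseq => k; rewrite ![k == _]eq_sym; case: (i =P k) => [<-|_].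
    by rewrite eq_sym (negPf ij) mul0r add0r mul1r.
  by rewrite mul0r addr0; case: (j == k); rewrite ?mul1r ?mul0r.
split; apply: dhopf_atE; [apply: etrans r1 _|apply: etrans i1 _|apply: etrans r2 _|apply: etrans i2 _];
  rewrite -E; apply: eq_mkseq => k; rewrite /x /y;
  move: ((re_seq z)`_i) ((re_seq z)`_j) ((im_seq z)`_i) ((im_seq z)`_j) => p q r t; ring.
Qed.

Lemma dhopf_row z k : (k < 4)%N ->
  let D := dhopf (re_seq z)`_0 (re_seq z)`_1 (re_seq z)`_2 (re_seq z)`_3
    (im_seq z)`_0 (im_seq z)`_1 (im_seq z)`_2 (im_seq z)`_3 in
  let e := mkseq (fun l => (k == l)%:R) 4 in let e0 := mkseq (fun _ => 0) 4 in
  dhopf_at z (rvec (row (o k) (1%:M : 'M[C]_4))) = D e e0 /\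
  dhopf_at z (rvec (ci *: row (o k) (1%:M : 'M[C]_4))) = D e0 e.
Proof. by move=> k4; have [r1 i1 r2 i2] := re_im_row k4; split; exact: dhopf_atE. Qed.

Lemma hopf_push z : S7 R z -> (jacobian hopf z)^T *m w7 z *m jacobian hopf z = w4 (hopf z).
Proof.
move=> /S7_seq Sz; apply/matrixP => k l.
rewrite /w7 /row_form big_ord4 [RHS]mxE.
have -> : mkseq (fun i => hopf z 0 (inord i)) 5 =
    hopf_pol (re_seq z) (im_seq z) (re_seq z) (im_seq z).
  apply: (@eq_from_nth _ 0) => [//|i]; rewrite size_mkseq => i5.
  by rewrite nth_mkseq// mxE inordK.
have [a1 b1] := @dhopf_V z 0 1 isT isT isT; have [a2 b2] := @dhopf_V z 0 2 isT isT isT; have [a3 b3] := @dhopf_V z 0 3 isT isT isT.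
have [a4 b4] := @dhopf_V z 1 2 isT isT isT; have [a5 b5] := @dhopf_V z 1 3 isT isT isT; have [a6 b6] := @dhopf_V z 2 3 isT isT isT.
have [a7 b7] := @dhopf_row z 0 isT; have [a8 b8] := @dhopf_row z 1 isT.
have [a9 b9] := @dhopf_row z 2 isT; have [a10 b10] := @dhopf_row z 3 isT.
have [rH iH] := re_im_Hc z.
apply: etrans (push_comb_eq (@jacobian_hopf z) _ k l a1 a2 a3 a4 a5 a6 b7 b8 b9 b10 (dhopf_atE z rH iH)
  b1 b2 b3 b4 b5 b6 a7 a8 a9 a10 (dhopf_atE z (erefl _) (erefl _))) _.
(* On the sphere [h] is 1, and multiplication by 2 clears the factor 1/2 of [w7]. *)
have := hopf_identity (ltn_ord k) (ltn_ord l) Sz; rewrite !mul1r => Q.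
apply: (mulfI (x := 2)); first by rewrite pnatr_eq0.
by rewrite mulrA divff ?pnatr_eq0// mul1r; exact: Q.
Qed.

End Hopf.

(** * Local triviality *)

Section HopfAlgebra.
Context {C : numClosedFieldType}.
Implicit Types a b c d u v q r N K : C.

Definition row4 (a b c d : C) : 'rV[C]_4 := \row_k nth 0 [:: a; b; c; d] k.

Lemma row4E a b c d : [/\ row4 a b c d 0 (inord 0) = a, row4 a b c d 0 (inord 1) = b,
  row4 a b c d 0 (inord 2) = c & row4 a b c d 0 (inord 3) = d].
Proof. by rewrite !mxE !inordK. Qed.

Lemma row4_eq (z : 'rV[C]_4) :
  z = row4 (z 0 (inord 0)) (z 0 (inord 1)) (z 0 (inord 2)) (z 0 (inord 3)).
Proof.
by apply/rowP; apply: ord4P; have [e0 e1 e2 e3] :=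
  row4E (z 0 (inord 0)) (z 0 (inord 1)) (z 0 (inord 2)) (z 0 (inord 3)).
Qed.

Lemma hmx_row01 u v : hmx u v (inord 0) (inord 0) = u /\ hmx u v (inord 0) (inord 1) = v.
Proof.
have [e0 e1 e2 e3] := ord4_split.
by rewrite e0 e1 /hmx !block4E !mxE.
Qed.

Lemma row4_hmx a b c d u v : row4 a b c d *m hmx u v =
  row4 (a * u - b * v^*) (a * v + b * u^*) (c * u^* - d * v) (c * v^* + d * u).
Proof.
have [x0 x1 x2 x3] := row4E a b c d.
have [y0 y1 y2 y3] := row4E (a * u - b * v^*) (a * v + b * u^*) (c * u^* - d * v) (c * v^* + d * u).
have [e0 e1 e2 e3] := ord4_split.
apply/rowP; apply: ord4P; rewrite [LHS]mxE big_ord4 x0 x1 x2 x3 ?y0 ?y1 ?y2 ?y3;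
  rewrite ?e0 ?e1 ?e2 ?e3 /hmx !block4E !mxE /= ?conjCK; ring.
Qed.

Lemma scale_row4 r a b c d : r *: row4 a b c d = row4 (r * a) (r * b) (r * c) (r * d).
Proof. by apply/rowP; apply: ord4P; rewrite !mxE !inordK. Qed.

(** [su2 (hopf1 a b c d) (hopf2 a b c d)] is the product of [su2 a b] and the adjoint of [su2 x y],
    where [x] and [y] are the conjugates of [c] and [d]; the action multiplies both factors from
    the right by the same matrix. *)
Definition hopf1 a b c d := a * c + b * d.
Definition hopf2 a b c d := b * c^* - a * d^*.
Definition norm2 a b := a * a^* + b * b^*.

(** Multiplying the right-hand sides by [norm2 u v = 1] turns the claims into polynomial identities
    in all the variables and their conjugates. *)
Lemma hopf_invariant a b c d u v : norm2 u v = 1 ->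
  let: (a', b', c', d') := (a * u - b * v^*, a * v + b * u^*, c * u^* - d * v, c * v^* + d * u) in
  [/\ hopf1 a' b' c' d' = hopf1 a b c d, hopf2 a' b' c' d' = hopf2 a b c d,
      norm2 a' b' = norm2 a b & norm2 c' d' = norm2 c d].
Proof.
move=> n1; have m x : x = norm2 u v * x by rewrite n1 mul1r.
rewrite (m (hopf1 a b c d)) (m (hopf2 a b c d)) (m (norm2 a b)) (m (norm2 c d)).
rewrite /hopf1 /hopf2 /norm2 !rmorphD /= !rmorphN /= !rmorphM /= ?conjCK.
by split; ring.
Qed.

Section Chart.
Variables (r N : C).
Hypotheses (rr : r^* = r) (NN : N^* = N) (rN : r * r * N = 1).

Lemma chart1_retract a b c d : N = norm2 a b ->
  let u := r * a in let v := r * b in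
  let q1 := hopf1 a b c d in let q2 := hopf2 a b c d in
  [/\ norm2 u v = 1, r * (N * u) = a, r * (N * v) = b,
      r * (q1 * u^* + q2^* * v) = c & r * (q1 * v^* - q2^* * u) = d].
Proof.
(* Multiplying one side by [r * r * N = 1] reduces each equation to a polynomial identity. *)
rewrite /norm2 => NE; have m x y : x = r * r * (a * a^* + b * b^*) * y -> x = y.
  by rewrite -NE rN mul1r.
rewrite /= /hopf1 /hopf2 !rmorphB /= !rmorphM /= !conjCK rr.
by split; apply: m; rewrite ?NE; ring.
Qed.

(** The relation on [norm2 q1 q2] is the equation of the 4-sphere, with [N] the squared norm of the
    half used for normalising. *)
Lemma chart1_section u v q1 q2 : norm2 u v = 1 -> norm2 q1 q2 = N * (1 - N) ->
  let: (a, b, c, d) := (r * (N * u), r * (N * v), r * (q1 * u^* + q2^* * v),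
    r * (q1 * v^* - q2^* * u)) in
  [/\ hopf1 a b c d = q1, hopf2 a b c d = q2, norm2 a b = N & norm2 c d = 1 - N].
Proof.
rewrite /norm2 => n1 nK; have m x y : x = r * r * N * (u * u^* + v * v^*) * y -> x = y.
  by rewrite n1 rN !mul1r.
rewrite /hopf1 /hopf2 ?(rmorphB, rmorphD, rmorphN, rmorphM) /= ?rmorphM /= ?conjCK rr NN.
split; apply: m; [ring|ring|ring|].
transitivity (r * r * (u * u^* + v * v^*) * (q1 * q1^* + q2 * q2^*)); first by ring.
by rewrite nK; ring.
Qed.

(** Now the second half is normalised, and [su2 a b] is [r] times [su2 q1 q2] times [su2 u v]. The
    conjugates in [u] and [v] occur because the subgroup acts on this half by the conjugate
    block. *)
Lemma chart2_retract a b c d : N = norm2 c d ->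
  let u := r * c^* in let v := r * d^* in
  let q1 := hopf1 a b c d in let q2 := hopf2 a b c d in
  [/\ norm2 u v = 1, r * (q1 * u - q2 * v^*) = a, r * (q1 * v + q2 * u^*) = b,
      r * (N * u^*) = c & r * (N * v^*) = d].
Proof.
rewrite /norm2 => NE; have m x y : x = r * r * (c * c^* + d * d^*) * y -> x = y.
  by rewrite -NE rN mul1r.
rewrite /= /hopf1 /hopf2 !rmorphM /= !conjCK rr.
by split; apply: m; rewrite ?NE; ring.
Qed.

Lemma chart2_section u v q1 q2 : norm2 u v = 1 -> norm2 q1 q2 = N * (1 - N) ->
  let: (a, b, c, d) := (r * (q1 * u - q2 * v^*), r * (q1 * v + q2 * u^*),
    r * (N * u^*), r * (N * v^*)) in
  [/\ hopf1 a b c d = q1, hopf2 a b c d = q2, norm2 a b = 1 - N & norm2 c d = N].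
Proof.
rewrite /norm2 => n1 nK; have m x y : x = r * r * N * (u * u^* + v * v^*) * y -> x = y.
  by rewrite n1 rN !mul1r.
rewrite /hopf1 /hopf2 ?(rmorphB, rmorphD, rmorphN, rmorphM) /= ?rmorphM /= ?conjCK rr NN.
split; apply: m; [ring|ring| |ring].
transitivity (r * r * (u * u^* + v * v^*) * (q1 * q1^* + q2 * q2^*)); first by ring.
by rewrite nK; ring.
Qed.

End Chart.
End HopfAlgebra.

Section Restriction.
Context {R : realType}.

Lemma smooth_onS (U W : normedModType R) (O O' : set U) (f : U -> W) : O `<=` O' ->
  smooth_on O' f -> smooth_on O f.
Proof.
move=> OO sf k; move: (sf k); elim: k f {sf} => [|k IH] f /=; first by move=> cf x /OO; exact: cf.
by move=> [df sf]; split=> [x /OO|v]; [exact: df|exact: IH].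
Qed.

Lemma smooth_on_scale (U : normedModType R) m n (O : set U) (r : U -> R) (f : U -> 'M[R]_(m, n)) :
  open O -> smooth_on O r -> smooth f -> smooth_on O (fun x => r x *: f x).
Proof.
move=> oO sr /(smooth_on_mxP _ openT) sf; apply/(smooth_on_mxP _ oO) => i j.
under eq_fun do rewrite mxE; apply: smooth_onM => //.
by apply: smooth_onS (sf i j) => ?.
Qed.

End Restriction.

(** * Complex coordinates on the two spheres *)

Section Charts.
Context {R : realType}.
Local Notation C := (complex R).
Local Notation C' := (closedC R).
Local Notation o k := (inord k : 'I_4).
Implicit Types (z : coords R 1 4) (y : 'rV[R]_5) (h : coords R 4 4) (a b c d : C').

Lemma big_ord5 (W : nmodType) (F : 'I_5 -> W) :
  \sum_i F i = F (inord 0) + F (inord 1) + F (inord 2) + F (inord 3) + F (inord 4).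
Proof.
rewrite !big_ord_recr /= big_ord0 Monoid.mul1m.
by do 4?congr (_ + _); congr F; apply: val_inj; rewrite /= inordK.
Qed.

Definition sphere_pt (q1 q2 : C') (e : R) : 'rV[R]_5 :=
  \row_l [:: 2 * complex.Re q1; 2 * complex.Im q1; 2 * complex.Re q2; 2 * complex.Im q2; e]`_l.

Definition pt1 y : C' := Complex (y 0 (inord 0) / 2) (y 0 (inord 1) / 2).
Definition pt2 y : C' := Complex (y 0 (inord 2) / 2) (y 0 (inord 3) / 2).

Lemma sphere_ptE q1 q2 e :
  [/\ pt1 (sphere_pt q1 q2 e) = q1, pt2 (sphere_pt q1 q2 e) = q2
    & sphere_pt q1 q2 e 0 (inord 4) = e].
Proof.
have f (x : R) : 2 * x / 2 = x by field.
by split; rewrite /pt1 /pt2 !mxE !inordK//= !f; [case: q1|case: q2].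
Qed.

Lemma sphere_ptK y : sphere_pt (pt1 y) (pt2 y) (y 0 (inord 4)) = y.
Proof.
have f (x : R) : 2 * (x / 2) = x by field.
apply/rowP => -[[|[|[|[|[|l]]]]] l5] //=; rewrite mxE /= ?f; congr (y 0 _);
  by apply: val_inj; rewrite /= inordK.
Qed.

Definition rnorm2 a b : R := complex.Re (norm2 a b).

Lemma norm2_real a b : norm2 a b = (rnorm2 a b)%:C%C.
Proof.
rewrite /rnorm2 /norm2; case: a b => a0 a1 [b0 b1].
by apply/eqP; rewrite eq_complex /=; apply/andP; split; apply/eqP; ring.
Qed.

Lemma re_im_row4 a b c d :
  re_seq (rvec (row4 a b c d)) = [:: complex.Re a; complex.Re b; complex.Re c; complex.Re d] /\
  im_seq (rvec (row4 a b c d)) = [:: complex.Im a; complex.Im b; complex.Im c; complex.Im d].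
Proof.
have [e0 e1 e2 e3] := row4E a b c d.
by rewrite /re_seq /im_seq /mkseq /= cmatK e0 e1 e2 e3.
Qed.

Lemma hopf_row4 a b c d :
  hopf (rvec (row4 a b c d)) =
  sphere_pt (hopf1 a b c d) (hopf2 a b c d) (rnorm2 a b - rnorm2 c d).
Proof.
rewrite /hopf /sphere_pt /rnorm2 /norm2 /hopf1 /hopf2; have [-> ->] := re_im_row4 a b c d.
case: a b c d => a0 a1 [b0 b1] [c0 c1] [d0 d1].
by apply/rowP => -[[|[|[|[|[|l]]]]] l5] //; rewrite !mxE /=; ring.
Qed.

Lemma S7_row4 a b c d : S7 R (rvec (row4 a b c d)) <-> rnorm2 a b + rnorm2 c d = 1.
Proof.
rewrite S7_seq; have [-> ->] := re_im_row4 a b c d; rewrite /rnorm2 /norm2.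
case: a b c d => a0 a1 [b0 b1] [c0 c1] [d0 d1] /=.
set X := (X in 1 = X); set Y := (Y in _ <-> Y = 1).
have -> : X = Y by rewrite /X /Y; ring.
by split=> ->.
Qed.

(** With [q] the pair [pt1 y], [pt2 y], the sphere is [4 |q|^2 + e^2 = 1], that is
    [|q|^2 = N (1 - N)] for [N = (1 + e) / 2]. The right-hand side is unchanged when [e] changes
    sign, which serves both charts. *)
Lemma S4_pt y (e : R) : e = y 0 (inord 4) \/ e = - y 0 (inord 4) ->
  S4 R y <-> rnorm2 (pt1 y) (pt2 y) = (1 + e) / 2 * (1 - (1 + e) / 2).
Proof.
rewrite /S4 /= big_ord5 /rnorm2 /norm2 /pt1 /pt2 /=.
move: (y 0 (inord 0)) (y 0 (inord 1)) (y 0 (inord 2)) (y 0 (inord 3)) (y 0 (inord 4)).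
by move=> y0 y1 y2 y3 y4 [->|->]; split=> E; lra.
Qed.

Lemma coords_row4 z : exists a b c d, z = rvec (row4 a b c d).
Proof.
exists (cmat z 0 (o 0)), (cmat z 0 (o 1)), (cmat z 0 (o 2)), (cmat z 0 (o 3)).
by rewrite -[LHS]rvecK {1}[cmat z](row4_eq (C := C')).
Qed.

Lemma SU2dg_norm2 (u v : C') : norm2 u v = 1 -> SU2dg R (rvec (hmx u v)).
Proof. by move=> n1; apply/SU2dgP; exists u, v; rewrite cmatK. Qed.

Lemma SU2dg_hmx h : SU2dg R h -> exists u v : C', norm2 u v = 1 /\ h = rvec (hmx u v).
Proof. by move=> /SU2dgP[u [v [n1 hE]]]; exists u, v; split=> //; rewrite -hE rvecK. Qed.

Lemma cmul_row4 a b c d (u v : C') : cmul (rvec (row4 a b c d)) (rvec (hmx u v)) =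
  rvec (row4 (a * u - b * v^*) (a * v + b * u^*) (c * u^* - d * v) (c * v^* + d * u)).
Proof. by rewrite /cmul !cmatK; congr rvec; exact: row4_hmx. Qed.

Lemma cmul_hmx (a b u v : C') : cmul (rvec (hmx a b)) (rvec (hmx u v)) =
  rvec (hmx (a * u - b * v^*) (a * v + b * u^*)).
Proof. by rewrite /cmul !cmatK; congr rvec; exact: hmx_mul. Qed.

Lemma cmul_S7_hopf z h : S7 R z -> SU2dg R h -> S7 R (cmul z h) /\ hopf (cmul z h) = hopf z.
Proof.
have [a [b [c [d ->]]]] := coords_row4 z.
move=> Sz /SU2dg_hmx[u [v [n1 ->]]]; rewrite cmul_row4.
have := hopf_invariant a b c d n1 => -[e1 e2 e3 e4].
split; last by rewrite !hopf_row4 e1 e2 /rnorm2 e3 e4.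
by apply/S7_row4; rewrite /rnorm2 e3 e4; exact/S7_row4.
Qed.

Lemma hopf_S4 z : S7 R z -> S4 R (hopf z).
Proof.
have [a [b [c [d ->]]]] := coords_row4 z; move=> /S7_row4 n1.
rewrite hopf_row4; apply/(S4_pt (or_introl (erefl _))).
have [-> -> ->] := sphere_ptE (hopf1 a b c d) (hopf2 a b c d) (rnorm2 a b - rnorm2 c d).
have -> : (1 + (rnorm2 a b - rnorm2 c d)) / 2 = rnorm2 a b by lra.
have -> : 1 - rnorm2 a b = rnorm2 c d by lra.
rewrite /rnorm2 /norm2 /hopf1 /hopf2; case: a b c d {n1} => a0 a1 [b0 b1] [c0 c1] [d0 d1] /=.
ring.
Qed.

End Charts.

Section SmoothCharts.
Context {R : realType}.
Local Notation C := (complex R).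
Local Notation C' := (closedC R).
Local Notation o k := (inord k : 'I_4).

Section Entries.
Context {U : normedModType R}.
Implicit Types f g : U -> C'.

Lemma csmooth_conj f : csmooth f -> csmooth (fun x => (f x)^* : C').
Proof.
move=> [f1 f2]; split.
  by rewrite (_ : (fun _ => _) = fun x => complex.Re (f x))//; apply/funext => x; case: (f x).
rewrite (_ : (fun _ => _) = fun x => - complex.Im (f x)); first exact: (smooth_onN openT).
by apply/funext => x; case: (f x).
Qed.

Lemma csmoothN f : csmooth f -> csmooth (fun x => - f x).
Proof.
move=> sf; rewrite (_ : (fun _ => _) = fun x => (-1) * f x).
  by apply: csmoothM => //; exact: csmooth_cst.
by apply/funext => x; rewrite mulN1r.
Qed.

Lemma csmooth_Complex (f g : U -> R) : smooth f -> smooth g ->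
  csmooth (fun x => Complex (f x) (g x)).
Proof. by []. Qed.

Lemma smooth_row4 (f0 f1 f2 f3 : U -> C') : csmooth f0 -> csmooth f1 -> csmooth f2 ->
  csmooth f3 -> smooth (fun x => rvec (row4 (f0 x) (f1 x) (f2 x) (f3 x))).
Proof.
move=> s0 s1 s2 s3; apply: smooth_rvec => i; rewrite ord1; apply: ord4P.
all: by under eq_fun do rewrite mxE inordK//.
Qed.

Lemma smooth_hmx f g : csmooth f -> csmooth g -> smooth (fun x => rvec (hmx (f x) (g x))).
Proof.
move=> sf sg; have [e0 e1 e2 e3] := ord4_split.
have cf := csmooth_conj sf; have cg := csmooth_conj sg.
have ccf := csmooth_conj cf; have ccg := csmooth_conj cg.
have n1 := csmoothN cg; have n2 := csmoothN ccg; have z : csmooth (fun _ : U => 0 : C') by exact: csmooth_cst.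
apply: smooth_rvec; apply: ord4P; apply: ord4P; rewrite ?e0 ?e1 ?e2 ?e3 /hmx;
  under eq_fun do rewrite block4E mxE /=; done.
Qed.

End Entries.

Variable e : R.

(** At the image of a point of the 7-sphere, [height 1] and [height (-1)] are the squared norms
    of its two halves in C^2, so the charts are where one of the halves does not vanish. *)
Definition height (y : 'rV[R]_5) : R := (1 + e * y 0 (inord 4)) / 2.
Definition scaling (y : 'rV[R]_5) : R := (Num.sqrt (height y))^-1.
Definition chart : set 'rV[R]_5 := [set y | 0 < height y].

Lemma smooth_height (U : normedModType R) (f : U -> 'rV[R]_5) : smooth f ->
  smooth (fun x => height (f x)).
Proof.
move=> /(smooth_on_mxP _ openT) sf; apply: (smooth_onM openT); last exact: smooth_on_cst.
apply: (smooth_onD openT); first exact: smooth_on_cst.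
by apply: (smooth_onM openT) => //; exact: smooth_on_cst.
Qed.

Lemma open_preimage_chart (U : normedModType R) (f : U -> 'rV[R]_5) : smooth f ->
  open (f @^-1` chart).
Proof.
move=> sf; have /open_comp := @open_gt R 0; apply => x _.
by apply: differentiable_continuous; have [+ _] := smooth_height sf 1%N; apply.
Qed.

Lemma smooth_on_chart (U : normedModType R) m n (f : U -> 'rV[R]_5) (g : U -> 'M[R]_(m, n)) :
  smooth f -> smooth g -> smooth_on (f @^-1` chart) (fun x => scaling (f x) *: g x).
Proof.
move=> sf sg; have oO := open_preimage_chart sf; apply: smooth_on_scale => //.
apply: smooth_on_rsqrt => //.
by apply: smooth_onS (smooth_height sf).
Qed.

Lemma scaling_sq y : chart y -> scaling y * scaling y * height y = 1.
Proof.
move=> hy; rewrite /scaling -invfM -expr2 sqr_sqrtr ?ltW// mulVf//; exact: lt0r_neq0.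
Qed.

End SmoothCharts.

Section Distributivity.
Context {C : numClosedFieldType}.
Implicit Types r a b c d u v : C.

Lemma distr_sub r a b u v : r * (a * u - b * v^*) = r * a * u - r * b * v^*.
Proof. by rewrite mulrBr !mulrA. Qed.

Lemma distr_add r a b u v : r * (a * v + b * u^*) = r * a * v + r * b * u^*.
Proof. by rewrite mulrDr !mulrA. Qed.

Lemma distr_conj_sub r c d u v : r * (c * u^* - d * v)^* = r * c^* * u - r * d^* * v^*.
Proof. by rewrite rmorphB /= !rmorphM /= conjCK distr_sub. Qed.

Lemma distr_conj_add r c d u v : r * (c * v^* + d * u)^* = r * c^* * v + r * d^* * u^*.
Proof. by rewrite rmorphD /= !rmorphM /= conjCK distr_add. Qed.

Lemma conj_scale r a b : r^* = r -> a^* = a -> r * (r * (a * b^*))^* = r * (r * (a * b)).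
Proof. by move=> rr aa; rewrite !rmorphM /= conjCK rr aa. Qed.

End Distributivity.

(** * Trivialisations and the Poisson bundle *)

Section HopfBundle.
Context {R : realType}.
Local Notation C := (complex R).
Local Notation C' := (closedC R).
Local Notation o k := (inord k : 'I_4).
Local Notation base w := (lsubmx w : 'rV[R]_5).
Local Notation fibre w := (rsubmx w : coords R 4 4).
Implicit Types (z : coords R 1 4) (y : 'rV[R]_5) (h : coords R 4 4) (a b c d u v : C').

Lemma scale_rvec_row4 (r : R) a b c d : r *: rvec (row4 a b c d) =
  rvec (row4 (r%:C%C * a) (r%:C%C * b) (r%:C%C * c) (r%:C%C * d)).
Proof. by rewrite -rvecZ; congr rvec; exact: scale_row4. Qed.

Lemma scale_rvec_hmx (r : R) a b : r *: rvec (hmx a b) = rvec (hmx (r%:C%C * a) (r%:C%C * b)).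
Proof.
have h0 : hmx 0 0 = 0 :> 'M[C']_4.
  have := @hmx_linear C' 1 0 0 0 0 (rmorph1 _); rewrite mulr0 addr0 scale1r.
  by move=> /esym/eqP; rewrite addrC -subr_eq0 addrK => /eqP.
rewrite -rvecZ; congr rvec.
have := @hmx_linear C' (r%:C%C) a b 0 0 (conj_real r); rewrite h0 !addr0; exact: esym.
Qed.

Definition coords1 (u v q1 q2 : C') (N : C') : 'rV[C']_4 :=
  row4 (N * u) (N * v) (q1 * u^* + q2^* * v) (q1 * v^* - q2^* * u).
Definition coords2 (u v q1 q2 : C') (N : C') : 'rV[C']_4 :=
  row4 (q1 * u - q2 * v^*) (q1 * v + q2 * u^*) (N * u^*) (N * v^*).

Definition triv1 z : coords R 4 4 :=
  scaling 1 (hopf z) *: rvec (hmx (cmat z 0 (o 0)) (cmat z 0 (o 1))).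
Definition triv2 z : coords R 4 4 :=
  scaling (-1) (hopf z) *: rvec (hmx ((cmat z 0 (o 2))^* : C') ((cmat z 0 (o 3))^* : C')).

Definition sect1 (w : 'rV[R]_(5 + (4 * 4 + 4 * 4))) : coords R 1 4 :=
  scaling 1 (base w) *: rvec (coords1 (cmat (fibre w) (o 0) (o 0)) (cmat (fibre w) (o 0) (o 1))
    (pt1 (base w)) (pt2 (base w)) ((height 1 (base w))%:C%C)).
Definition sect2 (w : 'rV[R]_(5 + (4 * 4 + 4 * 4))) : coords R 1 4 :=
  scaling (-1) (base w) *: rvec (coords2 (cmat (fibre w) (o 0) (o 0)) (cmat (fibre w) (o 0) (o 1))
    (pt1 (base w)) (pt2 (base w)) ((height (-1) (base w))%:C%C)).

Lemma cmat_row4 a b c d (z := rvec (row4 a b c d)) :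
  [/\ cmat z 0 (o 0) = a, cmat z 0 (o 1) = b, cmat z 0 (o 2) = c & cmat z 0 (o 3) = d].
Proof. by rewrite /z cmatK; exact: row4E. Qed.

Lemma triv1_row4 a b c d (z := rvec (row4 a b c d)) (r := ((scaling 1 (hopf z))%:C%C : C')) :
  triv1 z = rvec (hmx (r * a) (r * b)).
Proof. by rewrite /triv1; have [-> -> _ _] := cmat_row4 a b c d; exact: scale_rvec_hmx. Qed.

Lemma triv2_row4 a b c d (z := rvec (row4 a b c d)) (r := ((scaling (-1) (hopf z))%:C%C : C')) :
  triv2 z = rvec (hmx (r * c^*) (r * d^*)).
Proof. by rewrite /triv2; have [_ _ -> ->] := cmat_row4 a b c d; exact: scale_rvec_hmx. Qed.

Lemma sect1_row y u v (r := ((scaling 1 y)%:C%C : C')) (N := ((height 1 y)%:C%C : C'))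
    (q1 := pt1 y) (q2 := pt2 y) :
  sect1 (row_mx y (rvec (hmx u v))) =
  rvec (row4 (r * (N * u)) (r * (N * v)) (r * (q1 * u^* + q2^* * v)) (r * (q1 * v^* - q2^* * u))).
Proof.
rewrite /sect1 row_mxKl row_mxKr cmatK; have [-> ->] := @hmx_row01 C' u v.
exact: scale_rvec_row4.
Qed.

Lemma sect2_row y u v (r := ((scaling (-1) y)%:C%C : C')) (N := ((height (-1) y)%:C%C : C'))
    (q1 := pt1 y) (q2 := pt2 y) :
  sect2 (row_mx y (rvec (hmx u v))) =
  rvec (row4 (r * (q1 * u - q2 * v^*)) (r * (q1 * v + q2 * u^*)) (r * (N * u^*)) (r * (N * v^*))).
Proof.
rewrite /sect2 row_mxKl row_mxKr cmatK; have [-> ->] := @hmx_row01 C' u v.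
exact: scale_rvec_row4.
Qed.

Lemma scaling_sqC e y : chart e y ->
  ((scaling e y)%:C%C : C') * (scaling e y)%:C%C * (height e y)%:C%C = 1.
Proof. by move=> /scaling_sq E; rewrite -!rmorphM /= E. Qed.

Lemma height_S7 a b c d : S7 R (rvec (row4 a b c d)) ->
  (height 1 (hopf (rvec (row4 a b c d))))%:C%C = norm2 a b /\
  (height (-1) (hopf (rvec (row4 a b c d))))%:C%C = norm2 c d.
Proof.
move=> /S7_row4 n1; rewrite hopf_row4 /height.
have [_ _ ->] := sphere_ptE (hopf1 a b c d) (hopf2 a b c d) (rnorm2 a b - rnorm2 c d).
by rewrite !norm2_real; split; congr (_%:C)%C; lra.
Qed.

Lemma S4_height e y : e = 1 \/ e = -1 -> S4 R y ->
  norm2 (pt1 y) (pt2 y) = (height e y)%:C%C * (1 - (height e y)%:C%C) :> C'.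
Proof.
move=> e1 Sy; have E : e * y 0 (inord 4) = y 0 (inord 4) \/ e * y 0 (inord 4) = - y 0 (inord 4).
  by case: e1 => ->; [left|right]; ring.
rewrite norm2_real ((S4_pt E).1 Sy) -/(height e y).
by rewrite rmorphM rmorphB rmorph1.
Qed.

Lemma hopf_eq y a b c d : hopf1 a b c d = pt1 y -> hopf2 a b c d = pt2 y ->
  rnorm2 a b - rnorm2 c d = y 0 (inord 4) -> hopf (rvec (row4 a b c d)) = y.
Proof. by rewrite hopf_row4 => -> -> ->; exact: sphere_ptK. Qed.

Lemma real_inj (x y : R) : (x%:C%C = y%:C%C :> C') -> x = y.
Proof. by move=> []. Qed.

Lemma rvec_hmx_eq (p q p' q' : C') : p = p' -> q = q' ->
  rvec (hmx p q) = rvec (hmx p' q') :> coords R 4 4.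
Proof. by move=> -> ->. Qed.

Lemma pt_hopf a b c d (y := hopf (rvec (row4 a b c d))) :
  pt1 y = hopf1 a b c d /\ pt2 y = hopf2 a b c d.
Proof.
rewrite /y hopf_row4.
by case: (sphere_ptE (hopf1 a b c d) (hopf2 a b c d) (rnorm2 a b - rnorm2 c d)).
Qed.

Lemma trivialization1 z : S7 R z -> chart 1 (hopf z) ->
  [/\ SU2dg R (triv1 z), sect1 (row_mx (hopf z) (triv1 z)) = z
    & forall h, SU2dg R h -> hopf (cmul z h) = hopf z /\ triv1 (cmul z h) = cmul (triv1 z) h].
Proof.
have [a [b [c [d ->]]]] := coords_row4 z => Sz Oz; have [N1 _] := height_S7 Sz.
have [p1 p2] := pt_hopf a b c d.
have [n1 E1 E2 E3 E4] := chart1_retract (conj_real _) (scaling_sqC Oz) c d N1.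
rewrite triv1_row4; split; first exact: SU2dg_norm2.
  by rewrite sect1_row p1 p2 E1 E2 E3 E4.
move=> h Hh; have [_ hE] := cmul_S7_hopf Sz Hh; split=> //.
have [u [v [_ uv]]] := SU2dg_hmx Hh; rewrite uv in hE *.
rewrite cmul_row4 in hE *; rewrite triv1_row4 hE cmul_hmx.
exact: rvec_hmx_eq (distr_sub _ _ _ _ _) (distr_add _ _ _ _ _).
Qed.

Lemma trivialization2 z : S7 R z -> chart (-1) (hopf z) ->
  [/\ SU2dg R (triv2 z), sect2 (row_mx (hopf z) (triv2 z)) = z
    & forall h, SU2dg R h -> hopf (cmul z h) = hopf z /\ triv2 (cmul z h) = cmul (triv2 z) h].
Proof.
have [a [b [c [d ->]]]] := coords_row4 z => Sz Oz; have [_ N2] := height_S7 Sz.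
have [p1 p2] := pt_hopf a b c d.
have [n1 E1 E2 E3 E4] := chart2_retract (conj_real _) (scaling_sqC Oz) a b N2.
rewrite triv2_row4; split; first exact: SU2dg_norm2.
  by rewrite sect2_row p1 p2 E1 E2 E3 E4.
move=> h Hh; have [_ hE] := cmul_S7_hopf Sz Hh; split=> //.
have [u [v [_ uv]]] := SU2dg_hmx Hh; rewrite uv in hE *.
rewrite cmul_row4 in hE *; rewrite triv2_row4 hE cmul_hmx.
exact: rvec_hmx_eq (distr_conj_sub _ _ _ _ _) (distr_conj_add _ _ _ _ _).
Qed.

Lemma section_point y a b c d (N M : R) : hopf1 a b c d = pt1 y -> hopf2 a b c d = pt2 y ->
  norm2 a b = N%:C%C -> norm2 c d = M%:C%C -> N + M = 1 -> N - M = y 0 (inord 4) ->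
  S7 R (rvec (row4 a b c d)) /\ hopf (rvec (row4 a b c d)) = y.
Proof.
rewrite !norm2_real => E1 E2 /real_inj E3 /real_inj E4 NM Ny.
by split; [apply/S7_row4|apply: hopf_eq E1 E2 _]; rewrite E3 E4.
Qed.

Lemma scaling_cancel e y u : chart e y ->
  (scaling e y)%:C%C * ((scaling e y)%:C%C * ((height e y)%:C%C * u)) = u :> C'.
Proof. by move=> /scaling_sqC E; rewrite !mulrA E mul1r. Qed.

Lemma section1 y h : S4 R y -> chart 1 y -> SU2dg R h ->
  [/\ S7 R (sect1 (row_mx y h)), hopf (sect1 (row_mx y h)) = y & triv1 (sect1 (row_mx y h)) = h].
Proof.
move=> Sy Oy /SU2dg_hmx[u [v [n1 ->]]].
have rN := scaling_sqC Oy.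
have [E1 E2 E3 E4] := chart1_section (conj_real _) (conj_real _) rN n1 (S4_height (or_introl (erefl _)) Sy).
have E5 := etrans E4 (esym (etrans (rmorphB _ 1 (height 1 y)) (congr1 (fun p => p - _) (rmorph1 _)))).
have hN : height 1 y + (1 - height 1 y) = 1 by ring.
have hD : height 1 y - (1 - height 1 y) = y 0 (inord 4) by rewrite /height; field.
have [Sp Hp] := section_point E1 E2 E3 E5 hN hD.
rewrite sect1_row; split=> //; rewrite triv1_row4 Hp.
exact: rvec_hmx_eq (scaling_cancel _ Oy) (scaling_cancel _ Oy).
Qed.

Lemma section2 y h : S4 R y -> chart (-1) y -> SU2dg R h ->
  [/\ S7 R (sect2 (row_mx y h)), hopf (sect2 (row_mx y h)) = y & triv2 (sect2 (row_mx y h)) = h].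
Proof.
move=> Sy Oy /SU2dg_hmx[u [v [n1 ->]]].
have rN := scaling_sqC Oy.
have [E1 E2 E3 E4] := chart2_section (conj_real _) (conj_real _) rN n1 (S4_height (or_intror (erefl _)) Sy).
have E5 := etrans E3 (esym (etrans (rmorphB _ 1 (height (-1) y)) (congr1 (fun p => p - _) (rmorph1 _)))).
have hN : (1 - height (-1) y) + height (-1) y = 1 by ring.
have hD : (1 - height (-1) y) - height (-1) y = y 0 (inord 4) by rewrite /height; field.
have [Sp Hp] := section_point E1 E2 E5 E4 hN hD.
rewrite sect2_row; split=> //; rewrite triv2_row4 Hp.
(* The conjugation in [triv2] undoes the one that [sect2] puts on the second half. *)
have cc (w : C') : ((scaling (-1) y)%:C%C : C') * (((scaling (-1) y)%:C%C : C') * (((height (-1) y)%:C%C : C') * w^*))^* = w.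
  have E := @conj_scale C' ((scaling (-1) y)%:C%C) ((height (-1) y)%:C%C) w (conj_real _) (conj_real _).
  have F := scaling_cancel w Oy.
  exact: etrans E F.
exact: rvec_hmx_eq (cc _) (cc _).
Qed.

(** The two heights add up to 1, so one of them is positive. *)
Lemma chart_cover y : chart 1 y \/ chart (-1) y.
Proof.
rewrite /chart /= /height; have [|] := ltrP 0 ((1 + 1 * y 0 (inord 4)) / 2); first by left.
by right; lra.
Qed.

(** Surjectivity comes from the local sections, evaluated at the identity of the group. *)
Lemma hopf_image : hopf @` S7 R = S4 R.
Proof.
apply/seteqP; split=> [_ [z Sz <-]|y Sy]; first exact: hopf_S4.
have [Oy|Oy] := chart_cover y.
  have [Sp Hp _] := section1 Sy Oy (@SU2dg_cone R).
  by exists (sect1 (row_mx y cone)).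
have [Sp Hp _] := section2 Sy Oy (@SU2dg_cone R).
by exists (sect2 (row_mx y cone)).
Qed.

Lemma smooth_triv1 : smooth_on (hopf @^-1` chart 1) triv1.
Proof.
apply: smooth_on_chart; first exact: smooth_hopf.
by apply: smooth_hmx; apply: csmooth_cmat; exact: smooth_id.
Qed.

Lemma smooth_triv2 : smooth_on (hopf @^-1` chart (-1)) triv2.
Proof.
apply: smooth_on_chart; first exact: smooth_hopf.
by apply: smooth_hmx; apply: csmooth_conj; apply: csmooth_cmat; exact: smooth_id.
Qed.

Section SmoothSections.
Local Notation W := ('rV[R]_(5 + (4 * 4 + 4 * 4))).

Lemma csmooth_pt (i j : 'I_5) :
  csmooth (fun w : W => Complex (base w 0 i / 2) (base w 0 j / 2)).
Proof.
have /(smooth_on_mxP _ openT) sb : smooth (fun w : W => base w) by exact: smooth_lsubmx.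
by apply: csmooth_Complex; apply: (smooth_onM openT) => //; exact: smooth_on_cst.
Qed.

Lemma csmooth_height e : csmooth (fun w : W => ((height e (base w))%:C%C : C')).
Proof.
apply: csmooth_Complex; last exact: smooth_on_cst.
by apply: smooth_height; exact: smooth_lsubmx.
Qed.

Lemma csmooth_fibre (i j : 'I_4) : csmooth (fun w : W => cmat (fibre w) i j : C').
Proof. by apply: csmooth_cmat; exact: smooth_rsubmx. Qed.

Lemma smooth_sect1 : smooth_on [set w : W | chart 1 (base w)] sect1.
Proof.
have su := csmooth_fibre (o 0) (o 0); have sv := csmooth_fibre (o 0) (o 1).
have s1 := csmooth_pt (inord 0) (inord 1); have s2 := csmooth_pt (inord 2) (inord 3).
have sN := csmooth_height 1.
apply: smooth_on_chart; first exact: smooth_lsubmx.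
apply: smooth_row4; [exact: csmoothM|exact: csmoothM| |].
  by apply: csmoothD; apply: csmoothM => //; exact: csmooth_conj.
apply: csmoothD; first by apply: csmoothM => //; exact: csmooth_conj.
by apply: csmoothN; apply: csmoothM => //; exact: csmooth_conj.
Qed.

Lemma smooth_sect2 : smooth_on [set w : W | chart (-1) (base w)] sect2.
Proof.
have su := csmooth_fibre (o 0) (o 0); have sv := csmooth_fibre (o 0) (o 1).
have s1 := csmooth_pt (inord 0) (inord 1); have s2 := csmooth_pt (inord 2) (inord 3).
have sN := csmooth_height (-1).
apply: smooth_on_chart; first exact: smooth_lsubmx.
apply: smooth_row4; last 2 first.
- by apply: csmoothM => //; exact: csmooth_conj.
- by apply: csmoothM => //; exact: csmooth_conj.
- apply: csmoothD; first exact: csmoothM.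
  by apply: csmoothN; apply: csmoothM => //; exact: csmooth_conj.
- by apply: csmoothD; apply: csmoothM => //; exact: csmooth_conj.
Qed.

End SmoothSections.

Lemma hopf_principal_bundle :
  principal_bundle (SU2dg R) (fun z h => cmul z h) (S7 R) (S4 R) hopf.
Proof.
split.
- exact: SU2dg_lie_subgroup.
- by rewrite S7_sphere; exact: sphere_submanifold.
- exact: sphere_submanifold.
- split.
  + by apply: smooth_cmul; [exact: smooth_lsubmx|exact: smooth_rsubmx].
  + by move=> z h Sz Hh; have [] := cmul_S7_hopf Sz Hh.
  + by move=> z _; exact: cmul1.
  + by move=> z h k _ _ _; exact/esym/cmulA.
split; [exact: smooth_hopf|exact: hopf_S4|move=> y Sy].
have [Oy|Oy] := chart_cover y.
  exists (chart 1), triv1, sect1; split.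
  + by split=> //; exact: (open_preimage_chart 1 (@smooth_id R 5)).
  + exact: smooth_triv1.
  + exact: smooth_sect1.
  + by move=> z Sz Oz; exact: trivialization1.
  + by move=> c h Sc Oc Hh; exact: section1.
exists (chart (-1)), triv2, sect2; split.
+ by split=> //; exact: (open_preimage_chart (-1) (@smooth_id R 5)).
+ exact: smooth_triv2.
+ exact: smooth_sect2.
+ by move=> z Sz Oz; exact: trivialization2.
+ by move=> c h Sc Oc Hh; exact: section2.
Qed.

Lemma coinduced_S4 : poisson_manifold (S7 R) w7 -> coinduced (S7 R) w7 (S4 R) w4 hopf.
Proof.
move=> p7; apply: (coinduced_sphere p7).
- exact: smooth_hopf.
- exact: hopf_image.
- exact: smooth_w4.
- exact: hopf_push.
Qed.

End HopfBundle.

Theorem proposition3 (R : realType)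
    (delta w : coords R 4 4 -> 'M[R]_(4 * 4 + 4 * 4)) :
  coboundary_lie_bialgebra delta ->
  standard_values delta ->
  poisson_lie w ->
  tangent_cobracket w delta ->
  coisotropic_subgroup w (SU2dg R) /\
  exists w7 : coords R 1 4 -> 'M[R]_(1 * 4 + 1 * 4),
    [/\ quotient_map (U3 R) (U4 R) (S7 R) last_row,
        coinduced (U4 R) w (S7 R) w7 last_row
      & exists (p : coords R 1 4 -> 'rV[R]_5) (w4 : 'rV[R]_5 -> 'M[R]_5),
          poisson_bundle (SU2dg R) (fun z h => cmul z h)
            (S7 R) w7 (S4 R) w4 p].
Proof.
move=> cob std pl tc.
have wE : forall x, U4 R x -> w x = coboundary rmat (Lmx x) (Rmx x).
  by apply: (poisson_lie_U4 pl tc) => X; exact: (cobracket_rmat cob std).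
split; first by split; [exact: SU2dg_lie_subgroup|exact: SU2dg_coisotropic].
have c7 := coinduced_S7 pl.1 wE.
exists w7; split; [exact: last_row_quotient|exact: c7|].
exists hopf, w4; split; [exact: hopf_principal_bundle|by case: c7|].
by apply: coinduced_S4; case: c7.
Qed.
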